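(* If $M$ is a maximal simple regular matroid of rank six, then one of the following holds: (1) $M$ is graphic and $\operatorname{sys}_3^*(M)=\tfrac{6}{7}$. (2) $M$ is cographic and $\operatorname{sys}_3^*(M)\leq 1$. (3) $M$ is (isomorphic to) the parallel connection $P(M(K_3),R_{10})$ or the generalized parallel connection $P_T(M(K_5),M^*(K_{3,3}))$ and, in either case, $\operatorname{sys}_3^*(M)=\tfrac{12}{13}$.
   Context: Matroids are finite. A maximal simple regular matroid of rank $d$ is a simple regular matroid of rank $d$ that is not isomorphic to a proper restriction of another simple regular matroid of rank $d$. $M(G)$ is the cycle matroid of a graph $G$ and $M^*(G)$ is its dual; a matroid is graphic (cographic) if it is isomorphic to some $M(G)$ (some $M^*(G)$). A triple of cocircuits $C_1^*,C_2^*,C_3^*$ has the non-inclusion property if $C_h^*\not\subseteq C_i^*\cup C_j^*$ for all $\{h,i,j\}=\{1,2,3\}$. For a matroid $M$ with ground set $E$ of rank at least three, the $3$-cosystole is $$\operatorname{sys}_3^*(M)=\max_\mu\ \min\ \sum_{i=1}^3\mu(C_i^* ),$$ where the maximum runs over functions $\mu:E\to\mathbb{R}_{\geq 0}$ with $\mu(E)=1$, the minimum runs over all triples of cocircuits of $M$ with the non-inclusion property, and $\mu(X)=\sum_{e\in X}\mu(e)$. $P(M(K_3),R_{10})$ is the $12$-element parallel connection of $M(K_3)$ and the sporadic regular matroid $R_{10}$ along an element; it is the vector matroid over $\mathbb{Z}_2$ on the columns of $$A_{12}=\begin{pmatrix} 1&1&0&0&0&0&0&0&0&0&0&0\\ 1&0&1&0&0&0&0&1&1&0&0&1\\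 0&0&0&1&0&0&0&1&1&1&0&0\\ 0&0&0&0&1&0&0&0&1&1&1&0\\ 0&0&0&0&0&1&0&0&0&1&1&1\\ 0&0&0&0&0&0&1&1&0&0&1&1 \end{pmatrix}$$ (the last five rows and last ten columns represent $R_{10}$). $P_T(M(K_5),M^*(K_{3,3}))$ is the $16$-element generalized parallel connection of $M(K_5)$ and $M^*(K_{3,3})$ across a triangle (three-element circuit) $T$; it is the vector matroid over $\mathbb{Z}_2$ on the columns of $$A_{16}=\begin{pmatrix} 1&0&0&0&0&0&1&1&1&0&0&0&1&1&0&0\\ 0&1&0&0&0&0&1&1&0&1&0&0&1&1&0&0\\ 0&0&1&0&0&0&1&0&0&0&1&0&0&0&0&1\\ 0&0&0&1&0&0&0&1&0&0&0&1&0&0&0&1\\ 0&0&0&0&1&0&0&0&1&0&1&1&0&1&1&0\\ 0&0&0&0&0&1&0&0&0&1&1&1&0&1&1&0 \end{pmatrix}.$$ *)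

(* Defs.v *)
From HB Require Import structures.
From mathcomp Require Import all_boot all_order all_algebra.
From mathcomp Require Import boolp reals.

Set Implicit Arguments.
Unset Strict Implicit.
Unset Printing Implicit Defensive.

Import Order.TTheory GRing.Theory Num.Theory.
Local Open Scope ring_scope.

Record matroid (E : finType) := Matroid {
  indep : pred {set E};
  indep0 : indep set0;
  indepS : forall I J : {set E}, I \subset J -> indep J -> indep I;
  indepX : forall I J : {set E}, indep I -> indep J -> (#|I| < #|J|)%N ->
    exists2 e, e \in J :\: I & indep (e |: I) }.

Section Matroids.
Variables (E : finType) (M : matroid E).
Implicit Types (I J B C X : {set E}).

Definition basis B : bool := maxset (indep M) B.

Definition circuit C : bool := minset (fun X => ~~ indep M X) C.

Definition rank : nat := \max_(I : {set E} | indep M I) #|I|.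

(* Loops are the one-element circuits, parallel pairs the two-element ones. *)
Definition simple : Prop := forall C, circuit C -> (2 < #|C|)%N.

Lemma indep_extend I J : indep M I -> indep M J -> (#|I| <= #|J|)%N ->
  exists B, [/\ I \subset B, B \subset I :|: J, indep M B & #|B| = #|J|].
Proof.
have [k] := ubnP (#|J| - #|I|)%N; elim: k I => // k IHk I lek iI iJ leIJ.
have [ltIJ|geIJ] := ltnP #|I| #|J|; last first.
  exists I; split; rewrite ?subsetUl //.
  by apply/eqP; rewrite eqn_leq leIJ.
have [e /setDP[eJ eI] ieI] := indepX iI iJ ltIJ.
have cI : #|e |: I| = #|I|.+1 by rewrite cardsU1 eI.
have [||B [sIB sBU iB cB]] := IHk (e |: I) _ ieI iJ.
- by rewrite cI; move: lek; rewrite subnS ltnS; apply: leq_trans; rewrite ltn_predL subn_gt0.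
- by rewrite cI.
exists B; split=> //; first by apply: subset_trans sIB; apply: subsetUr.
apply: subset_trans sBU _; apply/subsetP=> x; rewrite !inE.
by case/orP=> [/orP[/eqP->|->]|->]; rewrite ?eJ ?orbT.
Qed.

Lemma basis_indep B : basis B -> indep M B.
Proof. by case/maxsetP. Qed.

Lemma leq_card_basis B I : basis B -> indep M I -> (#|I| <= #|B|)%N.
Proof.
move=> /maxsetP[iB maxB] iI; rewrite leqNgt; apply/negP=> ltBI.
have [e /setDP[_ eB] ieB] := indepX iB iI ltBI.
by move: eB; rewrite -(maxB _ ieB (subsetUr _ _)) setU11.
Qed.

Lemma basis_card B I : basis B -> indep M I -> #|I| = #|B| -> basis I.
Proof.
move=> bB iI cI; apply/maxsetP; split=> // J iJ sIJ.
by apply/esym/eqP; rewrite eqEcard sIJ cI leq_card_basis.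
Qed.

Definition dual_indep : pred {set E} :=
  fun X => [exists B, basis B && [disjoint X & B]].

Lemma dual_indep0 : dual_indep set0.
Proof.
have [B bB _] := maxset_exists (indep0 M).
by apply/existsP; exists B; rewrite /basis bB disjoints_subset sub0set.
Qed.

Lemma dual_indepS I J : I \subset J -> dual_indep J -> dual_indep I.
Proof.
move=> sIJ /existsP[B /andP[bB dJ]]; apply/existsP; exists B.
by rewrite bB (disjointWl _ dJ).
Qed.

Lemma dual_indepX I J : dual_indep I -> dual_indep J -> (#|I| < #|J|)%N ->
  exists2 e, e \in J :\: I & dual_indep (e |: I).
Proof.
move=> /existsP[BI /andP[bI dI]] /existsP[BJ /andP[bJ dJ]] ltIJ.
have iD : indep M (BJ :\: I) by apply: indepS (subsetDl _ _) (basis_indep bJ).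
have [|B [sB sBU iB cB]] := indep_extend iD (basis_indep bI).
  exact: leq_card_basis bI iD.
have bB : basis B := basis_card bI iB cB.
have dB : [disjoint I & B].
  rewrite disjoint_sym; apply: disjointWl sBU _.
  rewrite -setI_eq0 setIUl setU_eq0 !setI_eq0 [X in _ && X]disjoint_sym dI.
  by rewrite disjoints_subset setDE subsetIr.
have [sJB|/subsetPn[e eJI eB]] := boolP (J :\: I \subset B); last first.
  exists e => //; apply/existsP; exists B; rewrite bB.
  by rewrite -setI_eq0 setIUl setU_eq0 !setI_eq0 dB andbT disjoints1.
have cIJ : (#|I :\: J| < #|J :\: I|)%N.
  by rewrite -(ltn_add2l #|I :&: J|) cardsID setIC cardsID.
have cU : #|(BJ :\: I) :|: (J :\: I)| = (#|BJ :\: I| + #|J :\: I|)%N.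
  apply/eqP; rewrite (leq_card_setU (BJ :\: I) (J :\: I)).2.
  apply: disjointWl (subsetDl _ _) _; rewrite disjoint_sym.
  exact: disjointWl (subsetDl _ _) dJ.
have: (#|BJ :\: I| + #|J :\: I| <= #|B|)%N.
  by rewrite -cU subset_leq_card // subUset sB.
have cBJ : #|B| = #|BJ|.
  by apply/eqP; rewrite eqn_leq !leq_card_basis ?basis_indep.
rewrite cBJ -(cardsID I BJ) addnC leq_add2r leqNgt => /negP[].
apply: leq_ltn_trans cIJ; apply: subset_leq_card.
rewrite subsetD subsetIr /=; apply: disjointWl (subsetIl _ _) _.
by rewrite disjoint_sym.
Qed.

Definition dual : matroid E := Matroid dual_indep0 dual_indepS dual_indepX.

Definition restr_indep X : pred {set {x | x \in X}} :=
  fun I : {set {x | x \in X}} => indep M [set val x | x in I].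

Lemma restr_indep0 X : @restr_indep X set0.
Proof. by rewrite /restr_indep imset0 indep0. Qed.

Lemma restr_indepS X (I J : {set {x | x \in X}}) :
  I \subset J -> restr_indep J -> restr_indep I.
Proof. by move=> sIJ; apply: indepS; apply: imsetS. Qed.

Lemma restr_indepX X (I J : {set {x | x \in X}}) :
  restr_indep I -> restr_indep J -> (#|I| < #|J|)%N ->
  exists2 e, e \in J :\: I & restr_indep (e |: I).
Proof.
move=> iI iJ ltIJ.
have [|e /setDP[/imsetP[x xJ ->] xI] ix] := indepX iI iJ.
  by rewrite !card_imset //; apply: val_inj.
exists x; last by rewrite /restr_indep imsetU1.
by rewrite inE xJ andbT; apply: contra xI; apply: imset_f.
Qed.

Definition restriction X : matroid {x | x \in X} :=
  Matroid (@restr_indep0 X) (@restr_indepS X) (@restr_indepX X).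

End Matroids.

Definition cocircuit (E : finType) (M : matroid E) (C : {set E}) : bool :=
  circuit (dual M) C.

Definition isomorphic (E F : finType) (M : matroid E) (N : matroid F) : Prop :=
  exists2 f : E -> F, bijective f &
    forall I : {set E}, indep N [set f x | x in I] = indep M I.

Section VectorMatroid.
Variables (K : fieldType) (V : vectType K) (E : finType) (v : E -> V).
Implicit Types I J : {set E}.

Definition free_on I : bool := free [seq v e | e <- enum I].

Lemma free_onU1 e I : e \notin I ->
  free_on (e |: I) = (v e \notin <<[seq v x | x <- enum I]>>%VS) && free_on I.
Proof.
move=> eI; rewrite /free_on -free_cons -map_cons; apply: perm_free.
apply: perm_map; apply: uniq_perm; rewrite ?enum_uniq //=.
  by rewrite enum_uniq mem_enum eI.
by move=> x; rewrite in_cons !mem_enum !inE.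
Qed.

Lemma free_on0 : free_on set0.
Proof. by rewrite /free_on enum_set0 nil_free. Qed.

Lemma free_onS I J : I \subset J -> free_on J -> free_on I.
Proof.
move=> sIJ; rewrite /free_on.
have /perm_free-> : perm_eq [seq v e | e <- enum J]
  ([seq v e | e <- enum I] ++ [seq v e | e <- enum (J :\: I)]).
  rewrite -map_cat; apply: perm_map; apply: uniq_perm; rewrite ?enum_uniq //.
    rewrite cat_uniq !enum_uniq andbT /=; apply/hasPn=> x.
    by rewrite !mem_enum !inE => /andP[].
  move=> x; rewrite mem_cat !mem_enum !inE; case: (boolP (x \in I)) => //=.
  by move/(subsetP sIJ).
exact: catl_free.
Qed.

Lemma free_onX I J : free_on I -> free_on J -> (#|I| < #|J|)%N ->
  exists2 e, e \in J :\: I & free_on (e |: I).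
Proof.
move=> fI fJ ltIJ; apply/exists_inP; apply: contraTT ltIJ => /exists_inPn noE.
rewrite -leqNgt !cardE -(size_map v (enum J)) -(size_map v (enum I)).
rewrite -(eqP fI) -(eqP fJ); apply: dimvS; apply/span_subvP=> _ /mapP[e + ->].
rewrite mem_enum => eJ; case: (boolP (e \in I)) => eI.
  by apply: memv_span; apply: map_f; rewrite mem_enum.
have := noE e; rewrite !inE eI eJ => /(_ isT).
by rewrite free_onU1 // fI andbT negbK.
Qed.

Definition linear_matroid : matroid E := Matroid free_on0 free_onS free_onX.

Lemma free_onPn I : ~~ free_on I ->
  exists2 k : E -> K, \sum_(e in I) k e *: v e = 0 &
    exists2 e, e \in I & k e != 0.
Proof.
have spanP (s : seq E) (u : V) : uniq s -> u \in <<[seq v e | e <- s]>>%VS ->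
    exists k : E -> K, u = \sum_(e <- s) k e *: v e.
  elim: s u => [|x s IHs] u /=.
    by rewrite span_nil memv0 => _ /eqP->; exists (fun=> 0); rewrite big_nil.
  case/andP=> xs us; rewrite span_cons => /memv_addP[_ /vlineP[c ->]].
  case=> w /(IHs _ us)[k ->] ->.
  exists (fun y => if y == x then c else k y); rewrite big_cons eqxx.
  congr (_ + _); apply: eq_big_seq => y ys.
  by case: eqP => // yx; rewrite -yx ys in xs.
have freePn (s : seq E) : uniq s -> ~~ free [seq v e | e <- s] ->
    exists2 k : E -> K, \sum_(e <- s) k e *: v e = 0 &
      exists2 e, e \in s & k e != 0.
  elim: s => [|x s IHs] /=; first by rewrite nil_free.
  case/andP=> xs us; rewrite free_cons negb_and negbK.
  have extE c (k : E -> K) :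
      \sum_(e <- x :: s) (if e == x then c else k e) *: v e =
      c *: v x + \sum_(e <- s) k e *: v e.
    rewrite big_cons eqxx; congr (_ + _); apply: eq_big_seq => y ys.
    by case: eqP => // yx; rewrite -yx ys in xs.
  case/orP=> [/(spanP _ _ us)[k vx]|/(IHs us)[k k0 [e es ke]]].
    exists (fun y => if y == x then - 1 else k y).
      by rewrite extE -vx scaleN1r addNr.
    by exists x; rewrite ?mem_head // eqxx oppr_eq0 oner_eq0.
  exists (fun y => if y == x then 0 else k y).
    by rewrite extE k0 scale0r addr0.
  exists e; first by rewrite in_cons es orbT.
  by have [ex|//] := eqVneq e x; move: xs; rewrite -ex es.
move=> /(freePn _ (enum_uniq _))[k k0 [e eI ke]].
by exists k; [rewrite -big_enum | exists e; rewrite // -mem_enum].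
Qed.

End VectorMatroid.

(* The vector matroid A[K] on the columns of A. *)
Definition vector_matroid (K : fieldType) (m n : nat) (A : 'M[K]_(m, n)) :
  matroid 'I_n := linear_matroid (fun j : 'I_n => col j A).

Definition totally_unimodular (m n : nat) (A : 'M[rat]_(m, n)) : Prop :=
  forall (k : nat) (f : 'I_k -> 'I_m) (g : 'I_k -> 'I_n),
    injective f -> injective g -> \det (mxsub f g A) \in [:: 0; 1; -1].

(* Entries of a totally unimodular matrix are 0, 1 or -1, so its columns have
   the same linear dependencies over the rationals as over the reals. *)
Definition regular (E : finType) (M : matroid E) : Prop :=
  exists (m n : nat) (A : 'M[rat]_(m, n)),
    totally_unimodular A /\ isomorphic M (vector_matroid A).

Definition maximal_simple_regular (d : nat) (E : finType) (M : matroid E) :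
  Prop :=
  [/\ simple M, regular M, rank M = d &
      forall (F : finType) (N : matroid F) (X : {set F}),
        simple N -> regular N -> rank N = d -> X \proper [set: F] ->
        ~ isomorphic M (restriction N X)].

(* Finite graphs, with loops and parallel edges allowed.  The order of the two
   ends of an edge carries no meaning. *)
Record graph := Graph {
  vertex : finType;
  edge : finType;
  ends : edge -> vertex * vertex }.

Section CycleMatroid.
Variable G : graph.
Implicit Types (X Y D : {set edge G}) (p q : seq (vertex G * edge G)).

Definition joins (e : edge G) (x y : vertex G) : bool :=
  (ends e == (x, y)) || (ends e == (y, x)).

(* p = [:: (x1, e1); ...; (xk, ek)] with ei joining xi to x(i+1), indices
   modulo k: a loop if k = 1, a pair of parallel edges if k = 2. *)
Definition graph_cycle p : bool :=
  [&& p != [::], uniq (map fst p), uniq (map snd p) &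
      cycle [rel a b | joins a.2 a.1 b.1] p].

Definition acyclic X : bool :=
  `[< forall p, graph_cycle p -> ~~ ([set e in map snd p] \subset X) >].

Let incidence (e : edge G) : {ffun vertex G -> ('F_2)^o} :=
  [ffun x => (x == (ends e).1)%:R + (x == (ends e).2)%:R].

Let adj D (x y : vertex G) : bool := [exists e in D, joins e x y].

Let F2_double (a : 'F_2) : a + a = 0.
Proof. by rewrite -mulr2n; apply/val_inj; case: a => [[|[|[]]]]. Qed.

Let joinsC e x y : joins e x y = joins e y x.
Proof. by rewrite /joins orbC. Qed.

Let incidence_joins e x y : joins e x y ->
  forall z, incidence e z = (z == x)%:R + (z == y)%:R.
Proof.
by move=> /orP[] /eqP eE z; rewrite ffunE eE /= // addrC.
Qed.

Let path_edges D (p : seq (vertex G)) s : path (adj D) s p -> uniq (s :: p) ->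
  exists q : seq (vertex G * edge G),
    [/\ map fst q = belast s p, all (mem D) (map snd q), uniq (map snd q),
        (forall d x y, d \in map snd q -> joins d x y -> x \in s :: p) &
        forall x0 e0 e1, joins e0 x0 s ->
          path [rel a b | joins a.2 a.1 b.1] (x0, e0)
               (rcons q (last s p, e1))].
Proof.
elim: p s => [|w p IHp] s /=.
  by move=> _ _; exists [::]; split=> //= x0 e0 e1 ->.
case/andP=> /exists_inP[d dD dsw] pp /andP[sp up].
have [q [q1 qD uq qs qp]] := IHp w pp up.
exists ((s, d) :: q); split=> /=.
- by rewrite q1.
- by rewrite dD.
- rewrite uq andbT; apply: contra sp => dq; exact: (qs _ _ _ dq dsw).
- move=> d' x y; rewrite !inE => /orP[/eqP->|dq j]; last first.
    by have := qs _ _ _ dq j; rewrite inE => ->; rewrite orbT.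
  move: dsw => /orP[] /eqP eE; rewrite /joins eE => /orP[] /eqP[-> ->];
    by rewrite ?eqxx ?orbT.
- by move=> x0 e0 e1 ->; apply: qp.
Qed.

Let cycle_sum p : graph_cycle p -> \sum_(e <- map snd p) incidence e = 0.
Proof.
case: p => [|a p] // /and4P[_ _ _ cp]; rewrite big_map.
apply/ffunP=> z; rewrite sum_ffunE [RHS]ffunE.
have H : forall q b c, path [rel a b | joins a.2 a.1 b.1] b (rcons q c) ->
    \sum_(x <- b :: q) incidence x.2 z = (z == b.1)%:R + (z == c.1)%:R.
  elim=> [|d q IHq] b c /=.
    by rewrite andbT big_seq1 => /incidence_joins->.
  case/andP=> /incidence_joins jb /IHq; rewrite big_cons jb => ->.
  by rewrite -addrA [X in _ + X]addrA F2_double add0r.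
by rewrite (H _ _ _ cp) F2_double.
Qed.

Let sum_delta (P : pred (vertex G)) x :
  \sum_(z | P z) (z == x)%:R = (P x)%:R :> 'F_2.
Proof.
case: (boolP (P x)) => Px; last first.
  by rewrite big1 // => z Pz; case: eqP => // zx; rewrite -zx Pz in Px.
by rewrite (bigD1 x) //= eqxx big1 ?addr0 // => z /andP[_ /negPf->].
Qed.

Lemma acyclicE X : acyclic X = free_on incidence X.
Proof.
apply/asboolP/idP => [acX|fX p cp]; last first.
  apply/negP=> sX; have/(free_onS sX) := fX.
  have uq : uniq (map snd p) by case/and4P: cp.
  rewrite /free_on (@perm_free _ _ _ (map incidence (map snd p))); last first.
    apply: perm_map; apply: uniq_perm; rewrite ?enum_uniq // => x.
    by rewrite mem_enum inE.
  move=> /(@freeP _ _ _ (in_tuple _)) /(_ (fun=> 1)).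
  have pn : (0 < size (map incidence (map snd p)))%N.
    by rewrite !size_map; case/and4P: cp; case: (p).
  have -> : \sum_(i < size (map incidence (map snd p)))
      1 *: (in_tuple (map incidence (map snd p)))`_i = 0.
    rewrite -[RHS](cycle_sum cp).
    rewrite -(big_map incidence xpredT id) (big_nth 0) big_mkord; apply: eq_bigr => i _.
    by rewrite scale1r; apply: set_nth_default.
  by move=> /(_ erefl (Ordinal pn)).
apply/negPn/negP=> nfX.
have [k k0 [e0 e0X ke0]] := free_onPn nfX.
pose D := [set e in X | k e != 0].
have sumD : \sum_(e in D) incidence e = 0.
  rewrite -[RHS]k0 [RHS](bigID (fun e => k e != 0)) /= [X in _ + X]big1 ?addr0.
    apply: eq_big => e; rewrite inE // => /andP[_].
    case: (k e) => [[|[|[]]] //= h] _.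
    by rewrite (_ : Ordinal h = 1) ?scale1r //; apply: val_inj.
  by move=> e /andP[_ /negbNE/eqP->]; rewrite scale0r.
have sDX : D \subset X by apply/subsetP=> e; rewrite inE => /andP[].
have e0D : e0 \in D by rewrite inE e0X.
case eE: (ends e0) => [t s].
have j0 : joins e0 t s by rewrite /joins eE eqxx.
have adjC x y : adj (D :\ e0) x y = adj (D :\ e0) y x.
  by apply: eq_existsb => e; rewrite joinsC.
have : connect (adj (D :\ e0)) s t.
  apply/negPn/negP => nst.
  have := congr1 (fun f : {ffun vertex G -> ('F_2)^o} =>
    \sum_(z | connect (adj (D :\ e0)) s z) f z) sumD.
  rewrite [RHS]big1; last by move=> z _; rewrite ffunE.
  under eq_bigr do rewrite sum_ffunE.
  rewrite exchange_big /= (bigD1 e0) //= [X in _ + X]big1; last first.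
    move=> e /andP[eD ee0].
    case eE': (ends e) => [x y].
    have je : joins e x y by rewrite /joins eE' eqxx.
    under eq_bigr do rewrite (incidence_joins je).
    have axy : adj (D :\ e0) x y.
      by apply/exists_inP; exists e => //; rewrite in_setD1 ee0.
    have cxy : connect (adj (D :\ e0)) s x = connect (adj (D :\ e0)) s y.
      apply/idP/idP=> h; apply: connect_trans h _; apply: connect1 => //.
      by rewrite adjC.
    by rewrite big_split /= !sum_delta cxy F2_double.
  under eq_bigr do rewrite (incidence_joins j0).
  by rewrite big_split /= !sum_delta connect0 (negPf nst).
case/connectP=> p0 pp0 tE.
case/shortenP: pp0 tE => p pp up _ tE.
have [q [q1 qD uq _ qp]] := path_edges pp up.
have gc : graph_cycle ((t, e0) :: q).
  apply/and4P; split=> //=.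
  - rewrite q1 tE; have := up; rewrite lastI rcons_uniq => /andP[-> ->] //.
  - rewrite uq andbT; apply/negP=> /(allP qD); by rewrite /= !inE eqxx.
  - by have := qp t e0 e0 j0; rewrite -tE.
have /negP[] := acX _ gc; apply: subset_trans sDX; apply/subsetP=> e.
rewrite !inE => /orP[/eqP->|/(allP qD)]; first by rewrite e0X.
by rewrite /= !inE => /andP[].
Qed.

Lemma acyclic0 : acyclic set0.
Proof. by rewrite acyclicE free_on0. Qed.

Lemma acyclicS X Y : X \subset Y -> acyclic Y -> acyclic X.
Proof. by rewrite !acyclicE; apply: free_onS. Qed.

Lemma acyclicX X Y : acyclic X -> acyclic Y -> (#|X| < #|Y|)%N ->
  exists2 e, e \in Y :\: X & acyclic (e |: X).
Proof.
rewrite !acyclicE => fX fY /(free_onX fX fY)[e eYX fe].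
by exists e; rewrite ?acyclicE.
Qed.

Definition cycle_matroid : matroid (edge G) :=
  Matroid acyclic0 acyclicS acyclicX.

End CycleMatroid.

Definition graphic (E : finType) (M : matroid E) : Prop :=
  exists G : graph, isomorphic M (cycle_matroid G).

Definition cographic (E : finType) (M : matroid E) : Prop :=
  exists G : graph, isomorphic M (dual (cycle_matroid G)).

Section Cosystole.
Variables (R : realType) (E : finType) (M : matroid E).
Implicit Types (mu : E -> R) (s : R) (C : {set E}).

Definition is_min (S : R -> Prop) s : Prop := S s /\ forall x, S x -> s <= x.
Definition is_max (S : R -> Prop) s : Prop := S s /\ forall x, S x -> x <= s.

Definition non_inclusion C1 C2 C3 : bool :=
  [&& ~~ (C1 \subset C2 :|: C3), ~~ (C2 \subset C1 :|: C3) &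
      ~~ (C3 \subset C1 :|: C2)].

Definition weight mu : Prop := (forall e, 0 <= mu e) /\ \sum_e mu e = 1.

Definition measure mu C : R := \sum_(e in C) mu e.

Definition triple_measure mu s : Prop :=
  exists C1 C2 C3,
    [/\ [/\ cocircuit M C1, cocircuit M C2 & cocircuit M C3],
        non_inclusion C1 C2 C3 &
        s = measure mu C1 + measure mu C2 + measure mu C3].

(* s is the 3-cosystole of M; meaningful when M has rank at least three.  The
   relation asserts that the minimum and the maximum are attained. *)
Definition is_cosystole3 s : Prop :=
  is_max (fun m => exists2 mu, weight mu & is_min (triple_measure mu) m) s.

End Cosystole.

Definition mx_of_rows (m n : nat) (rows : seq (seq nat)) : 'M['F_2]_(m, n) :=
  \matrix_(i < m, j < n) (nth 0%N (nth [::] rows i) j)%:R.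

(* The last five rows and the last ten columns represent R10. *)
Definition A12 : 'M['F_2]_(6, 12) := mx_of_rows 6 12 [::
  [:: 1; 1; 0; 0; 0; 0; 0; 0; 0; 0; 0; 0];
  [:: 1; 0; 1; 0; 0; 0; 0; 1; 1; 0; 0; 1];
  [:: 0; 0; 0; 1; 0; 0; 0; 1; 1; 1; 0; 0];
  [:: 0; 0; 0; 0; 1; 0; 0; 0; 1; 1; 1; 0];
  [:: 0; 0; 0; 0; 0; 1; 0; 0; 0; 1; 1; 1];
  [:: 0; 0; 0; 0; 0; 0; 1; 1; 0; 0; 1; 1]]%N.

Definition A16 : 'M['F_2]_(6, 16) := mx_of_rows 6 16 [::
  [:: 1; 0; 0; 0; 0; 0; 1; 1; 1; 0; 0; 0; 1; 1; 0; 0];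
  [:: 0; 1; 0; 0; 0; 0; 1; 1; 0; 1; 0; 0; 1; 1; 0; 0];
  [:: 0; 0; 1; 0; 0; 0; 1; 0; 0; 0; 1; 0; 0; 0; 0; 1];
  [:: 0; 0; 0; 1; 0; 0; 0; 1; 0; 0; 0; 1; 0; 0; 0; 1];
  [:: 0; 0; 0; 0; 1; 0; 0; 0; 1; 0; 1; 1; 0; 1; 1; 0];
  [:: 0; 0; 0; 0; 0; 1; 0; 0; 0; 1; 1; 1; 0; 1; 1; 0]]%N.

(* The parallel connection P(M(K3), R10) along an element. *)
Definition P_K3_R10 : matroid 'I_12 := vector_matroid A12.

(* The generalized parallel connection of M(K5) and M*(K33) across a
   triangle. *)
Definition PT_K5_K33dual : matroid 'I_16 := vector_matroid A16.

(* Main.v *)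
(* A regular matroid of rank six is represented by integer vectors all of whose
   6 x 6 determinants are 0, 1 or -1.  Their reductions modulo 2 form a spanning
   set S of nonzero vectors of F_2^6 such that, in coordinates over a basis taken
   from S, neither the Fano matrix nor its transpose occurs among the vectors of
   S.  Up to linear isomorphism S is contained in one of eleven targets: M(K7),
   the two matroids of case (3), and M*(G) for eight cubic graphs G on ten
   vertices.  As the targets are regular, S is a target by maximality.

   To see the containment, start from a basis and settle configurations X inside
   S one after the other.  X is settled when every further vector v belongs to a
   fixed target containing X, or cannot be in S because X + v has a Fano minor, or
   completes X to a configuration containing a copy of a settled one.

   The cosystole of a target is found by linear programming duality.  In each case
   the optimal weights give every cocircuit at least one third of the value, and a
   weighted family of triples covering no element too often bounds it from above. *)

From Corelib Require Import BinNums.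
From mathcomp Require Import all_boot all_order all_algebra all_fingroup.
From mathcomp Require Import boolp reals zify ring lra.
From Stdlib Require BinNat.
Require Import Defs.

Set Implicit Arguments.
Unset Strict Implicit.
Unset Printing Implicit Defensive.

Import Order.TTheory GRing.Theory Num.Theory.
Local Open Scope ring_scope.

Number Notation N BinNat.N.of_num_uint BinNat.N.to_num_uint : N_scope.

(** * Unimodular representations *)

(** Excluding the Fano pattern is a matter of signs: after an integer change of basis all minors are
    0, 1 or -1, so an integer lift of the pattern has some 2 x 2 minors forced to vanish by parity,
    and these push a 3 x 3 minor to 2 or -2. Regularity of the targets is certified from the other
    side, by explicit signs. The size of the case analysis shapes the rest. A configuration is
    settled for all bases of F_2^6 at once, so every linear image of it is settled too. The script
    only names the linear map, and checking a reuse is a membership test instead of an isomorphism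
    search. Vectors, signs and graphs are plain lists, so that each certificate is verified by
    evaluation. For the cosystole, matroid notions become linear ones: a cocircuit is the support of
    one of the 63 nonzero functionals on F_2^6, and a triple of supports with the non-inclusion
    property contains a triple of cocircuits with it. Lower bounds can therefore be tested on all 63
    supports, and upper bounds may use any functionals. *)

Lemma free_onP (K : fieldType) (V : vectType K) (E : finType) (v : E -> V)
    (I : {set E}) :
  reflect (forall k : E -> K, \sum_(e in I) k e *: v e = 0 ->
             forall e, e \in I -> k e = 0) (free_on v I).
Proof.
apply: (iffP idP) => [fI k k0 e eI|H]; last first.
  apply/negPn/negP => /free_onPn[k k0 [e eI]].
  by rewrite (H k k0 e eI) eqxx.
have ltI : (index e (enum I) < size (map v (enum I)))%N.
  by rewrite size_map index_mem mem_enum.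
move: fI; rewrite /free_on => /(@freeP _ _ _ (in_tuple _)).
move=> /(_ (fun i => k (nth e (enum I) i))) H.
have -> : k e = k (nth e (enum I) (Ordinal ltI)) by rewrite /= nth_index ?mem_enum.
apply: H.
rewrite -[RHS]k0 -[RHS]big_enum /= (big_nth e) big_mkord size_map.
by apply: eq_bigr => i _; rewrite (nth_map e).
Qed.

Definition colsmx (R : Type) (r k : nat) (E : Type) (u : E -> 'cV[R]_r)
    (g : 'I_k -> E) : 'M[R]_(r, k) := \matrix_(i, j) u (g j) i 0.

Lemma colsmx_mul (R : pzRingType) (r s k : nat) (E : Type) (B : 'M[R]_(s, r))
    (u : E -> 'cV[R]_r) (g : 'I_k -> E) :
  colsmx (fun e => B *m u e) g = B *m colsmx u g.
Proof.
by apply/matrixP => i j; rewrite !mxE; apply: eq_bigr => l _; rewrite !mxE.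
Qed.

Lemma colsmx_map (R S : Type) (f : R -> S) (r k : nat) (E : Type)
    (u : E -> 'cV[R]_r) (g : 'I_k -> E) :
  colsmx (fun e => map_mx f (u e)) g = map_mx f (colsmx u g).
Proof. by apply/matrixP => i j; rewrite !mxE. Qed.

Lemma colsmx_mulcV (R : comPzRingType) (r k : nat) (E : Type)
    (u : E -> 'cV[R]_r) (g : 'I_k -> E) (x : 'cV[R]_k) :
  colsmx u g *m x = \sum_j x j 0 *: u (g j).
Proof.
apply/matrixP => i j; rewrite ord1 !mxE summxE; apply: eq_bigr => l _.
by rewrite !mxE mulrC.
Qed.

Lemma det_neq0_inj (K : fieldType) (r : nat) (A : 'M[K]_r) :
  (forall x : 'cV[K]_r, A *m x = 0 -> x = 0) -> \det A != 0.
Proof.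
move=> H; rewrite -det_tr; apply/negP => /det0P[x xn0 /(congr1 trmx)].
rewrite trmx_mul trmxK trmx0 => /H/(congr1 trmx); rewrite trmxK trmx0.
by move=> x0; rewrite x0 eqxx in xn0.
Qed.

Section FreeColumns.
Variables (K : fieldType) (E : finType).

Lemma sum_imset (V : zmodType) (k : nat) (g : 'I_k -> E) (F : E -> V) :
  injective g -> \sum_(e in [set g i | i : 'I_k]) F e = \sum_i F (g i).
Proof.
move=> gi; rewrite big_imset /=; last by move=> i j _ _; apply: gi.
by apply: eq_bigl => i; rewrite !inE.
Qed.

Lemma free_on_colsP (m k : nat) (v : E -> 'cV[K]_m) (g : 'I_k -> E) :
  injective g ->
  reflect (forall x : 'cV[K]_k, colsmx v g *m x = 0 -> x = 0)
          (free_on v [set g i | i : 'I_k]).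
Proof.
move=> gi; apply: (iffP (free_onP _ _)) => [H x|H c].
  rewrite colsmx_mulcV => x0; apply/matrixP => i j; rewrite ord1 !mxE.
  (* The coefficient vector is transported along the inverse of [g], with value 0 off its image. *)
  pose c e := if [pick i | g i == e] is Some i then x i 0 else 0.
  have cE i' : c (g i') = x i' 0.
    rewrite /c; case: pickP => [i'' /eqP/gi->//|/(_ i')]; by rewrite eqxx.
  rewrite -cE; apply: H; last by apply: imset_f.
  by rewrite sum_imset // -[RHS]x0; apply: eq_bigr => i' _; rewrite cE.
rewrite sum_imset // => c0 _ /imsetP[i _ ->].
have /matrixP/(_ i 0) : \col_j c (g j) = 0 :> 'cV_k.
  apply: H; rewrite colsmx_mulcV -[RHS]c0; apply: eq_bigr => j _.
  by rewrite mxE.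
by rewrite !mxE.
Qed.

Lemma free_on_det (r : nat) (v : E -> 'cV[K]_r) (g : 'I_r -> E) :
  injective g -> free_on v [set g i | i : 'I_r] = (\det (colsmx v g) != 0).
Proof.
move=> gi; apply/(free_on_colsP v gi)/idP => [|nz x]; first exact: det_neq0_inj.
have U : colsmx v g \in unitmx by rewrite unitmxE unitfE.
by move/(congr1 (mulmx (invmx (colsmx v g)))); rewrite mulKmx // mulmx0.
Qed.

Lemma free_on_card (r : nat) (v : E -> 'cV[K]_r) (I : {set E}) :
  free_on v I -> (#|I| <= r)%N.
Proof.
rewrite /free_on /free => /eqP; rewrite size_map -cardE => <-.
by apply: leq_trans (dimvS (subvf _)) _; rewrite dimvf /dim /= muln1.
Qed.

End FreeColumns.

Lemma enum_imset (E : finType) (I : {set E}) (r : nat) :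
  #|I| = r -> exists2 g : 'I_r -> E, injective g & I = [set g i | i : 'I_r].
Proof.
move=> cI; have [x0 _|I0] := pickP (mem I); last first.
  have r0 : r = 0%N by rewrite -cI; apply: eq_card0.
  subst r; rewrite r0; exists (fun i : 'I_0 => match i with Ordinal _ h => False_rect _ (notF h) end).
    by case.
  by apply/setP => x; rewrite [x \in I]I0; apply/esym/negbTE/negP => /imsetP[[]].
have sI : size (enum I) = r by rewrite -cardE.
exists (fun i : 'I_r => nth x0 (enum I) i).
  move=> i j /eqP; rewrite nth_uniq ?sI ?enum_uniq //.
  by move=> /eqP; apply: val_inj.
apply/setP => x; apply/idP/imsetP => [xI|[i _ ->]].
  have lt : (index x (enum I) < r)%N by rewrite -sI index_mem mem_enum.
  by exists (Ordinal lt); rewrite //= nth_index ?mem_enum.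
by rewrite -mem_enum; apply: mem_nth; rewrite sI.
Qed.

Lemma card_imset_inj (E : finType) (r : nat) (g : 'I_r -> E) :
  injective g -> #|[set g i | i : 'I_r]| = r.
Proof. by move=> gi; rewrite card_imset // card_ord. Qed.

Lemma extend_card (E : finType) (M : matroid E) (I J : {set E}) :
  indep M I -> indep M J -> (#|I| <= #|J|)%N ->
  exists2 B : {set E}, I \subset B & indep M B && (#|B| == #|J|).
Proof.
move=> iI iJ le; have [B [sB _ iB cB]] := indep_extend iI iJ le.
by exists B; rewrite // iB cB eqxx.
Qed.

(** Any independent set extends to one with [r] elements, where the two matroids agree; [J] shows
    that size [r] is reached. Comparing two representations thus comes down to [r] x [r]
    determinants. *)
Lemma eq_indep_of_bases (E : finType) (M N : matroid E) (r : nat) :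
  (forall I, indep M I -> (#|I| <= r)%N) ->
  (forall I, indep N I -> (#|I| <= r)%N) ->
  (forall I : {set E}, #|I| = r -> indep M I = indep N I) ->
  (exists2 J : {set E}, #|J| = r & indep M J) ->
  forall I, indep M I = indep N I.
Proof.
move=> cM cN eqB [J cJ iJ] I; apply/idP/idP => iI.
  have [|B sB /andP[iB /eqP cB]] := extend_card iI iJ; first by rewrite cJ cM.
  by apply: indepS sB _; rewrite -eqB // cB.
have iJN : indep N J by rewrite -eqB.
have [|B sB /andP[iB /eqP cB]] := extend_card iI iJN; first by rewrite cJ cN.
by apply: indepS sB _; rewrite eqB // cB.
Qed.

Definition sign01 (R : pzRingType) : seq R := [:: 0; 1; -1].

(** Constraining the maximal minors only makes the notion invariant under integer base change with
    determinant 1 or -1. [g] ranges over all maps, a repeated column contributing just the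
    determinant 0. *)
Definition unimodular (E : Type) (r : nat) (u : E -> 'cV[int]_r) : Prop :=
  forall g : 'I_r -> E, \det (colsmx u g) \in sign01 int.

Lemma colsmx_unit (E : Type) (r : nat) (u : E -> 'cV[int]_r) (g : 'I_r -> E) :
  unimodular u -> \det (colsmx u g) != 0 -> colsmx u g \in unitmx.
Proof.
by move=> /(_ g); rewrite unitmxE !inE => /or3P[] /eqP ->.
Qed.

Definition modr (R : pzRingType) (r : nat) (x : 'cV[int]_r) : 'cV[R]_r :=
  map_mx intr x.

Lemma det_modr (R : comNzRingType) (E : Type) (r : nat) (u : E -> 'cV[int]_r)
    (g : 'I_r -> E) :
  unimodular u ->
  (\det (colsmx (fun e => modr R (u e)) g) != 0) = (\det (colsmx u g) != 0).
Proof.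
move=> /(_ g) uu; rewrite colsmx_map det_map_mx.
by move: uu; rewrite !inE => /or3P[] /eqP ->; rewrite ?rmorph0 ?eqxx // ?rmorphN ?rmorph1 ?oppr_eq0 ?oner_eq0.
Qed.

(** A maximal minor equal to 0, 1 or -1 vanishes in one field exactly when it does in every other,
    so both fields give the same bases. *)
Lemma unimodular_free_on (K L : fieldType) (E : finType) (r : nat)
    (u : E -> 'cV[int]_r) (g : 'I_r -> E) :
  unimodular u -> injective g -> \det (colsmx u g) != 0 ->
  forall I, free_on (fun e => modr K (u e)) I = free_on (fun e => modr L (u e)) I.
Proof.
move=> uu gi nz.
pose MK := linear_matroid (fun e => modr K (u e)).
pose ML := linear_matroid (fun e => modr L (u e)).
apply: (@eq_indep_of_bases _ MK ML r).
- by move=> I; apply: free_on_card.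
- by move=> I; apply: free_on_card.
- move=> I /enum_imset[h hi ->].
  by rewrite [LHS](free_on_det _ hi) [RHS](free_on_det _ hi) !det_modr.
- exists [set g i | i : 'I_r]; first by rewrite card_imset_inj.
  by rewrite [indep _ _](free_on_det _ gi) det_modr.
Qed.

Lemma free_on_imset (K : fieldType) (V : vectType K) (E F : finType)
    (f : E -> F) (v : F -> V) (I : {set E}) :
  injective f -> free_on v [set f x | x in I] = free_on (v \o f) I.
Proof.
move=> fi; rewrite /free_on (map_comp v f); apply: perm_free.
apply: perm_map.
apply: uniq_perm; rewrite ?map_inj_uniq ?enum_uniq // => y.
rewrite mem_enum; apply/imsetP/mapP => [[x xI ->]|[x xI ->]].
  by exists x; rewrite ?mem_enum.
by exists x; rewrite // -mem_enum.
Qed.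

Lemma span_colsP (K : fieldType) (E : finType) (m k : nat) (v : E -> 'cV[K]_m)
    (g : 'I_k -> E) (w : 'cV[K]_m) :
  injective g -> w \in <<[seq v e | e <- enum [set g i | i : 'I_k]]>>%VS ->
  exists x : 'cV[K]_k, w = colsmx v g *m x.
Proof.
move=> gi wS; pose X := [tuple v (g i) | i < k].
have : w \in <<X>>%VS.
  rewrite (@eq_span _ _ _ [seq v e | e <- enum [set g i | i : 'I_k]]) // => y.
  apply/mapP/mapP => [[i _ ->]|[e]]; first by exists (g i); rewrite ?mem_enum ?imset_f.
  by rewrite mem_enum => /imsetP[i _ ->] ->; exists i; rewrite ?mem_enum.
move/coord_span => ->; exists (\col_i coord X i w).
rewrite colsmx_mulcV; apply: eq_bigr => i _.
by rewrite mxE -tnth_nth tnth_mktuple.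
Qed.

Lemma rank_basis (E : finType) (M : matroid E) :
  exists2 J : {set E}, #|J| = rank M & indep M J.
Proof.
have := @eq_bigmax_cond _ (indep M) (fun I : {set E} => #|I|).
case; last by move=> J iJ e; exists J.
by apply/card_gt0P; exists set0; apply: indep0.
Qed.

Lemma leq_rank (E : finType) (M : matroid E) (I : {set E}) :
  indep M I -> (#|I| <= rank M)%N.
Proof. by move=> iI; rewrite /rank (leq_bigmax_cond _ iI). Qed.

Lemma det_cols_noninj (R : comPzRingType) (E : Type) (r : nat) (u : E -> 'cV[R]_r)
    (g : 'I_r -> E) i j :
  i != j -> g i = g j -> \det (colsmx u g) = 0.
Proof.
move=> ne gij; rewrite -det_tr; apply: (determinant_alternate ne) => k.
by rewrite !mxE gij.
Qed.

(** The totally unimodular matrix may have more rows than the rank. If [C] holds its columns on a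
    basis and [rho] selects rows on which [C] is invertible, every column is a combination of [C];
    cutting down to the rows [rho] replaces [C] by an invertible matrix and so keeps all
    dependencies. *)
Lemma regular_unimodular (E : finType) (M : matroid E) : regular M ->
  exists u : E -> 'cV[int]_(rank M),
    [/\ unimodular u,
        exists2 g : 'I_(rank M) -> E, injective g & \det (colsmx u g) != 0 &
        forall I, indep M I = free_on (fun e => modr rat (u e)) I].
Proof.
case=> m [n [A [tu [f bf fI]]]]; set r := rank M.
have fi := bij_inj bf.
pose v e := col (f e) A.
have iE I : indep M I = free_on v I by rewrite -fI [LHS]free_on_imset.
have [J cJ iJ] := rank_basis M.
have [g gi Jg] := enum_imset cJ.
pose C := colsmx v g.
have Cinj (x : 'cV_r) : C *m x = 0 -> x = 0.
  by move: iJ; rewrite iE Jg => /(free_on_colsP v gi)/(_ x).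
have fC : row_full C.
  suff: row_free C^T by rewrite /row_free mxrank_tr.
  apply: inj_row_free => y /(congr1 trmx).
  rewrite trmx_mul trmxK trmx0 => /Cinj/(congr1 trmx).
  by rewrite trmxK trmx0.
pose rho := fullrankfun fC.
have rhoi : injective rho by apply: fullrankfun_inj.
have Cu : rowsub rho C \in unitmx by rewrite -row_full_unit fullrowsub_full.
have A01 i j : A i j \in sign01 rat.
  have := tu 1%N (fun=> i) (fun=> j) _ _.
  rewrite det_mx11 mxE; apply; by move=> x y _; rewrite !ord1.
(* The entries are 0, 1 or -1, hence equal to their numerators. *)
pose u e : 'cV[int]_r := \col_i numq (v e (rho i) 0).
have uE e : modr rat (u e) = rowsub rho (v e).
  apply/matrixP => i j; rewrite ord1 !mxE.
  by have := A01 (rho i) (f e); rewrite !inE => /or3P[] /eqP->.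
have detE (h : 'I_r -> E) :
    (\det (colsmx u h))%:~R = \det (mxsub rho (f \o h) A).
  rewrite -det_map_mx -colsmx_map; congr (\det _); apply/matrixP => i j.
  by have /matrixP/(_ i 0) := uE (h j); rewrite !mxE.
have uu : unimodular u.
  (* Total unimodularity covers distinct columns; otherwise two columns coincide and the determinant
     is 0. *)
  move=> h; have [hi|] := boolP (injectiveb h).
    have := tu r rho (f \o h) rhoi (inj_comp fi (injectiveP _ hi)).
    rewrite -detE !inE -[1%R in X in X -> _]/(1%:~R) -[0%R in X in X -> _]/(0%:~R).
    by rewrite -mulrNz !eqr_int.
  case/injectivePn => i [j ne e].
  by rewrite (det_cols_noninj _ _ e) ?inE ?eqxx // eq_sym.
have spanE e : exists x : 'cV_r, v e = C *m x.
  apply: span_colsP => //; rewrite -Jg.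
  have [eJ|eJ] := boolP (e \in J).
    by apply: memv_span; apply: map_f; rewrite mem_enum.
  apply: contraT => ve; have : indep M (e |: J).
    by rewrite iE free_onU1 // ve -iE.
  by move/leq_rank; rewrite cardsU1 eJ cJ ltnn.
(* One coefficient matrix [X] serves for the full columns over [C] and for the shortened columns
   over the selected rows of [C]. *)
have uX (h : 'I_r -> E) : exists X : 'M_r,
    colsmx v h = C *m X /\ colsmx (fun e => modr rat (u e)) h = rowsub rho C *m X.
  have [x xE] := fin_all_exists (fun i => spanE (h i)).
  pose X : 'M_r := \matrix_(i, j) x j i 0.
  have CX : colsmx v h = C *m X.
    apply/matrixP => i j; rewrite mxE xE !mxE; apply: eq_bigr => k _.
    by rewrite !mxE.
  exists X; split=> //; rewrite mul_rowsub_mx -CX; apply/matrixP => i j.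
  by rewrite mxE uE !mxE.
exists u; split=> //.
  exists g => //; rewrite -(det_modr rat) // -unitfE -unitmxE.
  congr (_ \in unitmx): Cu; apply/matrixP => i j.
  by have /matrixP/(_ i 0) := uE (g j); rewrite !mxE.
move=> I; apply: (@eq_indep_of_bases _ M (linear_matroid (fun e => modr rat (u e))) r).
- exact: leq_rank.
- by move=> {}I; apply: free_on_card.
- move=> {}I /enum_imset[h hi ->]; rewrite iE [RHS](free_on_det _ hi).
  have [X [CX uhX]] := uX h.
  rewrite uhX det_mulmx mulf_eq0 negb_or.
  have -> /= : \det (rowsub rho C) != 0 by rewrite -unitfE -unitmxE.
  apply/(free_on_colsP v hi)/idP => [H|nz x]; last first.
    rewrite CX -mulmxA => /Cinj.
    by move/(congr1 (mulmx (invmx X))); rewrite mulKmx ?unitmxE ?unitfE // mulmx0.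
  apply: det_neq0_inj => x X0; apply: H.
  by rewrite CX -mulmxA X0 mulmx0.
- by exists J.
Qed.

(** * Signs exclude the Fano matroid and its dual *)

Lemma det_mx22 (R : comPzRingType) (A : 'M[R]_2) :
  \det A = A 0 0 * A 1 1 - A 0 1 * A 1 0.
Proof.
rewrite (expand_det_row _ ord0) !big_ord_recl big_ord0 /cofactor !det_mx11 !mxE.
rewrite /= /bump /= !addn0 expr0 expr1 mul1r addr0 mulN1r mulrN.
by congr (_ * A _ _ - A _ _ * A _ _); apply: val_inj.
Qed.

Lemma det_mx33 (R : comPzRingType) (A : 'M[R]_3) (a : nat -> nat -> R) :
  (forall i j : 'I_3, A i j = a i j) ->
  \det A = a 0 0 * (a 1 1 * a 2 2 - a 1 2 * a 2 1)
         - a 0 1 * (a 1 0 * a 2 2 - a 1 2 * a 2 0)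
         + a 0 2 * (a 1 0 * a 2 1 - a 1 1 * a 2 0).
Proof.
move=> AE; rewrite (expand_det_row _ ord0) !big_ord_recl big_ord0 /cofactor.
rewrite !det_mx22 !mxE !AE /= /bump /=.
rewrite !addn0 !expr0 !expr1 !exprS expr0.
by ring.
Qed.

(** Each 2 x 2 minor is a difference of two signs, hence even, hence 0. So (a,b), (c,d), (e,f) are
    proportional to (p,q), (p,r), (q,r), and the determinant of the rows (a,b,0), (c,0,d), (0,e,f)
    becomes -2acepr. The zeros stay in the formula to match [det_rows3]. *)
Lemma fano_sign (a b c d e f p q r : int) :
  `|a| = 1 -> `|b| = 1 -> `|c| = 1 -> `|d| = 1 -> `|e| = 1 -> `|f| = 1 ->
  `|p| = 1 -> `|q| = 1 -> `|r| = 1 ->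
  a * q - b * p \in sign01 int -> c * r - d * p \in sign01 int ->
  e * r - f * q \in sign01 int ->
  a * (0 * f - d * e) - b * (c * f - d * 0) + 0 * (c * e - 0 * 0)
    \notin sign01 int.
Proof.
have N1 (x : int) : `|x| = 1 -> x * x = 1 by lia.
have M1 (x y : int) : `|x| = 1 -> `|y| = 1 -> `|x * y| = 1.
  by move=> x1 y1; rewrite normrM x1 y1.
have E2 (x y : int) : `|x| = 1 -> `|y| = 1 -> x - y \in sign01 int -> x = y.
  by rewrite !inE; lia.
move=> a1 b1 c1 d1 e1 f1 p1 q1 r1.
move=> /(E2 _ _ (M1 _ _ a1 q1) (M1 _ _ b1 p1)) aq.
move=> /(E2 _ _ (M1 _ _ c1 r1) (M1 _ _ d1 p1)) cr.
move=> /(E2 _ _ (M1 _ _ e1 r1) (M1 _ _ f1 q1)) er.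
have bE : b = a * q * p by rewrite aq -mulrA (N1 _ p1) mulr1.
have dE : d = c * r * p by rewrite cr -mulrA (N1 _ p1) mulr1.
have fE : f = e * r * q by rewrite er -mulrA (N1 _ q1) mulr1.
have -> : a * (0 * f - d * e) - b * (c * f - d * 0) + 0 * (c * e - 0 * 0) =
    - (a * c * e * p * r) * (1 + q * q).
  by rewrite bE dE fE; ring.
have := M1 _ _ (M1 _ _ (M1 _ _ (M1 _ _ a1 c1) e1) p1) r1.
by rewrite (N1 _ q1) !inE; lia.
Qed.

Lemma sign01M (x y : int) :
  x \in sign01 int -> y \in sign01 int -> x * y \in sign01 int.
Proof. by rewrite !inE => /or3P[]/eqP-> /or3P[]/eqP->. Qed.

Section Minors.
Variables (E : Type) (c : E -> 'cV[int]_6) (g : 'I_6 -> E).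
Hypothesis uc : unimodular c.
Hypothesis cg : forall i, c (g i) = delta_mx i 0.

(* Completing the three columns by three basis columns gives a 6x6 minor with
   the same value. *)
Lemma unimodular_minor_top (y : 'I_3 -> E) :
  \det (\matrix_(i < 3, j < 3) c (y j) (lshift 3 i) 0) \in sign01 int.
Proof.
pose h (j : 'I_(3 + 3)) := match split j with inl j' => y j' | inr _ => g j end.
have := uc h; set A := colsmx c h.
suff -> : A = block_mx (\matrix_(i < 3, j < 3) c (y j) (lshift 3 i) 0) 0
                       (\matrix_(i < 3, j < 3) c (y j) (rshift 3 i) 0) 1%:M.
  by rewrite (@det_lblock _ 3 3) det1 mulr1.
apply/matrixP => i j; rewrite [LHS]mxE /h; move: i j.
(* ['I_6] and ['I_(3 + 3)] are convertible, but splitting the indices and the blocks requires the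
   sum form. *)
change (forall i j : 'I_(3 + 3),
  c (match split j with inl j' => y j' | inr _ => g j end) i 0 =
  block_mx (\matrix_(i < 3, j < 3) c (y j) (lshift 3 i) 0) 0
                       (\matrix_(i < 3, j < 3) c (y j) (rshift 3 i) 0) 1%:M i j).
move=> i j; case: (split_ordP j) => j' ->; case: (split_ordP i) => i' ->.
- by rewrite block_mxEul mxE.
- by rewrite block_mxEdl mxE.
- by rewrite block_mxEur cg !mxE (@eq_lrshift 3 3).
- by rewrite block_mxEdr cg !mxE (@eq_rshift 3 3) andbT.
Qed.

End Minors.

(** Permuting the rows by [s] changes maximal minors by a sign and turns [g] composed with [s] into
    the unit columns, so the top three rows may be replaced by any three. *)
Lemma unimodular_minor (E : Type) (c : E -> 'cV[int]_6) (g : 'I_6 -> E)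
    (s : 'S_6) (y : 'I_3 -> E) :
  unimodular c -> (forall i, c (g i) = delta_mx i 0) ->
  \det (\matrix_(i < 3, j < 3) c (y j) (s (lshift 3 i)) 0) \in sign01 int.
Proof.
move=> uc cg.
have -> : \matrix_(i < 3, j < 3) c (y j) (s (lshift 3 i)) 0 =
          \matrix_(i < 3, j < 3) (fun e => row_perm s (c e)) (y j) (lshift 3 i) 0.
  by apply/matrixP => i j; rewrite !mxE.
apply: (@unimodular_minor_top E (fun e => row_perm s (c e)) (g \o s)) => [h|i] /=.
  have -> : colsmx (fun e => row_perm s (c e)) h = perm_mx s *m colsmx c h.
    by rewrite -row_permE; apply/matrixP => i j; rewrite !mxE.
  rewrite det_mulmx det_perm; apply: sign01M (uc h).
  by rewrite !inE; case: odd_perm; rewrite ?expr0 ?expr1.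
by apply/matrixP => k l; rewrite cg !mxE (inj_eq perm_inj).
Qed.

Lemma perm_pair (T : finType) (x0 x1 i j : T) :
  x0 != x1 -> i != j -> exists2 s : {perm T}, s x0 = i & s x1 = j.
Proof.
move=> x01 ij; pose s0 := tperm x0 i; pose j' := s0 j.
have j'x0 : j' != x0.
  by rewrite /j' /s0 -(inj_eq (@perm_inj _ (tperm x0 i))) tpermK tpermL eq_sym.
exists (tperm x1 j' * s0)%g; rewrite permM.
  by rewrite tpermD // 1?eq_sym // /s0 tpermL.
by rewrite tpermL /j' /s0 tpermK.
Qed.

Definition rows3 (R : Type) (a b c : R) (i : 'I_3) : R := nth a [:: a; b; c] i.

Lemma det_rows3 (R : comPzRingType) (A : 'M[R]_3) (a b c d e f p q r : R) :
  (forall i j, A i j = rows3 (rows3 a b c j) (rows3 d e f j) (rows3 p q r j) i) ->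
  \det A = a * (e * r - f * q) - b * (d * r - f * p) + c * (d * q - e * p).
Proof.
move=> AE.
by rewrite (det_mx33 (a := fun i j => nth 0 (nth [::] [:: [:: a; b; c];
  [:: d; e; f]; [:: p; q; r]] i) j)) // => -[[|[|[|]]] //= ?] [[|[|[|]]] //= ?]; rewrite AE.
Qed.

(** The third column is taken to be the unit vector of the third row [s (l ord_max)]; the 3 x 3
    minor then equals the 2 x 2 one. *)
Lemma unimodular_minor2 (E : Type) (c : E -> 'cV[int]_6) (g : 'I_6 -> E)
    (i j : 'I_6) (x y : E) :
  unimodular c -> (forall i, c (g i) = delta_mx i 0) -> i != j ->
  c x i 0 * c y j 0 - c y i 0 * c x j 0 \in sign01 int.
Proof.
move=> uc cg ij; pose l (k : 'I_3) : 'I_6 := lshift 3 k.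
have [s s0 s1] : exists2 s : 'S_6, s (l 0) = i & s (l 1) = j.
  exact: perm_pair.
have := unimodular_minor s (rows3 x y (g (s (l ord_max)))) uc cg.
rewrite (@det_rows3 _ _ (c x i 0) (c y i 0) 0 (c x j 0) (c y j 0) 0
  (c x (s (l ord_max)) 0) (c y (s (l ord_max)) 0) 1).
  by rewrite !mul0r !mulr1 !subr0.
have se (k k' : 'I_3) : (s (l k) == s (l k')) = (k == k').
  by rewrite (inj_eq perm_inj) /l (@eq_lshift 3 3).
have E0 (h : (0 < 3)%N) : s (l (Ordinal h)) = i by rewrite -s0; congr (s (l _)); apply: val_inj.
have E1 (h : (1 < 3)%N) : s (l (Ordinal h)) = j by rewrite -s1; congr (s (l _)); apply: val_inj.
have E2 (h : (2 < 3)%N) : s (l (Ordinal h)) = s (l ord_max) by congr (s (l _)); apply: val_inj.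
have i2 : (i == s (l ord_max)) = false by rewrite -s0 se.
have j2 : (j == s (l ord_max)) = false by rewrite -s1 se.
move=> [[|[|[|]]] // h] [[|[|[|]]] // h']; rewrite mxE /rows3 /= -/(l _) ?E0 ?E1 ?E2 //.
- by rewrite cg mxE i2.
- by rewrite cg mxE j2.
- by rewrite cg mxE eqxx.
Qed.

(** Paired with the basis element [g j] of another row [j], the 2 x 2 minor reduces to the entry
    itself. *)
Lemma unimodular_entry (E : Type) (c : E -> 'cV[int]_6) (g : 'I_6 -> E)
    (i : 'I_6) (x : E) :
  unimodular c -> (forall i, c (g i) = delta_mx i 0) -> c x i 0 \in sign01 int.
Proof.
move=> uc cg; have [j ij] : exists j : 'I_6, i != j.
  by have [->|] := eqVneq i 0; [exists 1 | exists 0].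
have := unimodular_minor2 x (g j) uc cg ij.
by rewrite cg !mxE eqxx (negPf ij) mulr1 mul0r subr0.
Qed.

Lemma even_sign01 (x : int) : x \in sign01 int -> x%:~R = 0 :> 'F_2 -> x = 0.
Proof. by rewrite !inE => /or3P[]/eqP->. Qed.

Lemma odd_sign01 (x : int) : x \in sign01 int -> x%:~R = 1 :> 'F_2 -> `|x| = 1.
Proof. by rewrite !inE => /or3P[]/eqP->. Qed.

Definition i6 (k : nat) : 'I_6 := inord k.

Section NoFano.
Variables (E : Type) (c : E -> 'cV[int]_6) (g : 'I_6 -> E).
Hypothesis uc : unimodular c.
Hypothesis cg : forall i, c (g i) = delta_mx i 0.

Let parity (y : E) (k : nat) : 'F_2 := (c y (i6 k) 0)%:~R.

Let even y k : parity y k = 0 -> c y (i6 k) 0 = 0.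
Proof. by apply: even_sign01; apply: unimodular_entry uc cg. Qed.

Let odd y k : parity y k = 1 -> `|c y (i6 k) 0| = 1.
Proof. by apply: odd_sign01; apply: unimodular_entry uc cg. Qed.

Let minor_top (y1 y2 y3 : E) :
  \det (\matrix_(i < 3, j < 3) c (rows3 y1 y2 y3 j) (i6 i) 0) \in sign01 int.
Proof.
have := unimodular_minor_top uc cg (rows3 y1 y2 y3).
have -> // : \matrix_(i < 3, j < 3) c (rows3 y1 y2 y3 j) (lshift 3 i) 0 =
  \matrix_(i < 3, j < 3) c (rows3 y1 y2 y3 j) (i6 i) 0.
apply/matrixP => i j; rewrite !mxE; congr (c _ _ _).
by apply: val_inj; rewrite /= inordK // (leq_trans (ltn_ord i)).
Qed.

Let minor2 (i j : nat) (x y : E) : (i < j < 6)%N ->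
  c x (i6 i) 0 * c y (i6 j) 0 - c y (i6 i) 0 * c x (i6 j) 0 \in sign01 int.
Proof.
case/andP=> ij j6; apply: unimodular_minor2 uc cg _.
by rewrite -val_eqE /= !inordK ?(ltn_trans ij) // neq_ltn ij.
Qed.

(** Reading only coordinates 0 to 2 amounts to contracting the other three basis elements: with the
    three that remain, the four vectors form F7. The signs of [y4] are the p, q, r of
    [fano_sign]. *)
Lemma no_fano (y1 y2 y3 y4 : E) :
  parity y1 0 = 1 -> parity y1 1 = 1 -> parity y1 2 = 0 ->
  parity y2 0 = 1 -> parity y2 1 = 0 -> parity y2 2 = 1 ->
  parity y3 0 = 0 -> parity y3 1 = 1 -> parity y3 2 = 1 ->
  parity y4 0 = 1 -> parity y4 1 = 1 -> parity y4 2 = 1 -> False.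
Proof.
move=> /odd a /odd b /even z1 /odd c1 /even z2 /odd d /even z3 /odd e /odd f.
move=> /odd p /odd q /odd r.
have m1 := @minor2 0 1 y1 y4 isT; have m2 := @minor2 0 2 y2 y4 isT.
have m3 := @minor2 1 2 y3 y4 isT.
(* After transposition the vectors are the rows, as in [fano_sign]; for the dual pattern below they
   already sit in the right place. *)
have := minor_top y1 y2 y3; apply/negP; rewrite -det_tr.
rewrite (@det_rows3 _ _ (c y1 (i6 0) 0) (c y1 (i6 1) 0) 0 (c y2 (i6 0) 0) 0
  (c y2 (i6 2) 0) 0 (c y3 (i6 1) 0) (c y3 (i6 2) 0)).
  apply: fano_sign a b c1 d e f p q r _ _ _.
  - by rewrite [X in _ - X]mulrC.
  - by rewrite [X in _ - X]mulrC.
  - by rewrite [X in _ - X]mulrC.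
by move=> [[|[|[|]]] // h] [[|[|[|]]] // h']; rewrite !mxE /rows3 /= ?z1 ?z2 ?z3.
Qed.

(** Now coordinates 0 to 3 matter, and the three vectors with four basis elements form the dual of
    F7. The pattern is the transpose of the previous one, so p, q, r form coordinate 3 instead of a
    fourth vector. *)
Lemma no_dual_fano (y1 y2 y3 : E) :
  parity y1 0 = 1 -> parity y1 1 = 1 -> parity y1 2 = 0 -> parity y1 3 = 1 ->
  parity y2 0 = 1 -> parity y2 1 = 0 -> parity y2 2 = 1 -> parity y2 3 = 1 ->
  parity y3 0 = 0 -> parity y3 1 = 1 -> parity y3 2 = 1 -> parity y3 3 = 1 ->
  False.
Proof.
move=> /odd a /odd c1 /even z1 /odd p /odd b /even z2 /odd e /odd q.
move=> /even z3 /odd d /odd f /odd r.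
have m1 := @minor2 0 3 y1 y2 isT; have m2 := @minor2 1 3 y1 y3 isT.
have m3 := @minor2 2 3 y2 y3 isT.
have := minor_top y1 y2 y3; apply/negP.
rewrite (@det_rows3 _ _ (c y1 (i6 0) 0) (c y2 (i6 0) 0) 0 (c y1 (i6 1) 0) 0
  (c y3 (i6 1) 0) 0 (c y2 (i6 2) 0) (c y3 (i6 2) 0)).
  exact: fano_sign a b c1 d e f p q r m1 m2 m3.
by move=> [[|[|[|]]] // h] [[|[|[|]]] // h']; rewrite !mxE /rows3 /= ?z1 ?z2 ?z3.
Qed.

End NoFano.

(** * Checking configurations of binary vectors *)

(** Lists are read as padded by zeros, [[::]] being the zero vector of any length. The functions on
    them are bare recursions on booleans, which [lazy] can evaluate. *)
Definition bvec : Type := seq bool.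

Fixpoint bxor (x y : bvec) : bvec :=
  match x, y with
  | [::], _ => y
  | _, [::] => x
  | a :: x', b :: y' => xorb a b :: bxor x' y'
  end.

Fixpoint bcomb (b : seq bvec) (x : bvec) : bvec :=
  match b, x with
  | v :: b', c :: x' => if c then bxor v (bcomb b' x') else bcomb b' x'
  | _, _ => [::]
  end.

Fixpoint comb (V : zmodType) (b : seq V) (x : bvec) : V :=
  match b, x with
  | v :: b', c :: x' => (if c then v else 0) + comb b' x'
  | _, _ => 0
  end.

(** Lists the combinations in the order of [ball], each new one obtained from an earlier one by a
    single [bxor]. *)
Fixpoint bspan (b : seq bvec) : seq bvec :=
  match b with
  | [::] => [:: [::]]
  | v :: b' => let s := bspan b' in s ++ map (bxor v) s
  end.

Fixpoint ball (n : nat) : seq bvec :=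
  match n with
  | 0 => [:: [::]]
  | n'.+1 => let s := ball n' in map (cons false) s ++ map (cons true) s
  end.

Fixpoint bnz (x : bvec) : bool :=
  match x with [::] => false | a :: x' => if a then true else bnz x' end.

Fixpoint beq (x y : bvec) : bool :=
  match x, y with
  | [::], [::] => true
  | a :: x', b :: y' => if xorb a b then false else beq x' y'
  | _, _ => false
  end.

Fixpoint bmem (x : bvec) (s : seq bvec) : bool :=
  match s with [::] => false | y :: s' => if beq x y then true else bmem x s' end.

Lemma beqP (x y : bvec) : beq x y -> x = y.
Proof. by elim: x y => [|[] x IHx] [|[] y] //= /IHx->. Qed.

Lemma bmemP (x : bvec) s : bmem x s -> x \in s.
Proof.
elim: s => //= y s IHs; rewrite in_cons; case: ifP => [/beqP-> _|_ /IHs->].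
  by rewrite eqxx.
by rewrite orbT.
Qed.

Lemma mem_ball (x : bvec) : x \in ball (size x).
Proof.
by elim: x => //= [[] x IHx]; rewrite mem_cat; apply/orP; [right|left];
  apply/mapP; exists x.
Qed.

Lemma bspanE (b : seq bvec) : bspan b = map (bcomb b) (ball (size b)).
Proof.
elim: b => //= v b ->; rewrite map_cat -!map_comp; congr (_ ++ _).
Qed.

(** The head of [bspan b] is the combination with all coefficients 0; no later one may vanish. *)
Definition bindep (b : seq bvec) : bool :=
  if bspan b is _ :: s then all bnz s else false.

Lemma ball_cons n : ball n = nseq n false :: behead (ball n).
Proof. by elim: n => //= n ->. Qed.

Lemma bnz_nseq n : bnz (nseq n false) = false.
Proof. by elim: n. Qed.

Lemma bcomb_nseq b k : bcomb b (nseq k false) = [::].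
Proof. by elim: b k => [|v b IHb] [|k] //=. Qed.

Lemma bcomb_pad b x k : bcomb b (x ++ nseq k false) = bcomb b x.
Proof.
elim: b x => [|v b IHb] [|c x] //=; last by rewrite IHb.
by case: k {IHb} => //= k; rewrite bcomb_nseq.
Qed.

Lemma bnz_pad x k : bnz (x ++ nseq k false) = bnz x.
Proof. by elim: x => [|[] x IHx] //=; rewrite bnz_nseq. Qed.

Lemma bindepP (b : seq bvec) (x : bvec) : bindep b ->
  (size x <= size b)%N -> bnz (bcomb b x) = false -> bnz x = false.
Proof.
rewrite /bindep bspanE ball_cons /= => /allP H sx.
rewrite -(bcomb_pad b x (size b - size x)) -(bnz_pad x (size b - size x)).
set y := x ++ _; have sy : size y = size b by rewrite size_cat size_nseq subnKC.
have := mem_ball y; rewrite sy ball_cons in_cons => /orP[/eqP->|yb bx].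
  by rewrite bnz_nseq.
by have := H _ (map_f _ yb); rewrite bx.
Qed.

Lemma size_bxor n (x y : bvec) :
  (size x <= n)%N -> (size y <= n)%N -> (size (bxor x y) <= n)%N.
Proof.
by elim: x y n => [|a x IHx] [|b y] [|n] //=; rewrite !ltnS; apply: IHx.
Qed.

Lemma size_bcomb n (b : seq bvec) (x : bvec) :
  all (fun v => size v <= n)%N b -> (size (bcomb b x) <= n)%N.
Proof.
elim: b x => [|v b IHb] [|c x] //= /andP[vn bn].
by case: c; [apply: size_bxor => //|]; apply: IHb.
Qed.

Section Comb.
Variable V : zmodType.
Hypothesis V2 : forall v : V, v + v = 0.
Implicit Types b : seq V.

Lemma comb_nil b : comb b [::] = 0.
Proof. by case: b. Qed.

Lemma comb_bxor b x y : comb b (bxor x y) = comb b x + comb b y.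
Proof.
elim: x b y => [|a x IHx] [|v b] [|c y] //=; rewrite ?addr0 ?add0r //.
rewrite IHx addrACA; congr (_ + _).
by case: a c => [] [] /=; rewrite ?V2 ?addr0 ?add0r.
Qed.

Lemma comb_bcomb b (c : seq bvec) x : comb b (bcomb c x) = comb (map (comb b) c) x.
Proof.
elim: c x => [|v c IHc] [|[] x] //=; rewrite ?comb_nil ?comb_bxor ?IHc //.
by rewrite add0r.
Qed.

Lemma comb_bnz b x : bnz x = false -> comb b x = 0.
Proof. by elim: x b => [|[] x IHx] [|v b] //= /IHx->; rewrite addr0. Qed.

(* Coefficient lists shorter than six are padded by zeros. *)
Definition is_basis b : Prop :=
  size b = 6 /\ forall x, (size x <= 6)%N -> comb b x = 0 -> bnz x = false.

Lemma is_basis_bcomb b (c : seq bvec) :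
  is_basis b -> size c = 6 -> all (fun v => size v <= 6)%N c -> bindep c ->
  is_basis (map (comb b) c).
Proof.
move=> [sb fb] sc c6 ic; split; first by rewrite size_map.
move=> x x6; rewrite -comb_bcomb => /(fb _ (size_bcomb _ c6)).
by apply: bindepP; rewrite ?sc.
Qed.

End Comb.

(** * The search script and its soundness *)

Fixpoint pos_bits (k : nat) (p : positive) : bvec :=
  match k, p with
  | 0, _ => [::]
  | k'.+1, xH => true :: nseq k' false
  | k'.+1, xO q => false :: pos_bits k' q
  | k'.+1, xI q => true :: pos_bits k' q
  end.

Definition bv (n : N) : bvec :=
  match n with N0 => nseq 6 false | Npos p => pos_bits 6 p end.

Lemma size_pos_bits k p : size (pos_bits k p) = k.
Proof. by elim: k p => [|k IHk] [p|p|] //=; rewrite ?IHk ?size_nseq. Qed.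

Lemma size_bv n : size (bv n) = 6.
Proof. by case: n => // p; exact: size_pos_bits. Qed.

(* The vector coded by a number has its binary digits, lowest first, as
   coordinates.  For the current configuration X, which S is assumed to contain:
   [Fano v c ys]: X + v contains a basis c over which the vectors with
     coordinates ys exhibit F7 or its dual, so v is not in S;
   [Known v k c]: X + v contains the image, under the linear map sending the
     unit vectors to c, of the k-th configuration already settled;
   [Push v]: pass to X + v;
   [Pop t c]: every v not yet excluded lies in the image of the t-th target
     under the linear map sending the unit vectors to c; X is settled. *)
Inductive step :=
  | Fano of N & seq N & seq N
  | Known of N & nat & seq N
  | Push of N
  | Pop of nat & seq N.

Definition basis_ok (c : seq bvec) : bool := (size c == 6) && bindep c.

Definition known_ok (P Y c : seq bvec) : bool :=
  basis_ok c && all (fun x => bmem (bcomb c x) Y) P.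

Fixpoint beqs (s t : seq bvec) : bool :=
  match s, t with
  | [::], [::] => true
  | x :: s', y :: t' => if beq x y then beqs s' t' else false
  | _, _ => false
  end.

Lemma beqsP s t : beqs s t -> s = t.
Proof. by elim: s t => [|x s IHs] [|y t] //=; case: ifP => // /beqP-> /IHs->. Qed.

(* The columns of the standard representations of F7 and of its dual that lie
   outside the basis. *)
Definition fano_pattern (ys : seq bvec) : bool :=
  beqs (map (take 3) ys) [:: [:: true; true; false]; [:: true; false; true];
                             [:: false; true; true]; [:: true; true; true]] ||
  beqs (map (take 4) ys) [:: [:: true; true; false; true];
    [:: true; false; true; true]; [:: false; true; true; true]].

Definition fano_ok (Y c ys : seq bvec) : bool :=
  [&& basis_ok c, all (bmem^~ Y) c, all (fun y => bmem (bcomb c y) Y) ys &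
    fano_pattern ys].

Definition units6 : seq bvec := [seq bv n | n <- [:: 32; 16; 8; 4; 2; 1]%num].

Section Run.
Variable targets : seq (seq N).

Definition target_image (t : nat) (c : seq bvec) : seq bvec :=
  [seq bcomb c (bv n) | n <- nth [::] targets t].

Definition pop_ok (T c : seq bvec) (t : nat) : bool :=
  [&& basis_ok c, (t < size targets)%N &
    let L := target_image t c in
    all (fun v => if bmem v T then true else bmem v L) (behead (ball 6))].

(* [fr] is a stack of pairs (vectors assumed in S, vectors whose presence in S
   settles the claim); [H] lists the settled configurations. *)
Fixpoint run (s : seq step) (fr : seq (seq bvec * seq bvec))
    (H : seq (seq bvec)) : seq (seq bvec) :=
  match s, fr with
  | Fano v c ys :: s', (X, T) :: fr' =>
      if fano_ok (bv v :: X) (map bv c) (map bv ys)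
      then run s' ((X, bv v :: T) :: fr') H else [::]
  | Known v k c :: s', (X, T) :: fr' =>
      if drop k H is P :: _ then
        if known_ok P (bv v :: X) (map bv c)
        then run s' ((X, bv v :: T) :: fr') H else [::]
      else [::]
  | Push v :: s', (X, T) :: fr' => run s' ((bv v :: X, T) :: fr) H
  | Pop t c :: s', (X, T) :: fr' =>
      if pop_ok T (map bv c) t then
        match fr', X with
        | (X', T') :: fr'', v :: X0 =>
            if beqs X0 X' then run s' ((X', v :: T') :: fr'') (rcons H X)
            else [::]
        | _, _ => rcons H X
        end
      else [::]
  | _, _ => H
  end.

Section Soundness.
Variables (V : zmodType) (inS : V -> Prop) (Good : Prop).
Hypothesis V2 : forall v : V, v + v = 0.

Definition holds (b : seq V) (X : seq bvec) : Prop :=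
  forall x, x \in X -> inS (comb b x).

(** Quantifying over all bases is what allows [Known] to reuse a settled configuration after an
    arbitrary linear change of coordinates. *)
Definition handled (X : seq bvec) : Prop :=
  forall b, is_basis b -> holds b X -> Good.

Hypothesis fano : forall b ys, is_basis b -> (forall v, v \in b -> inS v) ->
  holds b ys -> fano_pattern ys -> False.

Hypothesis total : forall b, is_basis b -> forall v, inS v ->
  exists2 x, x \in behead (ball 6) & v = comb b x.

Hypothesis target : forall b t, is_basis b -> (t < size targets)%N ->
  (forall v, inS v -> exists2 n, n \in nth [::] targets t & v = comb b (bv n)) ->
  Good.

Lemma basis_okP (b : seq V) (c : seq N) : is_basis b -> basis_ok (map bv c) ->
  is_basis (map (comb b) (map bv c)).
Proof.
move=> bb /andP[/eqP sc ic]; apply: is_basis_bcomb => //.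
by apply/allP => _ /mapP[n _ ->]; rewrite size_bv.
Qed.

Lemma holds_bcomb (b : seq V) Y c P :
  holds b Y -> all (fun x => bmem (bcomb c x) Y) P -> holds (map (comb b) c) P.
Proof.
by move=> hY /allP cP x /cP/bmemP/hY; rewrite comb_bcomb.
Qed.

Lemma fano_okP b Y c ys :
  is_basis b -> holds b Y -> fano_ok Y (map bv c) ys -> False.
Proof.
move=> bb hY /and4P[/(basis_okP bb) bb' /allP cY /(holds_bcomb hY) hc].
by apply: fano bb' _ hc => _ /mapP[x /cY/bmemP/hY xS ->].
Qed.

Definition settled X v := forall b, is_basis b -> holds b X -> inS (comb b v) -> Good.

Definition valid_frame (f : seq bvec * seq bvec) : Prop :=
  forall v, v \in f.2 -> settled f.1 v.

Lemma handled_settled v X : handled (v :: X) -> settled X v.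
Proof.
move=> h b bb hX bv; apply: (h b bb) => x; rewrite in_cons.
by case/orP=> [/eqP->|/hX].
Qed.

Lemma settled_sub v w X : settled X v -> settled (w :: X) v.
Proof.
by move=> h b bb hX; apply: (h b bb) => x xX; apply: hX; rewrite in_cons xX orbT.
Qed.

Lemma holds_cons b v X : holds b X -> inS (comb b v) -> holds b (v :: X).
Proof. by move=> hX bv x; rewrite in_cons => /orP[/eqP->|/hX]. Qed.

(** Either a vector of [T] is present, which settles the claim, or all of them are absent and every
    vector present passes the test of [pop_ok] by lying in the image of the target. *)
Lemma pop_handled X T t c : (forall v, v \in T -> settled X v) ->
  pop_ok T (map bv c) t -> handled X.
Proof.
move=> hT /and3P[/basis_okP bc tlt /allP ok] b bb hX.
have [[v [vT vS]]|noT] := EM (exists v, v \in T /\ inS (comb b v)).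
  exact: hT vT b bb hX vS.
apply: (target (bc b bb) tlt) => v vS.
have [x xb vE] := total bb vS; have := ok x xb.
case: ifP => [/bmemP xT|_ /bmemP/mapP[n nt xE]].
  by case: noT; exists x; rewrite -vE.
by exists n; rewrite // vE xE comb_bcomb.
Qed.

(** The invariant is that every frame holds only settled vectors in its second component and that
    every member of [H] is handled. A failed test returns the empty list, about which the conclusion
    says nothing. *)
Lemma run_sound s fr H :
  (forall f, f \in fr -> valid_frame f) ->
  (forall X, X \in H -> handled X) ->
  forall X, X \in run s fr H -> handled X.
Proof.
elim: s fr H => [|st s IHs] [|[X T] fr] H hfr hH //=; first by case: st.
have hT := hfr _ (mem_head _ _).
have hfr' f : f \in fr -> valid_frame f.
  by move=> ffr; apply: hfr; rewrite in_cons ffr orbT.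
have upd Y U : valid_frame (Y, U) -> forall f, f \in (Y, U) :: fr -> valid_frame f.
  by move=> YU f; rewrite in_cons => /orP[/eqP->|/hfr'].
have hcons v : settled X v -> valid_frame (X, v :: T).
  by move=> h w; rewrite in_cons => /orP[/eqP->|/hT].
case: st => [v c ys|v k c|v|t c].
- case: ifP => // ok; apply: IHs => //; apply: upd; apply: hcons.
  by move=> b bb hX vS; have := fano_okP bb (holds_cons hX vS) ok.
(* [H] grows at its end, so the index [k] keeps its meaning. [P] is handled for all bases, in
   particular for the image of [b] under [c]. *)
- case E: (drop k H) => [|P H'] //; case: ifP => // /andP[cb ok].
  apply: IHs => //; apply: upd; apply: hcons => b bb hX vS.
  have hP : handled P by apply: hH; apply: (@mem_drop k); rewrite E mem_head.
  by apply: (hP _ (basis_okP bb cb)); apply: holds_bcomb ok; apply: holds_cons.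
(* The new frame inherits [T], since a vector settled for a configuration is settled for any larger
   one. *)
- apply: IHs => // f; rewrite in_cons => /orP[/eqP->|/hfr//].
  by move=> w /hT; apply: settled_sub.
- case: ifP => // /(pop_handled hT) hX.
  have hH' Y : Y \in rcons H X -> handled Y.
    by rewrite mem_rcons in_cons => /orP[/eqP->|/hH].
  case: fr X hfr hT upd hcons hX hH' hfr' => [|[X' T'] fr] [|v X0] // hfr hT _ _ hX hH' hfr'.
  (* Back in the parent frame, whose configuration is checked to be [X] without its head [v], having
     handled [X] means that [v] is settled. *)
  case: ifP => // /beqsP XX; apply: IHs => // f; rewrite in_cons => /orP[/eqP->|ffr].
    move=> w; rewrite in_cons => /orP[/eqP->|].
      by apply: handled_settled; rewrite -XX.
    by apply: (hfr' (X', T')); rewrite mem_head.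
  by apply: hfr'; rewrite in_cons ffr orbT.
Qed.

Lemma run_handled s X :
  has (beqs X) (run s [:: (X, [::])] [::]) -> handled X.
Proof.
case/hasP=> Y YH /beqsP ->; apply: run_sound YH => // f.
by rewrite inE => /eqP-> v.
Qed.

End Soundness.
End Run.

(* M(K7), the columns of A16, those of A12, and the duals of the cycle matroids
   of the eight graphs [cubic_graphs] below. *)
Definition targets : seq (seq N) := ([::
  [:: 1; 2; 4; 8; 16; 32; 3; 5; 9; 17; 33; 6; 10; 18; 34; 12; 20; 36; 24; 40; 48];
  [:: 1; 2; 4; 8; 16; 32; 7; 11; 17; 34; 52; 56; 3; 51; 48; 12];
  [:: 3; 1; 2; 4; 8; 16; 32; 38; 14; 28; 56; 50];
  [:: 1; 2; 4; 7; 3; 8; 16; 5; 29; 24; 18; 32; 15; 61; 50];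
  [:: 1; 2; 4; 8; 12; 16; 3; 32; 51; 19; 36; 14; 24; 50; 42];
  [:: 1; 2; 4; 8; 12; 9; 16; 32; 57; 25; 36; 14; 18; 56; 42];
  [:: 1; 2; 4; 8; 12; 16; 32; 6; 54; 48; 14; 33; 24; 55; 47];
  [:: 1; 2; 4; 8; 12; 9; 16; 6; 31; 25; 14; 32; 48; 30; 46];
  [:: 1; 2; 4; 8; 16; 9; 32; 42; 3; 41; 46; 24; 20; 34; 54];
  [:: 1; 2; 4; 3; 8; 7; 9; 16; 32; 25; 57; 18; 36; 15; 43];
  [:: 1; 2; 4; 8; 16; 24; 9; 32; 6; 38; 47; 28; 48; 3; 51]])%num.

(* The output of a computer search. *)
Definition classification_script : seq step := ([::
  Push 7; Push 59; Fano 13 [:: 2; 4; 8; 1; 16; 32] [:: 11; 61; 14];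
  Fano 14 [:: 1; 4; 8; 2; 16; 32] [:: 11; 61; 14];
  Fano 21 [:: 2; 4; 16; 1; 8; 32] [:: 11; 61; 14];
  Fano 22 [:: 1; 4; 16; 2; 8; 32] [:: 11; 61; 14];
  Fano 29 [:: 2; 4; 8; 1; 16; 32] [:: 11; 61; 30];
  Fano 30 [:: 1; 4; 8; 2; 16; 32] [:: 11; 61; 30];
  Fano 37 [:: 2; 4; 32; 1; 8; 16] [:: 11; 61; 14];
  Fano 38 [:: 1; 4; 32; 2; 8; 16] [:: 11; 61; 14];
  Fano 45 [:: 2; 4; 8; 1; 16; 32] [:: 11; 61; 46];
  Fano 46 [:: 1; 4; 8; 2; 16; 32] [:: 11; 61; 46];
  Fano 53 [:: 2; 4; 16; 1; 8; 32] [:: 11; 61; 46];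
  Fano 54 [:: 1; 4; 16; 2; 8; 32] [:: 11; 61; 46];
  Fano 61 [:: 2; 4; 8; 1; 16; 32] [:: 11; 61; 62];
  Fano 62 [:: 1; 4; 8; 2; 16; 32] [:: 11; 61; 62]; Push 25;
  Fano 10 [:: 1; 2; 8; 4; 16; 32] [:: 11; 21; 6; 55];
  Fano 18 [:: 1; 2; 16; 4; 8; 32] [:: 11; 21; 6; 55];
  Fano 26 [:: 1; 2; 8; 4; 16; 32] [:: 11; 21; 22; 55];
  Fano 33 [:: 2; 8; 32; 7; 4; 16] [:: 59; 29; 62];
  Fano 41 [:: 2; 16; 32; 7; 4; 8] [:: 59; 61; 62];
  Fano 42 [:: 1; 2; 8; 4; 16; 32] [:: 11; 21; 38; 55];
  Fano 49 [:: 2; 8; 32; 7; 4; 16] [:: 59; 61; 62];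
  Fano 50 [:: 1; 2; 16; 4; 8; 32] [:: 11; 21; 38; 55];
  Fano 58 [:: 1; 2; 8; 4; 16; 32] [:: 11; 21; 54; 55]; Push 44;
  Fano 11 [:: 8; 16; 32; 1; 59; 4] [:: 11; 37; 22; 31];
  Fano 15 [:: 1; 4; 8; 2; 16; 32] [:: 11; 21; 38; 15];
  Fano 19 [:: 4; 8; 16; 1; 7; 32] [:: 35; 21; 14; 55];
  Fano 20 [:: 4; 8; 16; 25; 2; 32] [:: 35; 5; 14; 31];
  Fano 28 [:: 4; 16; 32; 8; 1; 2] [:: 11; 13; 62];
  Fano 31 [:: 1; 4; 8; 2; 16; 32] [:: 11; 21; 38; 31];
  Fano 35 [:: 1; 8; 32; 2; 4; 16] [:: 35; 13; 22; 47];
  Fano 39 [:: 1; 4; 32; 2; 8; 16] [:: 11; 61; 22; 15];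
  Fano 47 [:: 1; 4; 8; 2; 16; 32] [:: 11; 21; 38; 47];
  Fano 48 [:: 8; 16; 32; 1; 2; 4] [:: 11; 37; 6; 31];
  Fano 51 [:: 1; 8; 32; 2; 4; 16] [:: 35; 45; 22; 47];
  Fano 52 [:: 8; 16; 32; 1; 2; 4] [:: 11; 37; 38; 31];
  Fano 55 [:: 1; 4; 32; 2; 8; 16] [:: 11; 61; 22; 47];
  Fano 56 [:: 4; 16; 32; 7; 2; 8] [:: 59; 37; 38; 47];
  Fano 63 [:: 1; 4; 8; 2; 16; 32] [:: 11; 21; 38; 63]; Push 34;
  Fano 27 [:: 2; 8; 32; 1; 4; 16] [:: 43; 5; 22; 47];
  Fano 57 [:: 1; 2; 32; 4; 8; 16] [:: 11; 53; 6; 55]; Push 36;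
  Fano 12 [:: 4; 8; 32; 1; 2; 16] [:: 3; 5; 62; 7];
  Fano 40 [:: 4; 8; 32; 7; 2; 16] [:: 59; 5; 6; 7]; Push 5;
  Fano 3 [:: 2; 4; 32; 5; 8; 16] [:: 11; 5; 6; 63];
  Fano 6 [:: 1; 2; 4; 8; 16; 32] [:: 59; 5; 6; 7]; Push 24;
  Fano 9 [:: 8; 16; 32; 59; 2; 4] [:: 3; 37; 30; 31];
  Fano 17 [:: 4; 8; 16; 5; 2; 32] [:: 35; 13; 6; 15]; Push 43;
  Fano 23 [:: 1; 8; 16; 2; 4; 32] [:: 43; 29; 6; 7];
  Fano 60 [:: 1; 16; 32; 2; 4; 8] [:: 35; 45; 54; 47]; Pop 5%N [:: 5; 8; 25; 1; 36; 34]; Push 60;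
  Fano 23 [:: 1; 4; 16; 2; 8; 32] [:: 3; 21; 54; 15]; Pop 6%N [:: 2; 44; 16; 24; 25; 34];
  Pop 4%N [:: 23; 7; 4; 1; 24; 36]; Known 43 2%N [:: 7; 4; 2; 59; 16; 32]; Push 9;
  Fano 17 [:: 2; 8; 16; 7; 4; 32] [:: 27; 29; 62; 31]; Known 23 2%N [:: 7; 59; 16; 1; 4; 25];
  Pop 9%N [:: 4; 1; 7; 32; 8; 60]; Known 60 3%N [:: 7; 4; 2; 59; 16; 32];
  Pop 5%N [:: 44; 1; 32; 36; 17; 34]; Known 3 4%N [:: 1; 4; 2; 25; 16; 32]; Push 9;
  Fano 17 [:: 2; 8; 16; 7; 4; 32] [:: 27; 29; 62; 31];
  Fano 24 [:: 8; 16; 32; 59; 2; 4] [:: 3; 37; 30; 31]; Known 23 4%N [:: 7; 59; 16; 1; 4; 25];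
  Known 60 4%N [:: 1; 16; 8; 4; 2; 44]; Pop 7%N [:: 1; 59; 16; 9; 36; 32];
  Known 43 5%N [:: 7; 2; 4; 44; 16; 32]; Known 24 5%N [:: 1; 4; 2; 25; 16; 32];
  Known 60 5%N [:: 7; 4; 2; 59; 16; 32]; Pop 7%N [:: 44; 2; 32; 36; 17; 1];
  Known 6 6%N [:: 8; 4; 32; 25; 16; 2]; Known 9 6%N [:: 7; 16; 59; 2; 4; 25];
  Known 43 6%N [:: 1; 16; 25; 2; 4; 59]; Push 40;
  Fano 12 [:: 4; 8; 32; 1; 7; 16] [:: 3; 29; 6; 7]; Known 3 6%N [:: 16; 7; 44; 8; 25; 4];
  Known 17 6%N [:: 2; 25; 32; 4; 7; 8]; Push 23;
  Fano 60 [:: 1; 4; 16; 2; 8; 32] [:: 11; 21; 54; 15]; Pop 10%N [:: 1; 5; 2; 25; 59; 23];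
  Pop 4%N [:: 8; 32; 7; 5; 4; 60]; Known 5 8%N [:: 44; 32; 4; 7; 16; 2];
  Known 24 8%N [:: 7; 59; 16; 1; 4; 25]; Known 60 8%N [:: 1; 25; 16; 7; 4; 59];
  Pop 4%N [:: 1; 2; 44; 12; 4; 23]; Known 5 9%N [:: 16; 1; 8; 44; 59; 4];
  Known 6 9%N [:: 8; 1; 16; 44; 32; 7]; Known 40 9%N [:: 1; 4; 7; 16; 25; 44];
  Known 43 9%N [:: 1; 7; 4; 8; 25; 44]; Known 12 9%N [:: 2; 4; 1; 25; 59; 8];
  Known 17 9%N [:: 2; 1; 7; 59; 32; 16]; Known 24 9%N [:: 4; 1; 2; 32; 44; 25];
  Known 57 9%N [:: 1; 2; 7; 16; 8; 59]; Known 60 9%N [:: 1; 7; 2; 25; 8; 59];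
  Pop 4%N [:: 1; 8; 59; 23; 16; 27]; Known 47 10%N [:: 1; 8; 25; 2; 4; 32];
  Known 52 10%N [:: 1; 8; 25; 2; 4; 59]; Known 55 10%N [:: 1; 16; 25; 2; 4; 32]; Push 36;
  Fano 12 [:: 4; 8; 32; 59; 2; 16] [:: 3; 5; 62; 47];
  Fano 20 [:: 4; 16; 32; 59; 2; 8] [:: 3; 5; 62; 47];
  Fano 28 [:: 4; 8; 32; 59; 2; 16] [:: 35; 5; 62; 47];
  Fano 39 [:: 1; 4; 32; 2; 8; 16] [:: 11; 61; 6; 15];
  Fano 40 [:: 4; 8; 32; 7; 2; 16] [:: 59; 5; 6; 47];
  Fano 48 [:: 4; 16; 32; 7; 2; 8] [:: 59; 5; 6; 47];
  Fano 56 [:: 4; 8; 32; 7; 2; 16] [:: 59; 5; 38; 47];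
  Fano 63 [:: 1; 4; 32; 2; 8; 16] [:: 11; 61; 6; 63]; Push 19;
  Fano 5 [:: 4; 8; 32; 5; 59; 16] [:: 43; 5; 22; 63];
  Fano 9 [:: 8; 16; 32; 2; 7; 9] [:: 43; 61; 46];
  Fano 11 [:: 2; 8; 16; 1; 4; 32] [:: 11; 13; 14; 47];
  Fano 15 [:: 2; 8; 16; 1; 4; 32] [:: 27; 13; 14; 47];
  Fano 43 [:: 2; 8; 16; 1; 4; 32] [:: 43; 13; 14; 47];
  Fano 57 [:: 4; 16; 32; 1; 7; 8] [:: 19; 5; 46; 55]; Push 60;
  Fano 6 [:: 2; 4; 8; 25; 16; 32] [:: 3; 13; 54; 31];
  Fano 23 [:: 1; 4; 16; 2; 8; 32] [:: 11; 13; 54; 15];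
  Fano 31 [:: 1; 4; 8; 2; 16; 32] [:: 11; 21; 54; 31];
  Fano 34 [:: 2; 16; 32; 1; 4; 8] [:: 11; 5; 54; 47];
  Fano 35 [:: 1; 8; 32; 2; 4; 16] [:: 35; 13; 54; 47];
  Fano 51 [:: 1; 8; 32; 2; 4; 16] [:: 35; 45; 54; 47]; Pop 1%N [:: 4; 7; 1; 16; 36; 60];
  Pop 0%N [:: 1; 2; 17; 6; 25; 34]; Push 60; Fano 15 [:: 1; 4; 8; 2; 16; 32] [:: 11; 21; 54; 15];
  Fano 23 [:: 1; 4; 16; 2; 8; 32] [:: 11; 21; 54; 15];
  Fano 31 [:: 1; 4; 8; 2; 16; 32] [:: 11; 21; 54; 31];
  Fano 35 [:: 1; 8; 32; 2; 4; 16] [:: 35; 13; 54; 47];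
  Fano 43 [:: 1; 16; 32; 2; 4; 8] [:: 35; 45; 54; 47];
  Fano 51 [:: 1; 8; 32; 2; 4; 16] [:: 35; 45; 54; 47]; Push 34;
  Fano 11 [:: 2; 8; 32; 1; 4; 16] [:: 11; 5; 54; 47];
  Fano 27 [:: 2; 8; 32; 1; 4; 16] [:: 43; 5; 54; 47];
  Fano 57 [:: 1; 2; 32; 4; 8; 16] [:: 11; 53; 6; 55]; Push 3;
  Fano 5 [:: 2; 4; 32; 5; 8; 16] [:: 11; 5; 6; 63];
  Fano 6 [:: 2; 4; 8; 25; 16; 32] [:: 3; 29; 54; 31]; Known 17 10%N [:: 2; 34; 4; 3; 16; 59];
  Pop 6%N [:: 4; 8; 9; 25; 34; 32]; Push 5; Fano 6 [:: 1; 2; 4; 8; 16; 32] [:: 59; 5; 6; 7];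
  Known 17 10%N [:: 2; 60; 5; 4; 34; 16]; Pop 6%N [:: 2; 9; 8; 24; 36; 32]; Push 9;
  Fano 17 [:: 1; 8; 16; 2; 4; 32] [:: 3; 5; 54; 7]; Pop 3%N [:: 8; 1; 16; 59; 7; 4];
  Pop 3%N [:: 32; 34; 4; 7; 59; 8]; Known 5 16%N [:: 25; 2; 59; 8; 16; 7];
  Known 6 16%N [:: 25; 2; 32; 8; 16; 4]; Known 57 16%N [:: 1; 2; 7; 8; 16; 59]; Push 17;
  Fano 9 [:: 1; 8; 16; 2; 4; 32] [:: 3; 5; 54; 7];
  Fano 11 [:: 1; 8; 16; 2; 4; 32] [:: 11; 5; 54; 7]; Pop 1%N [:: 36; 60; 1; 16; 4; 7];
  Pop 1%N [:: 4; 7; 1; 8; 36; 60]; Push 51; Fano 11 [:: 2; 8; 16; 1; 4; 32] [:: 11; 45; 14; 47];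
  Fano 15 [:: 2; 8; 16; 1; 4; 32] [:: 27; 45; 14; 47];
  Fano 43 [:: 2; 8; 16; 1; 4; 32] [:: 43; 45; 14; 47]; Known 57 10%N [:: 1; 16; 8; 2; 4; 51];
  Push 9; Fano 17 [:: 2; 8; 16; 7; 4; 32] [:: 27; 29; 62; 31];
  Fano 24 [:: 1; 8; 16; 2; 4; 32] [:: 3; 45; 6; 7];
  Fano 31 [:: 4; 8; 16; 7; 2; 32] [:: 27; 45; 14; 31]; Known 3 18%N [:: 3; 2; 8; 7; 36; 59];
  Known 6 18%N [:: 6; 7; 8; 2; 32; 51]; Known 23 10%N [:: 1; 9; 59; 2; 4; 25];
  Known 27 10%N [:: 1; 51; 9; 2; 4; 16]; Pop 8%N [:: 8; 51; 2; 1; 5; 16];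
  Known 5 19%N [:: 1; 16; 8; 4; 2; 51]; Pop 0%N [:: 1; 2; 6; 34; 17; 25];
  Known 23 20%N [:: 25; 1; 16; 32; 59; 7]; Push 5;
  Fano 3 [:: 2; 8; 32; 3; 5; 16] [:: 43; 29; 46];
  Fano 6 [:: 1; 2; 4; 8; 16; 32] [:: 59; 5; 6; 7];
  Fano 11 [:: 4; 16; 32; 5; 59; 8] [:: 43; 5; 22; 63]; Known 15 20%N [:: 25; 1; 8; 32; 59; 7];
  Known 31 18%N [:: 1; 32; 5; 8; 16; 2]; Push 27;
  Fano 34 [:: 2; 4; 32; 5; 8; 16] [:: 59; 5; 6; 63];
  Fano 57 [:: 4; 8; 32; 1; 7; 16] [:: 51; 5; 46; 55]; Known 43 20%N [:: 1; 2; 4; 16; 8; 32];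
  Push 17; Fano 9 [:: 2; 8; 16; 7; 4; 32] [:: 27; 29; 30; 31]; Pop 6%N [:: 36; 16; 17; 25; 2; 7];
  Pop 6%N [:: 36; 8; 9; 25; 2; 7]; Known 57 22%N [:: 1; 32; 5; 8; 16; 2]; Push 17;
  Fano 9 [:: 2; 8; 16; 7; 4; 32] [:: 27; 29; 62; 31]; Known 43 20%N [:: 1; 2; 4; 16; 8; 32];
  Pop 1%N [:: 4; 5; 16; 24; 36; 7]; Pop 1%N [:: 4; 5; 9; 25; 32; 2];
  Known 57 24%N [:: 25; 2; 32; 8; 16; 4]; Push 17;
  Fano 9 [:: 2; 8; 16; 7; 4; 32] [:: 27; 29; 62; 31];
  Fano 11 [:: 8; 16; 32; 11; 7; 2] [:: 43; 29; 14]; Known 43 24%N [:: 1; 8; 16; 2; 4; 43];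
  Known 15 24%N [:: 25; 1; 8; 32; 59; 7]; Pop 0%N [:: 1; 16; 24; 3; 7; 35];
  Pop 0%N [:: 1; 2; 6; 34; 9; 25]; Known 15 26%N [:: 2; 1; 7; 32; 59; 8];
  Known 20 26%N [:: 2; 1; 4; 32; 59; 16]; Known 23 26%N [:: 2; 1; 7; 32; 59; 16];
  Known 40 26%N [:: 1; 25; 8; 4; 7; 32]; Known 48 26%N [:: 1; 25; 16; 4; 7; 32];
  Known 51 26%N [:: 1; 25; 8; 4; 7; 59]; Known 60 26%N [:: 1; 2; 7; 8; 16; 59];
  Known 63 26%N [:: 1; 2; 4; 8; 16; 59]; Push 19;
  Fano 11 [:: 2; 8; 16; 1; 4; 32] [:: 11; 13; 14; 47];
  Fano 12 [:: 4; 8; 16; 1; 7; 32] [:: 3; 21; 14; 55];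
  Fano 43 [:: 2; 8; 16; 1; 4; 32] [:: 43; 13; 14; 47]; Known 6 26%N [:: 8; 16; 1; 32; 59; 7];
  Known 57 26%N [:: 16; 8; 25; 4; 7; 32]; Push 9;
  Fano 17 [:: 2; 8; 16; 7; 4; 32] [:: 27; 29; 62; 31];
  Fano 24 [:: 1; 8; 16; 2; 4; 32] [:: 3; 13; 6; 7];
  Fano 28 [:: 1; 8; 16; 2; 4; 32] [:: 3; 13; 22; 7];
  Fano 31 [:: 4; 8; 16; 7; 2; 32] [:: 27; 13; 14; 31];
  Fano 35 [:: 8; 16; 32; 9; 2; 4] [:: 27; 29; 30];
  Fano 39 [:: 8; 16; 32; 9; 2; 4] [:: 27; 61; 30];
  Fano 56 [:: 1; 8; 16; 2; 4; 32] [:: 3; 13; 38; 7]; Pop 7%N [:: 16; 5; 4; 3; 27; 32]; Push 56;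
  Fano 34 [:: 2; 16; 32; 1; 4; 8] [:: 11; 5; 38; 47];
  Fano 35 [:: 1; 8; 32; 2; 4; 16] [:: 35; 13; 38; 47];
  Fano 39 [:: 1; 8; 32; 2; 4; 16] [:: 35; 29; 38; 47]; Push 31;
  Fano 5 [:: 2; 4; 8; 5; 16; 32] [:: 27; 29; 30; 63];
  Fano 28 [:: 1; 4; 8; 2; 16; 32] [:: 11; 21; 22; 31]; Pop 0%N [:: 1; 16; 3; 24; 7; 56];
  Pop 0%N [:: 1; 16; 3; 24; 56; 4]; Known 31 29%N [:: 2; 25; 32; 7; 4; 16];
  Pop 0%N [:: 1; 2; 17; 25; 5; 34]; Known 31 30%N [:: 1; 25; 8; 4; 7; 32];
  Known 56 30%N [:: 2; 1; 4; 32; 59; 8]; Push 17;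
  Fano 9 [:: 2; 8; 16; 7; 4; 32] [:: 27; 29; 62; 31]; Known 11 30%N [:: 1; 2; 4; 16; 8; 32];
  Known 12 26%N [:: 2; 1; 4; 32; 59; 8]; Known 43 26%N [:: 1; 25; 16; 4; 7; 59]; Push 34;
  Fano 57 [:: 1; 2; 32; 4; 8; 16] [:: 11; 53; 6; 55]; Push 6;
  Fano 5 [:: 1; 2; 4; 8; 16; 32] [:: 59; 5; 6; 7]; Known 28 30%N [:: 1; 25; 8; 7; 4; 32];
  Known 39 26%N [:: 1; 2; 7; 8; 16; 32]; Pop 0%N [:: 1; 16; 24; 3; 7; 35];
  Pop 0%N [:: 1; 16; 24; 3; 35; 4]; Known 6 32%N [:: 2; 25; 32; 7; 4; 8];
  Known 57 32%N [:: 1; 2; 4; 8; 16; 59]; Pop 0%N [:: 1; 16; 24; 3; 4; 35];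
  Known 6 33%N [:: 1; 25; 8; 4; 7; 32]; Known 57 33%N [:: 2; 1; 4; 32; 59; 8];
  Pop 0%N [:: 1; 2; 5; 9; 25; 34]; Known 26 34%N [:: 1; 2; 4; 32; 59; 8];
  Known 28 34%N [:: 4; 7; 1; 8; 16; 32]; Known 31 34%N [:: 4; 7; 1; 32; 59; 8];
  Known 42 34%N [:: 1; 2; 4; 16; 59; 8]; Known 47 34%N [:: 4; 7; 1; 16; 59; 8];
  Known 49 34%N [:: 1; 2; 4; 16; 32; 8]; Known 50 34%N [:: 1; 2; 4; 8; 59; 16];
  Known 52 34%N [:: 4; 7; 1; 16; 32; 8]; Known 55 34%N [:: 4; 7; 1; 8; 59; 16]; Push 33;
  Fano 9 [:: 2; 8; 32; 7; 4; 16] [:: 27; 29; 62];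
  Fano 17 [:: 2; 16; 32; 7; 4; 8] [:: 27; 29; 62];
  Fano 34 [:: 1; 2; 32; 4; 8; 16] [:: 11; 5; 6; 55];
  Fano 58 [:: 1; 2; 32; 4; 8; 16] [:: 11; 5; 54; 55]; Push 12;
  Fano 15 [:: 1; 4; 8; 2; 16; 32] [:: 11; 61; 6; 15];
  Fano 19 [:: 8; 16; 32; 7; 2; 12] [:: 43; 61; 46];
  Fano 20 [:: 4; 8; 16; 59; 2; 32] [:: 3; 5; 62; 47];
  Fano 36 [:: 4; 8; 32; 59; 2; 16] [:: 3; 5; 62; 47];
  Fano 40 [:: 4; 8; 32; 7; 2; 16] [:: 3; 29; 6; 47];
  Fano 56 [:: 4; 8; 32; 7; 2; 16] [:: 3; 29; 38; 47];
  Fano 63 [:: 1; 4; 8; 2; 16; 32] [:: 11; 61; 6; 63]; Known 24 34%N [:: 2; 4; 1; 33; 59; 12];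
  Known 27 34%N [:: 1; 7; 2; 33; 59; 12]; Known 41 34%N [:: 1; 2; 4; 8; 32; 16];
  Known 44 34%N [:: 1; 7; 2; 12; 33; 16]; Push 18;
  Fano 10 [:: 2; 8; 16; 59; 4; 32] [:: 3; 5; 62; 47];
  Fano 35 [:: 8; 16; 32; 7; 1; 12] [:: 59; 45; 46];
  Fano 57 [:: 1; 2; 16; 4; 8; 32] [:: 11; 53; 6; 55]; Known 3 34%N [:: 3; 8; 7; 1; 16; 33];
  Known 6 34%N [:: 6; 8; 2; 7; 32; 18]; Known 39 34%N [:: 33; 39; 1; 8; 18; 12];
  Known 11 34%N [:: 8; 11; 4; 18; 33; 16]; Known 43 34%N [:: 2; 7; 1; 18; 59; 12];
  Known 23 34%N [:: 18; 23; 2; 8; 33; 12]; Pop 4%N [:: 59; 51; 32; 1; 4; 48];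
  Known 23 35%N [:: 1; 4; 7; 23; 8; 33]; Known 57 35%N [:: 1; 2; 4; 8; 59; 32];
  Known 60 35%N [:: 1; 4; 7; 60; 8; 33]; Push 5; Fano 3 [:: 2; 8; 32; 3; 5; 16] [:: 27; 13; 46];
  Fano 6 [:: 1; 2; 4; 8; 16; 32] [:: 59; 5; 6; 7]; Known 10 34%N [:: 4; 10; 2; 5; 32; 16];
  Known 11 34%N [:: 4; 11; 7; 5; 33; 16]; Known 48 35%N [:: 4; 5; 32; 48; 2; 8];
  Pop 1%N [:: 1; 5; 8; 51; 33; 2]; Pop 0%N [:: 1; 32; 3; 7; 11; 48];
  Known 15 37%N [:: 1; 2; 7; 8; 16; 32]; Known 20 37%N [:: 1; 2; 4; 16; 8; 32];
  Known 60 37%N [:: 1; 2; 7; 59; 8; 32]; Known 63 37%N [:: 1; 2; 4; 59; 8; 32]; Push 11;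
  Fano 19 [:: 8; 16; 32; 11; 2; 4] [:: 11; 29; 14];
  Fano 23 [:: 8; 16; 32; 11; 2; 4] [:: 43; 29; 14];
  Fano 40 [:: 1; 8; 32; 2; 4; 16] [:: 11; 5; 6; 47];
  Fano 44 [:: 1; 8; 32; 2; 4; 16] [:: 11; 5; 22; 47];
  Fano 56 [:: 1; 8; 32; 2; 4; 16] [:: 11; 5; 38; 47]; Known 6 34%N [:: 7; 11; 4; 6; 33; 16];
  Known 18 34%N [:: 8; 11; 4; 18; 33; 16]; Known 41 34%N [:: 1; 2; 4; 8; 32; 16];
  Known 57 34%N [:: 8; 11; 4; 33; 57; 32]; Push 39;
  Fano 5 [:: 2; 4; 32; 5; 8; 16] [:: 27; 13; 14; 63];
  Fano 36 [:: 1; 4; 32; 2; 8; 16] [:: 11; 5; 6; 15]; Known 24 34%N [:: 1; 2; 8; 7; 39; 24];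
  Known 27 34%N [:: 1; 2; 8; 27; 59; 4]; Pop 0%N [:: 1; 32; 3; 7; 11; 48]; Push 24;
  Fano 51 [:: 1; 8; 16; 2; 4; 32] [:: 11; 45; 6; 47]; Known 48 34%N [:: 1; 2; 4; 16; 48; 24];
  Pop 0%N [:: 1; 32; 3; 11; 27; 4]; Push 27; Fano 48 [:: 1; 16; 32; 2; 4; 8] [:: 43; 5; 6; 47];
  Known 51 39%N [:: 1; 2; 4; 8; 59; 32]; Pop 0%N [:: 1; 32; 3; 11; 27; 4];
  Pop 0%N [:: 1; 32; 3; 11; 4; 48]; Known 56 41%N [:: 1; 2; 4; 59; 8; 32]; Push 48;
  Fano 19 [:: 1; 16; 32; 2; 4; 8] [:: 11; 5; 6; 47];
  Fano 23 [:: 1; 16; 32; 2; 4; 8] [:: 27; 5; 6; 47];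
  Fano 27 [:: 1; 16; 32; 2; 4; 8] [:: 43; 5; 6; 47];
  Fano 40 [:: 8; 16; 32; 59; 2; 4] [:: 27; 5; 6; 31];
  Fano 44 [:: 8; 16; 32; 59; 2; 4] [:: 27; 37; 6; 31]; Known 6 37%N [:: 6; 7; 32; 48; 8; 2];
  Known 10 41%N [:: 10; 59; 16; 48; 4; 2]; Known 41 37%N [:: 16; 59; 41; 8; 4; 32];
  Known 43 34%N [:: 1; 2; 4; 16; 48; 8]; Push 18;
  Fano 24 [:: 8; 16; 32; 1; 59; 4] [:: 3; 29; 6; 31];
  Fano 35 [:: 2; 16; 32; 1; 4; 8] [:: 3; 13; 6; 47];
  Fano 36 [:: 4; 16; 32; 1; 7; 8] [:: 27; 5; 6; 55];
  Fano 39 [:: 2; 16; 32; 1; 4; 8] [:: 3; 29; 6; 47];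
  Fano 57 [:: 1; 2; 16; 4; 8; 32] [:: 11; 53; 6; 55]; Pop 3%N [:: 4; 1; 7; 16; 32; 8]; Push 39;
  Fano 5 [:: 4; 16; 32; 5; 59; 8] [:: 51; 13; 6; 63];
  Fano 36 [:: 1; 4; 32; 2; 8; 16] [:: 11; 5; 6; 15]; Pop 0%N [:: 1; 32; 48; 3; 7; 56];
  Pop 0%N [:: 1; 32; 48; 3; 4; 56]; Known 27 44%N [:: 1; 2; 4; 8; 59; 32]; Push 39;
  Fano 23 [:: 4; 16; 32; 1; 2; 8] [:: 27; 29; 62];
  Fano 36 [:: 1; 4; 32; 2; 8; 16] [:: 11; 5; 6; 15];
  Fano 44 [:: 1; 4; 32; 2; 8; 16] [:: 11; 5; 22; 15]; Known 10 44%N [:: 33; 10; 16; 4; 7; 32];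
  Known 57 44%N [:: 33; 57; 8; 4; 7; 32]; Push 5; Fano 3 [:: 2; 4; 32; 3; 8; 16] [:: 11; 13; 14];
  Fano 6 [:: 1; 2; 4; 8; 16; 32] [:: 59; 5; 6; 7];
  Fano 19 [:: 2; 4; 32; 5; 8; 16] [:: 43; 13; 14; 63];
  Fano 40 [:: 4; 8; 32; 5; 59; 16] [:: 51; 13; 6; 63]; Push 51; Push 43;
  Fano 24 [:: 1; 8; 16; 2; 4; 32] [:: 43; 45; 6; 47]; Pop 1%N [:: 1; 32; 8; 51; 4; 39];
  Known 24 45%N [:: 1; 39; 33; 16; 59; 5]; Pop 1%N [:: 1; 32; 51; 8; 4; 39];
  Known 24 46%N [:: 1; 39; 33; 8; 59; 5]; Pop 1%N [:: 1; 32; 8; 51; 4; 39]; Push 24;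
  Known 18 44%N [:: 2; 1; 4; 32; 8; 16]; Known 19 41%N [:: 1; 2; 4; 16; 8; 32]; Push 51;
  Fano 40 [:: 8; 16; 32; 1; 2; 4] [:: 3; 5; 30; 31];
  Fano 41 [:: 1; 8; 16; 2; 4; 32] [:: 35; 45; 6; 47];
  Fano 43 [:: 1; 8; 16; 2; 4; 32] [:: 43; 45; 6; 47]; Pop 0%N [:: 1; 32; 3; 7; 48; 56];
  Pop 0%N [:: 1; 32; 3; 7; 40; 56]; Pop 0%N [:: 1; 32; 3; 7; 40; 19]; Push 57;
  Fano 10 [:: 1; 2; 8; 4; 16; 32] [:: 11; 53; 6; 55];
  Fano 18 [:: 1; 2; 16; 4; 8; 32] [:: 11; 53; 6; 55]; Known 6 34%N [:: 6; 33; 7; 4; 59; 8];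
  Known 19 41%N [:: 1; 2; 4; 16; 8; 32]; Known 23 37%N [:: 1; 2; 7; 16; 8; 32];
  Known 51 50%N [:: 8; 16; 33; 4; 7; 59]; Pop 0%N [:: 1; 32; 3; 4; 40; 56];
  Known 10 51%N [:: 1; 2; 4; 16; 59; 32]; Push 6;
  Fano 5 [:: 1; 2; 4; 8; 16; 32] [:: 59; 5; 6; 7]; Known 23 37%N [:: 1; 2; 7; 16; 8; 32];
  Known 36 50%N [:: 1; 36; 33; 8; 16; 6]; Known 44 44%N [:: 7; 44; 16; 2; 32; 1]; Push 24;
  Known 18 51%N [:: 1; 2; 4; 8; 59; 32]; Known 19 51%N [:: 2; 24; 33; 7; 19; 6]; Push 51;
  Fano 40 [:: 8; 16; 32; 1; 2; 4] [:: 3; 5; 30; 31];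
  Fano 41 [:: 1; 8; 16; 2; 4; 32] [:: 35; 45; 6; 47];
  Fano 43 [:: 1; 8; 16; 2; 4; 32] [:: 43; 45; 6; 47]; Pop 0%N [:: 1; 32; 3; 7; 48; 56];
  Pop 0%N [:: 1; 32; 3; 7; 40; 56]; Pop 0%N [:: 1; 32; 3; 7; 40; 19]; Push 24;
  Known 18 51%N [:: 1; 2; 4; 8; 59; 32]; Known 19 41%N [:: 1; 2; 4; 16; 8; 32];
  Known 23 44%N [:: 7; 4; 1; 32; 8; 16]; Push 51;
  Fano 40 [:: 8; 16; 32; 1; 2; 4] [:: 3; 5; 30; 31];
  Fano 41 [:: 1; 8; 16; 2; 4; 32] [:: 35; 45; 6; 47];
  Fano 43 [:: 1; 8; 16; 2; 4; 32] [:: 43; 45; 6; 47];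
  Fano 44 [:: 8; 16; 32; 1; 2; 4] [:: 3; 37; 30; 31]; Pop 0%N [:: 1; 32; 3; 48; 56; 4];
  Pop 0%N [:: 1; 32; 3; 4; 40; 56]; Pop 0%N [:: 1; 32; 3; 4; 40; 19];
  Known 10 57%N [:: 2; 1; 4; 16; 32; 8]; Known 15 57%N [:: 7; 4; 1; 16; 32; 8];
  Known 17 57%N [:: 1; 2; 4; 8; 32; 16]; Known 20 57%N [:: 4; 7; 1; 8; 32; 16];
  Known 34 57%N [:: 2; 1; 4; 8; 16; 32]; Known 36 57%N [:: 4; 7; 1; 8; 16; 32];
  Known 39 57%N [:: 7; 4; 1; 8; 16; 32]; Known 57 57%N [:: 2; 1; 4; 8; 16; 59];
  Known 58 57%N [:: 1; 2; 4; 8; 16; 59]; Known 60 57%N [:: 7; 4; 1; 8; 16; 59];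
  Known 63 57%N [:: 4; 7; 1; 8; 16; 59]; Push 6; Fano 5 [:: 1; 2; 4; 8; 16; 32] [:: 59; 5; 6; 7];
  Known 9 57%N [:: 1; 2; 4; 16; 32; 8]; Known 18 57%N [:: 2; 1; 4; 8; 32; 16];
  Known 41 57%N [:: 1; 41; 8; 4; 16; 7]; Push 35; Known 12 57%N [:: 1; 32; 2; 12; 16; 6];
  Known 27 57%N [:: 59; 35; 8; 1; 4; 27]; Known 48 57%N [:: 16; 35; 8; 1; 4; 48]; Push 56;
  Fano 11 [:: 1; 8; 32; 2; 4; 16] [:: 11; 13; 38; 47];
  Fano 19 [:: 1; 16; 32; 2; 4; 8] [:: 11; 13; 38; 47];
  Fano 23 [:: 1; 16; 32; 2; 4; 8] [:: 27; 13; 38; 47]; Known 51 57%N [:: 8; 56; 16; 1; 4; 51];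
  Pop 0%N [:: 2; 4; 3; 32; 40; 56]; Known 11 58%N [:: 2; 1; 7; 16; 59; 8]; Push 24;
  Known 19 58%N [:: 2; 1; 7; 8; 59; 16]; Known 23 57%N [:: 1; 35; 2; 8; 23; 6]; Push 51;
  Fano 40 [:: 8; 16; 32; 1; 2; 4] [:: 3; 5; 30; 31];
  Fano 43 [:: 1; 8; 16; 2; 4; 32] [:: 43; 45; 6; 47];
  Fano 44 [:: 8; 16; 32; 1; 2; 4] [:: 3; 37; 30; 31]; Pop 0%N [:: 2; 4; 3; 32; 19; 27];
  Pop 0%N [:: 2; 4; 3; 32; 40; 56]; Pop 0%N [:: 2; 4; 3; 32; 40; 19];
  Known 56 61%N [:: 2; 1; 7; 8; 16; 59]; Push 48; Known 12 57%N [:: 4; 7; 1; 16; 32; 8];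
  Known 23 57%N [:: 6; 23; 1; 8; 32; 2]; Known 44 57%N [:: 4; 44; 8; 1; 16; 2]; Push 40;
  Fano 24 [:: 8; 16; 32; 1; 2; 4] [:: 3; 5; 6; 31];
  Fano 27 [:: 8; 16; 32; 1; 2; 4] [:: 27; 5; 6; 31]; Known 19 61%N [:: 2; 1; 7; 8; 32; 16];
  Known 51 61%N [:: 2; 1; 7; 32; 40; 48]; Pop 0%N [:: 2; 4; 3; 8; 40; 56];
  Known 24 62%N [:: 2; 1; 7; 8; 32; 16]; Known 43 62%N [:: 2; 1; 7; 32; 59; 16];
  Pop 0%N [:: 2; 4; 3; 16; 48; 11]; Known 24 63%N [:: 2; 1; 7; 32; 8; 16];
  Known 51 63%N [:: 2; 1; 7; 16; 8; 59]; Pop 0%N [:: 2; 4; 3; 8; 19; 40]; Push 35;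
  Known 9 57%N [:: 1; 2; 4; 16; 32; 8]; Known 12 57%N [:: 4; 7; 1; 16; 32; 8]; Push 40;
  Fano 11 [:: 1; 8; 32; 2; 4; 16] [:: 11; 13; 6; 47];
  Fano 27 [:: 1; 8; 32; 2; 4; 16] [:: 43; 13; 6; 47];
  Fano 48 [:: 8; 16; 32; 59; 2; 4] [:: 11; 5; 6; 31]; Push 56;
  Fano 18 [:: 2; 16; 32; 1; 4; 8] [:: 3; 13; 38; 47];
  Fano 19 [:: 1; 16; 32; 2; 4; 8] [:: 11; 13; 38; 47];
  Fano 23 [:: 1; 16; 32; 2; 4; 8] [:: 27; 13; 38; 47]; Push 51;
  Fano 24 [:: 8; 16; 32; 1; 2; 4] [:: 3; 5; 30; 7];
  Fano 41 [:: 1; 8; 16; 2; 4; 32] [:: 35; 45; 38; 47];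
  Fano 43 [:: 1; 8; 16; 2; 4; 32] [:: 43; 45; 38; 47];
  Fano 44 [:: 4; 8; 16; 7; 2; 32] [:: 35; 45; 38; 47]; Pop 1%N [:: 32; 35; 1; 4; 8; 51];
  Pop 0%N [:: 32; 8; 24; 33; 35; 36]; Push 24; Fano 51 [:: 8; 16; 32; 1; 2; 4] [:: 3; 5; 30; 31];
  Known 18 57%N [:: 2; 1; 4; 8; 32; 16]; Known 19 66%N [:: 1; 2; 4; 8; 59; 16];
  Known 23 57%N [:: 7; 4; 1; 8; 32; 16]; Pop 0%N [:: 1; 2; 33; 41; 57; 5];
  Pop 0%N [:: 1; 2; 33; 41; 5; 18]; Known 27 68%N [:: 1; 2; 4; 59; 8; 32];
  Known 48 68%N [:: 1; 2; 4; 16; 8; 32]; Push 56;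
  Fano 11 [:: 1; 8; 32; 2; 4; 16] [:: 11; 13; 38; 47];
  Fano 18 [:: 2; 16; 32; 1; 4; 8] [:: 3; 13; 38; 47];
  Fano 19 [:: 1; 16; 32; 2; 4; 8] [:: 11; 13; 38; 47];
  Fano 23 [:: 1; 16; 32; 2; 4; 8] [:: 27; 13; 38; 47]; Known 51 68%N [:: 1; 2; 4; 16; 8; 35];
  Pop 0%N [:: 1; 2; 33; 5; 41; 57]; Known 11 69%N [:: 1; 2; 4; 16; 59; 8]; Push 24;
  Known 18 57%N [:: 2; 1; 4; 8; 32; 16]; Known 19 69%N [:: 1; 2; 4; 8; 59; 16];
  Known 23 57%N [:: 7; 4; 1; 8; 32; 16]; Push 51;
  Fano 41 [:: 1; 8; 16; 2; 4; 32] [:: 35; 45; 6; 47];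
  Fano 43 [:: 1; 8; 16; 2; 4; 32] [:: 43; 45; 6; 47];
  Fano 44 [:: 8; 16; 32; 1; 2; 4] [:: 3; 37; 30; 31]; Pop 0%N [:: 1; 2; 33; 18; 26; 5];
  Pop 0%N [:: 1; 2; 33; 5; 41; 57]; Pop 0%N [:: 1; 2; 33; 5; 41; 18];
  Known 56 72%N [:: 1; 2; 4; 8; 16; 59]; Push 48; Known 41 57%N [:: 16; 59; 2; 4; 7; 32];
  Known 44 57%N [:: 16; 59; 7; 1; 2; 32]; Push 40;
  Fano 24 [:: 8; 16; 32; 1; 2; 4] [:: 3; 5; 6; 31];
  Fano 27 [:: 8; 16; 32; 1; 2; 4] [:: 27; 5; 6; 31]; Known 18 57%N [:: 2; 1; 4; 8; 32; 16];
  Known 19 72%N [:: 1; 2; 4; 8; 32; 16]; Known 23 57%N [:: 7; 4; 1; 8; 32; 16];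
  Known 51 72%N [:: 1; 2; 4; 32; 40; 48]; Pop 0%N [:: 32; 8; 48; 9; 11; 12];
  Known 24 73%N [:: 1; 2; 4; 8; 32; 16]; Known 43 73%N [:: 1; 2; 4; 32; 59; 16];
  Pop 0%N [:: 1; 2; 5; 18; 50; 9]; Known 24 74%N [:: 1; 2; 4; 32; 8; 16];
  Known 51 74%N [:: 1; 2; 4; 16; 8; 59]; Pop 0%N [:: 1; 2; 5; 9; 18; 41];
  Known 61 75%N [:: 1; 4; 2; 8; 16; 32]; Known 62 75%N [:: 1; 7; 2; 8; 16; 32]; Push 27;
  Fano 13 [:: 2; 4; 8; 1; 16; 32] [:: 11; 29; 14];
  Fano 14 [:: 1; 4; 8; 2; 16; 32] [:: 11; 29; 14];
  Fano 21 [:: 2; 4; 16; 1; 8; 32] [:: 11; 29; 14];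
  Fano 22 [:: 1; 4; 16; 2; 8; 32] [:: 11; 29; 14];
  Fano 29 [:: 2; 4; 8; 1; 16; 32] [:: 11; 29; 30];
  Fano 30 [:: 1; 4; 8; 2; 16; 32] [:: 11; 29; 30];
  Fano 45 [:: 2; 4; 8; 1; 16; 32] [:: 11; 29; 46];
  Fano 46 [:: 1; 4; 8; 2; 16; 32] [:: 11; 29; 46];
  Fano 53 [:: 2; 4; 16; 1; 8; 32] [:: 11; 29; 46];
  Fano 54 [:: 1; 4; 16; 2; 8; 32] [:: 11; 29; 46]; Known 40 75%N [:: 1; 2; 4; 16; 27; 32];
  Known 48 75%N [:: 1; 2; 4; 8; 27; 32]; Push 42;
  Fano 9 [:: 1; 2; 8; 4; 16; 32] [:: 11; 5; 38; 23];
  Fano 18 [:: 2; 8; 16; 27; 4; 32] [:: 35; 5; 30; 15];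
  Fano 25 [:: 1; 2; 8; 4; 16; 32] [:: 11; 21; 38; 23];
  Fano 35 [:: 1; 8; 32; 2; 4; 16] [:: 43; 13; 14];
  Fano 36 [:: 1; 8; 32; 2; 7; 16] [:: 43; 29; 14];
  Fano 39 [:: 1; 8; 32; 2; 4; 16] [:: 43; 29; 14];
  Fano 41 [:: 1; 2; 8; 4; 16; 32] [:: 11; 37; 38; 23];
  Fano 50 [:: 8; 16; 32; 2; 1; 4] [:: 27; 13; 14];
  Fano 51 [:: 1; 8; 32; 2; 4; 16] [:: 43; 45; 14];
  Fano 52 [:: 7; 16; 32; 4; 1; 8] [:: 43; 61; 14];
  Fano 55 [:: 1; 8; 32; 2; 4; 16] [:: 43; 61; 14];
  Fano 56 [:: 2; 16; 32; 8; 1; 4] [:: 27; 13; 14];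
  Fano 57 [:: 1; 2; 8; 4; 16; 32] [:: 11; 53; 38; 23];
  Fano 60 [:: 2; 16; 32; 8; 1; 4] [:: 27; 13; 46];
  Fano 63 [:: 4; 16; 32; 7; 1; 8] [:: 43; 61; 46]; Known 5 75%N [:: 2; 8; 32; 4; 5; 16];
  Known 20 75%N [:: 1; 4; 2; 20; 27; 32]; Known 24 75%N [:: 4; 7; 24; 1; 8; 32];
  Known 26 75%N [:: 16; 26; 32; 1; 4; 7]; Known 28 75%N [:: 1; 7; 2; 16; 28; 32];
  Known 31 75%N [:: 1; 4; 2; 16; 31; 32]; Known 58 75%N [:: 1; 2; 4; 8; 27; 42]; Push 37;
  Fano 6 [:: 1; 2; 4; 8; 16; 32] [:: 27; 37; 6; 7];
  Fano 12 [:: 4; 8; 32; 37; 2; 16] [:: 3; 13; 22; 63];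
  Fano 23 [:: 8; 16; 32; 2; 1; 23] [:: 27; 13; 46];
  Fano 38 [:: 1; 2; 4; 8; 16; 32] [:: 27; 37; 38; 7];
  Fano 43 [:: 1; 2; 32; 4; 8; 16] [:: 11; 13; 22; 23];
  Fano 47 [:: 1; 2; 32; 4; 8; 16] [:: 11; 13; 22; 31]; Known 33 75%N [:: 2; 32; 7; 8; 16; 27];
  Known 34 75%N [:: 1; 2; 4; 16; 27; 34]; Known 3 75%N [:: 2; 32; 7; 3; 16; 27];
  Known 10 75%N [:: 2; 7; 32; 4; 10; 16]; Known 15 75%N [:: 2; 7; 32; 1; 15; 16];
  Known 17 75%N [:: 1; 4; 2; 17; 27; 37]; Known 49 75%N [:: 1; 2; 4; 8; 16; 42];
  Known 19 75%N [:: 1; 2; 16; 4; 8; 37]; Pop 2%N [:: 27; 11; 1; 2; 4; 42];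
  Known 44 76%N [:: 1; 2; 7; 8; 16; 42]; Known 47 76%N [:: 1; 2; 4; 8; 16; 42]; Push 43;
  Fano 33 [:: 1; 2; 32; 4; 8; 16] [:: 11; 5; 22; 23];
  Fano 38 [:: 1; 4; 32; 2; 8; 16] [:: 11; 29; 14];
  Fano 49 [:: 1; 2; 32; 4; 8; 16] [:: 11; 37; 22; 23]; Known 15 75%N [:: 4; 15; 16; 2; 8; 42];
  Known 34 75%N [:: 1; 2; 4; 16; 27; 34]; Pop 0%N [:: 2; 1; 6; 10; 42; 17];
  Known 15 77%N [:: 8; 2; 32; 1; 16; 4]; Pop 0%N [:: 2; 1; 6; 10; 17; 32];
  Known 44 78%N [:: 7; 4; 1; 8; 16; 32]; Known 47 78%N [:: 4; 7; 1; 8; 16; 32];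
  Known 49 78%N [:: 2; 1; 4; 16; 8; 32]; Known 52 78%N [:: 7; 4; 1; 16; 8; 32];
  Known 55 78%N [:: 4; 7; 1; 16; 8; 32]; Known 57 78%N [:: 1; 2; 4; 27; 8; 32];
  Known 58 78%N [:: 2; 1; 4; 27; 8; 32]; Known 60 78%N [:: 4; 7; 1; 27; 8; 32];
  Known 63 78%N [:: 7; 4; 1; 27; 8; 32]; Push 56;
  Fano 37 [:: 2; 4; 32; 1; 27; 16] [:: 11; 29; 14];
  Fano 38 [:: 1; 4; 32; 2; 27; 16] [:: 11; 29; 14];
  Fano 41 [:: 1; 16; 32; 8; 2; 4] [:: 27; 13; 14];
  Fano 43 [:: 1; 16; 32; 8; 2; 4] [:: 27; 29; 14];
  Fano 50 [:: 2; 8; 32; 16; 1; 4] [:: 27; 13; 14];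
  Fano 51 [:: 1; 8; 32; 16; 2; 4] [:: 27; 29; 14]; Known 6 75%N [:: 8; 16; 32; 1; 4; 6];
  Known 10 78%N [:: 2; 1; 4; 27; 32; 10]; Known 15 78%N [:: 7; 4; 1; 27; 32; 15];
  Known 17 78%N [:: 1; 2; 4; 27; 32; 8]; Known 18 78%N [:: 2; 1; 4; 27; 32; 8];
  Known 19 75%N [:: 1; 2; 4; 8; 19; 32]; Known 20 78%N [:: 4; 7; 1; 27; 32; 8];
  Known 23 78%N [:: 7; 4; 1; 27; 32; 8]; Known 26 75%N [:: 8; 16; 32; 1; 4; 7];
  Known 31 75%N [:: 8; 16; 32; 1; 2; 4]; Known 34 78%N [:: 2; 1; 4; 27; 8; 34];
  Known 39 78%N [:: 7; 4; 1; 27; 8; 39]; Pop 0%N [:: 1; 2; 5; 9; 25; 33];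
  Known 43 79%N [:: 1; 2; 4; 16; 27; 32]; Known 51 79%N [:: 1; 2; 4; 8; 27; 32]; Push 35;
  Fano 37 [:: 2; 4; 32; 1; 8; 16] [:: 11; 13; 14];
  Fano 38 [:: 1; 4; 32; 2; 8; 16] [:: 11; 13; 14];
  Fano 41 [:: 2; 8; 32; 1; 4; 16] [:: 43; 13; 14];
  Fano 50 [:: 1; 16; 32; 2; 4; 8] [:: 43; 13; 14]; Known 10 79%N [:: 1; 10; 16; 4; 7; 32];
  Known 15 79%N [:: 1; 2; 32; 4; 15; 16]; Known 17 79%N [:: 2; 17; 8; 4; 7; 32];
  Known 20 79%N [:: 1; 2; 32; 7; 20; 8]; Known 25 79%N [:: 1; 25; 8; 4; 7; 32];
  Known 26 79%N [:: 2; 26; 8; 4; 7; 32]; Known 28 79%N [:: 1; 2; 32; 4; 28; 8];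
  Known 31 79%N [:: 1; 2; 32; 7; 31; 8]; Push 34;
  Fano 33 [:: 1; 2; 32; 4; 8; 16] [:: 11; 5; 6; 7]; Known 6 75%N [:: 4; 6; 32; 1; 8; 16];
  Known 36 75%N [:: 1; 34; 7; 8; 16; 27]; Push 24; Known 18 79%N [:: 1; 18; 8; 4; 7; 32];
  Known 23 79%N [:: 1; 2; 32; 4; 23; 8]; Push 19;
  Fano 9 [:: 1; 8; 16; 2; 4; 32] [:: 3; 13; 6; 15];
  Fano 11 [:: 1; 8; 16; 2; 4; 32] [:: 11; 13; 6; 15];
  Fano 12 [:: 4; 8; 16; 7; 2; 32] [:: 3; 13; 6; 15]; Pop 0%N [:: 2; 32; 3; 16; 24; 7];
  Pop 0%N [:: 2; 32; 3; 7; 11; 27]; Pop 0%N [:: 2; 32; 3; 7; 11; 16];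
  Known 6 82%N [:: 2; 1; 32; 8; 16; 7]; Known 39 82%N [:: 7; 4; 1; 8; 16; 35]; Push 24;
  Known 18 79%N [:: 1; 18; 8; 4; 7; 32]; Known 23 79%N [:: 1; 2; 32; 4; 23; 8]; Push 19;
  Fano 9 [:: 1; 8; 16; 2; 4; 32] [:: 3; 13; 6; 15];
  Fano 11 [:: 1; 8; 16; 2; 4; 32] [:: 11; 13; 6; 15];
  Fano 12 [:: 4; 8; 16; 7; 2; 32] [:: 3; 13; 6; 15]; Pop 0%N [:: 1; 2; 17; 25; 5; 33];
  Pop 0%N [:: 1; 2; 5; 33; 9; 25]; Pop 0%N [:: 1; 2; 5; 33; 9; 18]; Push 38;
  Fano 5 [:: 1; 2; 4; 8; 16; 32] [:: 27; 5; 38; 7];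
  Fano 37 [:: 1; 2; 4; 8; 16; 32] [:: 27; 37; 38; 7]; Known 10 78%N [:: 7; 1; 32; 10; 4; 16];
  Known 12 78%N [:: 1; 7; 32; 12; 2; 16]; Known 17 78%N [:: 4; 2; 32; 17; 7; 8];
  Known 23 78%N [:: 2; 4; 32; 23; 1; 8]; Known 25 78%N [:: 7; 1; 32; 25; 4; 8];
  Known 26 78%N [:: 4; 2; 32; 26; 7; 8]; Known 28 78%N [:: 2; 4; 32; 28; 1; 8];
  Known 31 78%N [:: 1; 7; 32; 31; 2; 8]; Known 36 75%N [:: 1; 38; 7; 8; 16; 27];
  Known 39 75%N [:: 2; 38; 4; 8; 16; 27]; Push 24; Known 18 78%N [:: 7; 1; 32; 18; 4; 8];
  Known 19 75%N [:: 16; 19; 24; 1; 4; 32]; Known 20 78%N [:: 2; 1; 24; 7; 16; 32];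
  Known 50 78%N [:: 27; 1; 2; 32; 8; 7]; Pop 0%N [:: 2; 1; 6; 32; 9; 25];
  Pop 0%N [:: 2; 1; 6; 32; 9; 18]; Push 36; Fano 41 [:: 2; 8; 32; 1; 7; 16] [:: 43; 29; 14];
  Fano 50 [:: 1; 16; 32; 2; 7; 8] [:: 43; 29; 14]; Known 6 75%N [:: 2; 6; 32; 7; 8; 16];
  Known 10 75%N [:: 1; 10; 16; 7; 8; 32]; Known 17 75%N [:: 2; 17; 8; 7; 16; 32];
  Known 20 78%N [:: 7; 20; 8; 16; 1; 32]; Known 25 75%N [:: 1; 25; 8; 7; 27; 32];
  Known 26 75%N [:: 2; 26; 8; 7; 27; 32]; Known 31 78%N [:: 7; 31; 8; 27; 1; 32];
  Known 33 87%N [:: 2; 1; 4; 8; 16; 33]; Known 34 87%N [:: 2; 1; 7; 8; 16; 34]; Push 28;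
  Fano 15 [:: 1; 4; 8; 2; 16; 32] [:: 11; 29; 22; 15];
  Fano 23 [:: 1; 4; 16; 2; 8; 32] [:: 11; 29; 22; 15]; Known 18 75%N [:: 1; 18; 8; 7; 16; 32];
  Known 19 78%N [:: 7; 19; 8; 16; 32; 1]; Pop 0%N [:: 4; 32; 5; 7; 12; 28];
  Known 15 88%N [:: 1; 2; 4; 16; 27; 32]; Push 24; Known 18 87%N [:: 2; 1; 27; 7; 32; 8];
  Known 19 85%N [:: 1; 2; 16; 7; 32; 24]; Known 23 88%N [:: 1; 2; 4; 8; 27; 32];
  Pop 0%N [:: 1; 2; 5; 37; 9; 25]; Pop 0%N [:: 1; 2; 5; 37; 9; 18];
  Known 39 90%N [:: 1; 2; 7; 8; 16; 32]; Push 10;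
  Fano 9 [:: 1; 2; 8; 4; 16; 32] [:: 11; 5; 6; 23];
  Fano 18 [:: 2; 8; 16; 27; 4; 32] [:: 3; 5; 30; 15];
  Fano 25 [:: 1; 2; 8; 4; 16; 32] [:: 11; 21; 6; 23];
  Fano 41 [:: 1; 2; 8; 4; 16; 32] [:: 11; 37; 6; 23];
  Fano 50 [:: 2; 8; 16; 27; 4; 32] [:: 3; 37; 30; 15]; Push 20;
  Fano 12 [:: 4; 8; 16; 27; 2; 32] [:: 3; 5; 30; 15];
  Fano 23 [:: 1; 4; 16; 2; 8; 32] [:: 11; 29; 6; 15];
  Fano 24 [:: 4; 8; 16; 1; 7; 32] [:: 27; 5; 6; 23];
  Fano 31 [:: 1; 4; 16; 2; 8; 32] [:: 11; 29; 6; 31]; Push 26;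
  Fano 11 [:: 4; 8; 16; 7; 2; 32] [:: 11; 5; 22; 15];
  Fano 17 [:: 1; 2; 16; 4; 8; 32] [:: 11; 5; 22; 23]; Known 33 90%N [:: 2; 4; 1; 8; 20; 32];
  Push 19; Fano 15 [:: 1; 8; 16; 2; 4; 32] [:: 27; 13; 14; 15];
  Fano 28 [:: 2; 8; 16; 1; 4; 32] [:: 3; 13; 22; 7]; Known 37 90%N [:: 1; 16; 2; 20; 32; 8];
  Push 5; Fano 3 [:: 2; 4; 16; 5; 8; 32] [:: 11; 21; 6; 15];
  Fano 6 [:: 1; 2; 4; 8; 16; 32] [:: 19; 5; 6; 7]; Pop 6%N [:: 4; 32; 34; 8; 19; 20];
  Known 6 91%N [:: 16; 1; 10; 7; 2; 32]; Pop 3%N [:: 32; 2; 40; 26; 1; 7];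
  Known 3 92%N [:: 27; 8; 20; 2; 16; 32]; Known 6 92%N [:: 20; 8; 27; 2; 26; 32];
  Known 28 92%N [:: 4; 2; 1; 8; 26; 32]; Pop 1%N [:: 16; 26; 2; 32; 4; 1];
  Known 6 93%N [:: 16; 1; 10; 7; 2; 32]; Known 28 93%N [:: 7; 2; 4; 10; 20; 32];
  Pop 0%N [:: 2; 8; 3; 7; 19; 34]; Known 23 94%N [:: 1; 2; 7; 8; 16; 32];
  Known 28 94%N [:: 1; 2; 7; 8; 27; 32]; Push 19;
  Fano 24 [:: 2; 8; 16; 1; 4; 32] [:: 3; 13; 6; 15];
  Fano 31 [:: 4; 8; 16; 1; 7; 32] [:: 27; 21; 22; 23]; Known 6 94%N [:: 16; 1; 27; 6; 19; 32];
  Push 26; Fano 11 [:: 1; 8; 16; 2; 4; 32] [:: 11; 13; 14; 15];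
  Fano 12 [:: 4; 8; 16; 7; 2; 32] [:: 3; 13; 22; 15];
  Fano 15 [:: 1; 8; 16; 2; 4; 32] [:: 27; 13; 14; 15];
  Fano 17 [:: 1; 2; 16; 4; 8; 32] [:: 11; 5; 22; 7]; Pop 1%N [:: 8; 10; 7; 34; 19; 16]; Push 15;
  Fano 12 [:: 1; 4; 8; 2; 16; 32] [:: 11; 29; 6; 15]; Pop 0%N [:: 2; 8; 3; 7; 19; 34];
  Known 12 96%N [:: 1; 2; 7; 8; 16; 32]; Pop 0%N [:: 2; 8; 3; 19; 7; 34];
  Known 12 97%N [:: 1; 10; 16; 8; 7; 32]; Push 17;
  Fano 26 [:: 1; 2; 16; 4; 8; 32] [:: 11; 5; 22; 23]; Known 24 97%N [:: 2; 1; 4; 16; 27; 32];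
  Known 31 94%N [:: 2; 1; 4; 16; 27; 32]; Push 6;
  Fano 5 [:: 1; 2; 4; 8; 16; 32] [:: 27; 5; 6; 7];
  Fano 37 [:: 1; 2; 4; 8; 16; 32] [:: 27; 37; 6; 7]; Known 15 97%N [:: 10; 1; 16; 6; 15; 32];
  Pop 0%N [:: 2; 4; 3; 8; 19; 34]; Pop 0%N [:: 1; 16; 3; 11; 4; 33];
  Known 6 99%N [:: 1; 10; 16; 8; 7; 32]; Pop 0%N [:: 2; 8; 3; 7; 24; 34];
  Known 15 100%N [:: 4; 7; 1; 8; 16; 32]; Known 17 100%N [:: 2; 1; 4; 16; 8; 32];
  Known 20 100%N [:: 7; 4; 1; 16; 8; 32]; Known 25 100%N [:: 1; 2; 4; 27; 8; 32];
  Known 26 100%N [:: 2; 1; 4; 27; 8; 32]; Known 28 100%N [:: 4; 7; 1; 27; 8; 32];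
  Known 31 100%N [:: 7; 4; 1; 27; 8; 32]; Push 6;
  Fano 5 [:: 1; 2; 4; 8; 16; 32] [:: 27; 5; 6; 7];
  Fano 37 [:: 1; 2; 4; 8; 16; 32] [:: 27; 37; 6; 7]; Known 12 100%N [:: 7; 4; 1; 8; 16; 32];
  Known 23 100%N [:: 23; 4; 8; 2; 1; 32]; Push 24; Known 18 100%N [:: 27; 1; 8; 6; 4; 32];
  Known 50 100%N [:: 2; 16; 32; 8; 1; 4]; Push 19;
  Fano 9 [:: 1; 8; 16; 2; 4; 32] [:: 3; 13; 6; 15];
  Fano 11 [:: 1; 8; 16; 2; 4; 32] [:: 11; 13; 6; 15];
  Fano 41 [:: 1; 8; 16; 2; 4; 32] [:: 35; 13; 6; 15]; Pop 0%N [:: 2; 4; 3; 16; 24; 34];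
  Pop 0%N [:: 2; 4; 3; 11; 27; 34]; Pop 0%N [:: 2; 4; 3; 11; 16; 34]; Push 24;
  Known 18 100%N [:: 1; 2; 4; 16; 8; 32]; Known 23 100%N [:: 4; 7; 1; 16; 8; 32];
  Known 50 100%N [:: 2; 16; 32; 8; 1; 4]; Push 19;
  Fano 9 [:: 1; 8; 16; 2; 4; 32] [:: 3; 13; 6; 15];
  Fano 11 [:: 1; 8; 16; 2; 4; 32] [:: 11; 13; 6; 15];
  Fano 12 [:: 4; 8; 16; 7; 2; 32] [:: 3; 13; 6; 15];
  Fano 41 [:: 1; 8; 16; 2; 4; 32] [:: 35; 13; 6; 15]; Pop 0%N [:: 1; 2; 17; 25; 5; 32];
  Pop 0%N [:: 1; 2; 5; 9; 25; 32]; Pop 0%N [:: 1; 2; 5; 9; 18; 32];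
  Known 29 106%N [:: 1; 4; 2; 8; 16; 32]; Known 30 106%N [:: 1; 7; 2; 8; 16; 32];
  Known 43 106%N [:: 1; 2; 4; 8; 32; 16]; Known 46 106%N [:: 1; 7; 2; 8; 32; 16];
  Known 51 106%N [:: 1; 2; 4; 16; 32; 8]; Known 53 106%N [:: 1; 4; 2; 16; 32; 8];
  Known 54 106%N [:: 1; 7; 2; 16; 32; 8]; Push 11;
  Fano 13 [:: 2; 4; 8; 1; 16; 32] [:: 11; 13; 14];
  Fano 14 [:: 1; 4; 8; 2; 16; 32] [:: 11; 13; 14];
  Fano 45 [:: 2; 4; 8; 1; 16; 32] [:: 11; 13; 46]; Known 20 106%N [:: 1; 2; 8; 7; 16; 32];
  Known 23 106%N [:: 1; 2; 8; 4; 16; 32]; Known 24 106%N [:: 1; 2; 4; 11; 16; 32];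
  Known 36 106%N [:: 1; 2; 8; 7; 32; 16]; Known 39 106%N [:: 1; 2; 8; 4; 32; 16];
  Known 40 106%N [:: 1; 2; 4; 11; 32; 16]; Known 49 75%N [:: 4; 7; 8; 2; 16; 32];
  Known 50 75%N [:: 4; 7; 8; 1; 16; 32]; Known 52 75%N [:: 1; 2; 8; 7; 16; 32];
  Known 55 75%N [:: 1; 2; 8; 4; 16; 32]; Known 56 75%N [:: 1; 2; 4; 11; 16; 32];
  Known 57 106%N [:: 1; 8; 2; 16; 32; 4]; Known 58 106%N [:: 1; 11; 2; 16; 32; 4];
  Known 60 106%N [:: 4; 8; 7; 16; 32; 1]; Known 63 106%N [:: 4; 11; 7; 16; 32; 1]; Push 35;
  Fano 37 [:: 2; 4; 32; 1; 8; 16] [:: 11; 13; 14];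
  Fano 38 [:: 1; 4; 32; 2; 8; 16] [:: 11; 13; 14];
  Fano 41 [:: 2; 8; 32; 1; 4; 16] [:: 11; 13; 14];
  Fano 42 [:: 1; 8; 32; 2; 4; 16] [:: 11; 13; 14];
  Fano 44 [:: 7; 8; 32; 4; 2; 16] [:: 11; 13; 14];
  Fano 47 [:: 4; 8; 32; 7; 2; 16] [:: 11; 13; 14]; Known 6 106%N [:: 8; 11; 32; 1; 4; 16];
  Known 10 106%N [:: 4; 7; 32; 1; 8; 16]; Known 15 106%N [:: 1; 2; 32; 4; 8; 16];
  Known 18 106%N [:: 4; 7; 8; 1; 16; 32]; Known 21 75%N [:: 8; 11; 32; 1; 7; 16];
  Known 22 75%N [:: 8; 11; 32; 1; 4; 16]; Known 25 75%N [:: 4; 7; 32; 1; 11; 16];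
  Known 26 75%N [:: 4; 7; 32; 1; 8; 16]; Known 28 75%N [:: 1; 2; 32; 4; 11; 16];
  Known 31 75%N [:: 1; 2; 32; 4; 8; 16]; Known 34 106%N [:: 4; 7; 8; 1; 32; 16];
  Pop 0%N [:: 1; 2; 5; 9; 33; 17]; Known 19 107%N [:: 1; 2; 4; 8; 32; 16]; Push 38;
  Fano 5 [:: 1; 2; 4; 8; 16; 32] [:: 11; 5; 38; 7];
  Fano 21 [:: 1; 2; 4; 8; 16; 32] [:: 11; 21; 38; 7];
  Fano 37 [:: 1; 2; 4; 8; 16; 32] [:: 11; 37; 38; 7]; Known 9 106%N [:: 1; 7; 32; 4; 9; 16];
  Known 15 106%N [:: 1; 7; 32; 2; 11; 16]; Known 25 75%N [:: 1; 7; 32; 4; 11; 16];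
  Known 28 75%N [:: 1; 7; 32; 2; 8; 16]; Known 31 75%N [:: 1; 7; 32; 2; 11; 16]; Push 41;
  Fano 10 [:: 1; 2; 8; 4; 16; 32] [:: 11; 37; 6; 7];
  Fano 12 [:: 4; 8; 32; 41; 2; 16] [:: 3; 21; 14; 31];
  Fano 26 [:: 1; 2; 8; 4; 16; 32] [:: 11; 37; 22; 7];
  Fano 42 [:: 1; 2; 8; 4; 16; 32] [:: 11; 37; 38; 7];
  Fano 47 [:: 1; 2; 32; 4; 8; 16] [:: 11; 21; 14; 31]; Known 3 106%N [:: 1; 32; 7; 3; 11; 16];
  Known 6 106%N [:: 1; 8; 2; 6; 38; 16]; Known 18 106%N [:: 1; 7; 32; 4; 16; 8];
  Known 22 107%N [:: 1; 7; 2; 16; 8; 32]; Known 33 106%N [:: 1; 2; 4; 11; 33; 16];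
  Known 34 106%N [:: 1; 2; 4; 8; 34; 16]; Known 48 106%N [:: 1; 7; 2; 16; 38; 8];
  Pop 2%N [:: 17; 1; 2; 4; 32; 8]; Known 44 108%N [:: 1; 2; 4; 11; 16; 38];
  Known 47 108%N [:: 1; 2; 4; 8; 16; 38]; Pop 0%N [:: 2; 1; 6; 10; 32; 16];
  Known 22 109%N [:: 2; 1; 7; 8; 32; 16]; Known 26 109%N [:: 2; 1; 11; 4; 32; 16];
  Known 28 109%N [:: 7; 4; 8; 1; 32; 16]; Known 31 109%N [:: 7; 4; 11; 1; 32; 16];
  Known 42 109%N [:: 2; 1; 11; 4; 16; 32]; Known 44 109%N [:: 7; 4; 8; 1; 16; 32];
  Known 47 109%N [:: 7; 4; 11; 1; 16; 32]; Push 10;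
  Fano 9 [:: 1; 2; 8; 4; 16; 32] [:: 11; 5; 6; 7];
  Fano 25 [:: 1; 2; 8; 4; 16; 32] [:: 11; 21; 6; 7];
  Fano 41 [:: 1; 2; 8; 4; 16; 32] [:: 11; 37; 6; 7]; Push 5;
  Fano 6 [:: 1; 2; 4; 8; 16; 32] [:: 11; 5; 6; 7]; Push 12;
  Fano 3 [:: 2; 4; 8; 5; 16; 32] [:: 11; 5; 6; 15];
  Fano 15 [:: 1; 4; 8; 2; 16; 32] [:: 3; 13; 6; 15]; Known 17 109%N [:: 5; 4; 10; 16; 32; 2];
  Known 33 109%N [:: 5; 4; 10; 32; 16; 2]; Pop 1%N [:: 1; 4; 16; 32; 10; 8];
  Pop 0%N [:: 1; 4; 3; 11; 17; 33]; Known 6 111%N [:: 1; 2; 7; 8; 16; 32];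
  Known 12 111%N [:: 8; 11; 2; 7; 16; 32]; Pop 0%N [:: 2; 8; 3; 7; 18; 34];
  Known 6 112%N [:: 2; 1; 8; 7; 16; 32]; Known 15 112%N [:: 7; 4; 1; 11; 16; 32];
  Pop 0%N [:: 1; 2; 5; 9; 16; 32]; Known 14 113%N [:: 1; 7; 2; 8; 16; 32];
  Known 19 113%N [:: 1; 2; 4; 16; 8; 32]; Known 22 113%N [:: 1; 7; 2; 16; 8; 32];
  Known 35 113%N [:: 1; 2; 4; 32; 8; 16]; Known 37 113%N [:: 1; 4; 2; 32; 8; 16];
  Known 38 113%N [:: 1; 7; 2; 32; 8; 16]; Push 6; Push 5;
  Fano 3 [:: 1; 2; 4; 8; 16; 32] [:: 3; 5; 6; 7]; Known 9 113%N [:: 4; 5; 6; 8; 16; 32];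
  Known 15 113%N [:: 1; 6; 2; 8; 16; 32]; Known 17 113%N [:: 4; 5; 6; 16; 8; 32];
  Known 23 113%N [:: 1; 6; 2; 16; 8; 32]; Known 25 106%N [:: 4; 5; 6; 8; 16; 32];
  Known 26 106%N [:: 4; 6; 5; 8; 16; 32]; Known 28 106%N [:: 1; 5; 2; 8; 16; 32];
  Known 31 106%N [:: 1; 6; 2; 8; 16; 32]; Known 33 113%N [:: 4; 5; 6; 32; 8; 16];
  Known 39 113%N [:: 1; 6; 2; 32; 8; 16]; Known 41 106%N [:: 4; 5; 6; 8; 32; 16];
  Known 42 106%N [:: 4; 6; 5; 8; 32; 16]; Known 44 106%N [:: 1; 5; 2; 8; 32; 16];
  Known 45 106%N [:: 1; 4; 2; 8; 32; 16]; Known 47 106%N [:: 1; 6; 2; 8; 32; 16];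
  Known 49 106%N [:: 4; 5; 6; 16; 32; 8]; Known 50 106%N [:: 4; 6; 5; 16; 32; 8];
  Known 52 106%N [:: 1; 5; 2; 16; 32; 8]; Known 55 106%N [:: 1; 6; 2; 16; 32; 8];
  Known 57 75%N [:: 4; 5; 6; 8; 16; 32]; Known 58 75%N [:: 4; 6; 5; 8; 16; 32];
  Known 60 75%N [:: 1; 5; 2; 8; 16; 32]; Known 63 75%N [:: 1; 6; 2; 8; 16; 32]; Push 56;
  Known 34 113%N [:: 4; 6; 5; 32; 8; 16]; Known 36 113%N [:: 1; 5; 2; 32; 8; 16]; Push 48;
  Push 40; Fano 24 [:: 8; 16; 32; 1; 2; 4] [:: 3; 5; 6; 7];
  Known 18 113%N [:: 2; 18; 32; 40; 1; 4]; Known 20 113%N [:: 1; 5; 2; 16; 8; 32];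
  Known 21 113%N [:: 1; 4; 2; 16; 8; 32]; Pop 0%N [:: 4; 1; 6; 36; 12; 52];
  Pop 0%N [:: 4; 1; 6; 20; 52; 12]; Pop 0%N [:: 4; 1; 6; 12; 20; 44];
  Pop 0%N [:: 4; 1; 6; 12; 20; 36]; Known 3 117%N [:: 2; 7; 1; 8; 16; 32]; Push 9;
  Known 10 113%N [:: 1; 2; 4; 9; 16; 32]; Known 12 113%N [:: 1; 4; 2; 9; 16; 32];
  Known 26 106%N [:: 1; 2; 4; 9; 16; 32]; Known 28 106%N [:: 1; 4; 2; 9; 16; 32];
  Known 31 113%N [:: 6; 9; 7; 16; 2; 32]; Known 42 106%N [:: 1; 2; 4; 9; 32; 16];
  Known 44 106%N [:: 1; 4; 2; 9; 32; 16]; Known 45 106%N [:: 1; 4; 2; 8; 32; 16];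
  Known 47 113%N [:: 6; 9; 7; 32; 2; 16]; Known 49 106%N [:: 6; 7; 8; 16; 32; 2];
  Known 58 75%N [:: 1; 2; 4; 9; 16; 32]; Known 60 75%N [:: 1; 4; 2; 9; 16; 32];
  Known 63 106%N [:: 6; 9; 7; 16; 32; 2]; Push 36; Known 17 113%N [:: 6; 7; 8; 16; 2; 32];
  Known 20 113%N [:: 2; 6; 16; 32; 1; 8]; Known 21 113%N [:: 1; 4; 2; 16; 8; 32];
  Known 33 113%N [:: 1; 4; 2; 33; 8; 16]; Known 39 113%N [:: 1; 2; 4; 36; 8; 16];
  Known 40 106%N [:: 1; 4; 2; 9; 36; 16]; Known 41 106%N [:: 1; 4; 2; 8; 36; 16];
  Known 55 106%N [:: 1; 2; 4; 16; 36; 8]; Known 56 75%N [:: 1; 4; 2; 9; 16; 36];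
  Known 57 75%N [:: 1; 4; 2; 8; 16; 36]; Push 24; Known 18 106%N [:: 1; 2; 4; 9; 18; 32];
  Known 25 117%N [:: 8; 25; 1; 2; 4; 32]; Known 48 75%N [:: 1; 4; 2; 9; 24; 36];
  Known 50 113%N [:: 2; 32; 6; 16; 1; 8]; Known 52 75%N [:: 1; 4; 2; 9; 24; 32];
  Pop 0%N [:: 4; 2; 5; 13; 21; 32]; Known 25 118%N [:: 1; 2; 4; 9; 16; 32];
  Known 48 118%N [:: 4; 7; 1; 32; 16; 8]; Known 52 118%N [:: 4; 7; 1; 36; 16; 8];
  Pop 0%N [:: 4; 2; 5; 13; 32; 18]; Known 18 119%N [:: 2; 7; 1; 16; 32; 8];
  Known 20 119%N [:: 4; 7; 1; 16; 32; 8]; Known 25 119%N [:: 9; 7; 6; 16; 32; 2];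
  Known 34 119%N [:: 2; 7; 1; 32; 16; 8]; Known 41 119%N [:: 9; 7; 6; 32; 16; 2]; Push 56;
  Known 33 113%N [:: 6; 7; 8; 32; 2; 16]; Known 39 106%N [:: 1; 32; 6; 9; 16; 2];
  Known 40 119%N [:: 40; 9; 1; 16; 2; 6]; Known 50 113%N [:: 2; 50; 8; 16; 1; 4];
  Known 52 113%N [:: 4; 52; 8; 16; 1; 2]; Known 57 113%N [:: 6; 7; 8; 56; 2; 16];
  Pop 0%N [:: 1; 8; 5; 7; 16; 48]; Known 50 120%N [:: 6; 8; 9; 2; 16; 32];
  Known 52 120%N [:: 6; 8; 9; 4; 16; 32]; Known 57 120%N [:: 1; 2; 4; 9; 16; 32]; Push 55;
  Known 33 113%N [:: 6; 7; 8; 32; 2; 16]; Known 40 119%N [:: 8; 7; 6; 32; 16; 2];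
  Known 48 119%N [:: 48; 6; 1; 16; 2; 8]; Pop 0%N [:: 1; 8; 5; 7; 16; 39];
  Pop 0%N [:: 1; 8; 5; 7; 16; 32]; Known 15 122%N [:: 6; 8; 15; 2; 16; 32];
  Known 17 122%N [:: 1; 2; 4; 16; 8; 32]; Known 23 122%N [:: 6; 16; 23; 2; 8; 32];
  Known 33 122%N [:: 1; 2; 4; 32; 8; 16]; Known 34 122%N [:: 2; 1; 7; 32; 8; 16];
  Known 36 122%N [:: 4; 1; 7; 32; 8; 16]; Known 39 122%N [:: 6; 32; 39; 2; 8; 16]; Push 41;
  Known 10 122%N [:: 2; 1; 7; 8; 16; 32]; Known 13 113%N [:: 1; 4; 2; 8; 16; 32];
  Known 25 113%N [:: 1; 8; 16; 32; 2; 4]; Known 26 75%N [:: 1; 2; 4; 16; 26; 32];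
  Known 31 106%N [:: 1; 8; 32; 6; 16; 2]; Known 42 113%N [:: 1; 2; 4; 41; 8; 16];
  Known 45 122%N [:: 4; 1; 7; 41; 8; 16]; Known 47 113%N [:: 1; 7; 2; 41; 8; 16];
  Known 49 113%N [:: 1; 32; 8; 16; 2; 4]; Known 50 75%N [:: 1; 2; 4; 8; 16; 41];
  Known 52 75%N [:: 1; 4; 2; 8; 16; 41]; Known 55 106%N [:: 1; 32; 8; 6; 16; 2];
  Known 56 113%N [:: 1; 41; 8; 16; 2; 4]; Known 58 106%N [:: 1; 2; 4; 16; 41; 8];
  Known 63 106%N [:: 1; 7; 2; 16; 41; 8]; Push 48; Known 18 122%N [:: 2; 32; 48; 4; 1; 8];
  Known 20 122%N [:: 4; 32; 48; 2; 1; 8]; Known 21 113%N [:: 1; 4; 2; 16; 8; 32];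
  Known 57 113%N [:: 1; 8; 32; 48; 2; 4]; Known 60 106%N [:: 1; 4; 2; 16; 41; 8];
  Pop 0%N [:: 1; 4; 6; 8; 40; 24]; Known 24 123%N [:: 1; 2; 4; 32; 16; 8];
  Known 57 123%N [:: 1; 2; 4; 8; 16; 41]; Pop 0%N [:: 1; 4; 6; 8; 40; 20];
  Known 25 124%N [:: 1; 2; 4; 8; 32; 16]; Known 26 124%N [:: 2; 1; 7; 8; 32; 16];
  Known 28 124%N [:: 4; 1; 7; 8; 32; 16]; Known 31 124%N [:: 7; 2; 4; 8; 32; 16];
  Known 47 124%N [:: 7; 2; 4; 8; 16; 32]; Known 49 124%N [:: 1; 2; 4; 16; 8; 32];
  Known 50 124%N [:: 2; 1; 7; 16; 8; 32]; Known 52 124%N [:: 4; 1; 7; 16; 8; 32];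
  Known 55 124%N [:: 7; 2; 4; 16; 8; 32]; Push 40; Known 57 124%N [:: 1; 2; 4; 16; 8; 40];
  Known 58 124%N [:: 2; 1; 7; 16; 8; 40]; Known 60 124%N [:: 4; 1; 7; 16; 8; 40];
  Known 63 124%N [:: 7; 2; 4; 16; 8; 40]; Push 56; Known 48 117%N [:: 32; 56; 8; 1; 2; 4];
  Pop 0%N [:: 2; 4; 5; 8; 40; 16]; Known 48 125%N [:: 2; 1; 7; 8; 16; 40];
  Pop 0%N [:: 2; 4; 5; 8; 40; 16]; Known 48 126%N [:: 2; 1; 7; 16; 8; 32]; Push 57;
  Known 12 122%N [:: 4; 1; 7; 8; 16; 32]; Known 13 113%N [:: 1; 4; 2; 8; 16; 32];
  Known 18 122%N [:: 2; 1; 7; 16; 8; 32]; Known 21 113%N [:: 1; 4; 2; 16; 8; 32];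
  Known 44 124%N [:: 4; 1; 7; 8; 16; 32]; Known 58 113%N [:: 1; 2; 4; 57; 8; 16];
  Known 60 113%N [:: 1; 4; 2; 57; 8; 16]; Known 63 113%N [:: 1; 7; 2; 57; 8; 16];
  Pop 5%N [:: 1; 10; 4; 6; 42; 20]; Known 58 127%N [:: 2; 1; 7; 8; 16; 32];
  Known 60 127%N [:: 4; 1; 7; 8; 16; 32]; Known 63 127%N [:: 7; 2; 4; 8; 16; 32];
  Pop 0%N [:: 2; 4; 5; 8; 16; 40]; Push 12; Known 9 128%N [:: 4; 1; 9; 2; 16; 32];
  Known 10 128%N [:: 4; 2; 10; 1; 16; 32]; Known 25 106%N [:: 1; 4; 2; 12; 16; 32];
  Known 26 106%N [:: 1; 7; 2; 12; 16; 32]; Known 28 128%N [:: 16; 4; 8; 1; 2; 32];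
  Known 31 106%N [:: 1; 2; 4; 12; 16; 32]; Known 36 128%N [:: 32; 8; 12; 1; 2; 16];
  Known 40 128%N [:: 32; 4; 12; 1; 2; 16]; Known 41 106%N [:: 1; 4; 2; 12; 32; 16];
  Known 42 106%N [:: 1; 7; 2; 12; 32; 16]; Known 44 128%N [:: 32; 4; 8; 1; 2; 16];
  Known 45 106%N [:: 1; 4; 2; 8; 32; 16]; Known 47 106%N [:: 1; 2; 4; 12; 32; 16];
  Known 57 75%N [:: 1; 4; 2; 12; 16; 32]; Known 58 75%N [:: 1; 7; 2; 12; 16; 32];
  Known 63 75%N [:: 1; 2; 4; 12; 16; 32]; Push 33; Known 17 128%N [:: 32; 16; 17; 2; 4; 8];
  Known 20 128%N [:: 16; 8; 12; 1; 2; 32]; Known 21 113%N [:: 1; 4; 2; 16; 8; 32];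
  Known 24 128%N [:: 16; 4; 12; 1; 2; 32]; Known 39 128%N [:: 7; 1; 33; 2; 8; 16];
  Known 48 128%N [:: 16; 1; 33; 2; 4; 8]; Known 49 128%N [:: 16; 1; 32; 2; 4; 8];
  Known 52 106%N [:: 1; 4; 2; 16; 33; 8]; Known 55 106%N [:: 1; 7; 2; 16; 33; 8];
  Known 56 75%N [:: 1; 4; 2; 12; 16; 33]; Known 60 75%N [:: 1; 4; 2; 8; 16; 33];
  Pop 0%N [:: 1; 32; 5; 2; 13; 18]; Known 17 129%N [:: 1; 2; 4; 8; 32; 16];
  Known 18 129%N [:: 2; 1; 4; 8; 32; 16]; Known 34 129%N [:: 2; 1; 4; 8; 16; 32];
  Known 39 129%N [:: 4; 1; 7; 32; 16; 8]; Push 50; Known 3 128%N [:: 4; 1; 2; 8; 16; 32];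
  Known 15 128%N [:: 7; 4; 12; 1; 16; 32]; Known 23 129%N [:: 4; 1; 7; 16; 32; 8];
  Known 49 113%N [:: 1; 2; 4; 49; 8; 16]; Known 55 113%N [:: 1; 4; 2; 50; 8; 16];
  Known 60 113%N [:: 2; 50; 12; 16; 1; 4]; Pop 0%N [:: 2; 4; 5; 8; 16; 48];
  Known 49 130%N [:: 2; 1; 4; 8; 16; 32]; Push 60; Known 13 128%N [:: 4; 1; 13; 2; 16; 32];
  Known 15 130%N [:: 1; 12; 15; 7; 16; 32]; Known 24 130%N [:: 32; 4; 24; 8; 1; 2];
  Known 56 128%N [:: 56; 8; 12; 1; 2; 16]; Pop 0%N [:: 4; 8; 1; 3; 20; 52];
  Pop 0%N [:: 4; 8; 5; 7; 16; 48]; Known 15 132%N [:: 1; 2; 7; 8; 16; 32];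
  Known 20 132%N [:: 1; 2; 4; 16; 8; 32]; Known 23 132%N [:: 1; 2; 7; 16; 8; 32];
  Known 33 132%N [:: 2; 4; 1; 32; 8; 16]; Known 34 132%N [:: 1; 4; 2; 32; 8; 16];
  Known 36 132%N [:: 1; 2; 4; 32; 8; 16]; Known 39 132%N [:: 1; 2; 7; 32; 8; 16]; Push 44;
  Known 3 132%N [:: 8; 32; 4; 3; 1; 16]; Known 9 132%N [:: 2; 4; 1; 8; 16; 32];
  Known 17 132%N [:: 2; 4; 1; 16; 8; 32]; Known 25 75%N [:: 1; 4; 2; 16; 25; 32];
  Known 26 75%N [:: 1; 7; 2; 16; 26; 32]; Known 28 113%N [:: 4; 8; 16; 32; 1; 2];
  Known 31 75%N [:: 1; 2; 4; 16; 31; 32]; Known 41 113%N [:: 1; 4; 2; 41; 8; 16];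
  Known 47 113%N [:: 1; 2; 4; 44; 8; 16]; Known 48 132%N [:: 4; 8; 32; 16; 1; 2];
  Known 49 75%N [:: 1; 4; 2; 8; 16; 44]; Known 50 75%N [:: 1; 7; 2; 8; 16; 44];
  Known 52 113%N [:: 4; 32; 8; 16; 1; 2]; Known 55 75%N [:: 1; 2; 4; 8; 16; 44];
  Known 57 106%N [:: 1; 4; 2; 16; 44; 8]; Known 58 106%N [:: 1; 7; 2; 16; 44; 8];
  Known 60 132%N [:: 4; 8; 44; 16; 1; 2]; Known 63 106%N [:: 1; 2; 4; 16; 44; 8];
  Pop 0%N [:: 4; 1; 6; 12; 44; 20]; Known 25 133%N [:: 2; 4; 1; 8; 32; 16];
  Known 26 133%N [:: 1; 4; 2; 8; 32; 16]; Known 28 133%N [:: 1; 2; 4; 8; 32; 16];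
  Known 31 133%N [:: 1; 2; 7; 8; 32; 16]; Known 47 133%N [:: 1; 2; 7; 8; 16; 32];
  Known 49 133%N [:: 2; 4; 1; 16; 8; 32]; Known 50 133%N [:: 1; 4; 2; 16; 8; 32];
  Known 52 133%N [:: 1; 2; 4; 16; 8; 32]; Known 55 133%N [:: 1; 2; 7; 16; 8; 32]; Push 40;
  Known 48 128%N [:: 16; 8; 40; 1; 2; 4]; Known 57 133%N [:: 2; 4; 1; 16; 8; 40];
  Known 58 133%N [:: 1; 4; 2; 16; 8; 40]; Known 60 133%N [:: 1; 2; 4; 16; 8; 40];
  Known 63 133%N [:: 1; 2; 7; 16; 8; 40]; Pop 0%N [:: 1; 2; 5; 8; 40; 16];
  Known 48 134%N [:: 1; 2; 4; 16; 8; 32]; Push 60; Known 3 128%N [:: 4; 1; 2; 8; 16; 32];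
  Known 9 132%N [:: 2; 4; 1; 8; 16; 32]; Known 17 132%N [:: 2; 4; 1; 16; 8; 32];
  Known 18 132%N [:: 1; 4; 2; 16; 8; 32]; Known 21 113%N [:: 1; 4; 2; 16; 8; 32];
  Known 24 134%N [:: 1; 2; 4; 8; 32; 16]; Known 41 133%N [:: 2; 4; 1; 8; 16; 32];
  Known 57 113%N [:: 1; 4; 2; 57; 8; 16]; Known 63 113%N [:: 1; 2; 4; 60; 8; 16];
  Pop 0%N [:: 4; 1; 6; 12; 44; 60]; Known 57 135%N [:: 2; 4; 1; 8; 16; 32];
  Known 58 135%N [:: 1; 4; 2; 8; 16; 32]; Known 63 135%N [:: 1; 2; 7; 8; 16; 32];
  Pop 0%N [:: 1; 2; 5; 8; 16; 40]; Known 11 136%N [:: 1; 2; 8; 4; 16; 32];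
  Known 13 136%N [:: 1; 4; 8; 2; 16; 32]; Known 14 136%N [:: 2; 4; 8; 1; 16; 32];
  Known 19 136%N [:: 1; 2; 16; 4; 8; 32]; Known 21 136%N [:: 1; 4; 16; 2; 8; 32];
  Known 22 136%N [:: 2; 4; 16; 1; 8; 32]; Known 25 136%N [:: 1; 8; 16; 2; 4; 32];
  Known 26 136%N [:: 2; 8; 16; 1; 4; 32]; Known 28 136%N [:: 4; 8; 16; 1; 2; 32];
  Known 35 136%N [:: 1; 2; 32; 4; 8; 16]; Known 37 136%N [:: 1; 4; 32; 2; 8; 16];
  Known 38 136%N [:: 2; 4; 32; 1; 8; 16]; Known 41 136%N [:: 1; 8; 32; 2; 4; 16];
  Known 42 136%N [:: 2; 8; 32; 1; 4; 16]; Known 44 136%N [:: 4; 8; 32; 1; 2; 16];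
  Known 49 136%N [:: 1; 16; 32; 2; 4; 8]; Known 50 136%N [:: 2; 16; 32; 1; 4; 8];
  Known 52 136%N [:: 4; 16; 32; 1; 2; 8]; Known 56 136%N [:: 8; 16; 32; 1; 2; 4]; Push 15;
  Known 6 136%N [:: 1; 6; 8; 2; 16; 32]; Known 9 136%N [:: 2; 4; 9; 1; 16; 32];
  Known 12 136%N [:: 1; 2; 12; 4; 16; 32]; Known 23 136%N [:: 8; 15; 16; 1; 2; 32];
  Known 29 136%N [:: 2; 15; 16; 1; 4; 32]; Known 30 136%N [:: 1; 15; 16; 2; 4; 32];
  Known 39 136%N [:: 8; 15; 32; 1; 2; 16]; Known 45 136%N [:: 2; 15; 32; 1; 4; 16];
  Known 46 136%N [:: 1; 15; 32; 2; 4; 16]; Known 63 136%N [:: 15; 16; 32; 1; 2; 4]; Push 51;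
  Fano 53 [:: 2; 4; 16; 1; 8; 32] [:: 27; 45; 46];
  Fano 54 [:: 1; 4; 16; 2; 8; 32] [:: 27; 45; 46];
  Fano 57 [:: 2; 8; 16; 1; 4; 32] [:: 27; 45; 46];
  Fano 58 [:: 1; 8; 16; 2; 4; 32] [:: 27; 45; 46];
  Fano 61 [:: 2; 4; 16; 1; 8; 32] [:: 27; 45; 62];
  Fano 62 [:: 1; 4; 16; 2; 8; 32] [:: 27; 45; 62]; Known 18 136%N [:: 1; 18; 32; 2; 4; 8];
  Known 33 136%N [:: 2; 16; 33; 1; 4; 8]; Known 43 136%N [:: 4; 15; 32; 1; 2; 16];
  Known 48 136%N [:: 1; 2; 48; 4; 8; 16]; Push 36;
  Fano 20 [:: 4; 16; 32; 51; 2; 8] [:: 3; 5; 30; 47];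
  Fano 27 [:: 8; 16; 32; 1; 2; 15] [:: 27; 61; 30];
  Fano 40 [:: 4; 8; 32; 15; 2; 16] [:: 27; 5; 6; 47];
  Fano 47 [:: 1; 4; 32; 2; 8; 16] [:: 27; 45; 6; 31];
  Fano 55 [:: 1; 4; 32; 2; 8; 16] [:: 27; 45; 6; 47]; Known 3 136%N [:: 3; 4; 8; 1; 16; 32];
  Known 24 136%N [:: 15; 24; 36; 1; 2; 4]; Known 60 136%N [:: 8; 16; 36; 1; 2; 4];
  Pop 4%N [:: 1; 17; 8; 59; 31; 10]; Known 24 137%N [:: 1; 2; 8; 4; 32; 16];
  Known 31 137%N [:: 1; 2; 15; 4; 32; 16]; Known 47 137%N [:: 1; 2; 15; 4; 16; 32];
  Known 55 137%N [:: 1; 2; 4; 8; 16; 51]; Known 59 137%N [:: 1; 2; 8; 4; 16; 51];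
  Known 60 137%N [:: 1; 2; 15; 4; 16; 51]; Pop 0%N [:: 1; 2; 5; 10; 17; 34];
  Known 53 138%N [:: 1; 4; 2; 8; 16; 32]; Known 54 138%N [:: 2; 4; 1; 8; 16; 32];
  Known 55 138%N [:: 8; 15; 1; 2; 16; 32]; Known 57 138%N [:: 1; 8; 2; 4; 16; 32];
  Known 58 138%N [:: 2; 8; 1; 4; 16; 32]; Known 59 138%N [:: 4; 15; 1; 2; 16; 32];
  Known 60 138%N [:: 4; 8; 1; 2; 16; 32]; Known 61 138%N [:: 2; 15; 1; 4; 16; 32];
  Known 62 138%N [:: 1; 15; 2; 4; 16; 32]; Push 36; Known 34 136%N [:: 2; 4; 34; 1; 8; 16];
  Known 40 136%N [:: 4; 8; 36; 1; 2; 16]; Known 47 136%N [:: 4; 15; 36; 1; 2; 16]; Push 18;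
  Known 20 138%N [:: 18; 20; 1; 8; 2; 32]; Known 24 136%N [:: 2; 8; 18; 1; 4; 32];
  Known 27 138%N [:: 16; 27; 1; 2; 15; 32]; Known 31 136%N [:: 2; 15; 18; 1; 4; 32];
  Known 48 138%N [:: 2; 4; 1; 8; 18; 36]; Pop 0%N [:: 2; 16; 1; 5; 33; 10];
  Known 24 139%N [:: 1; 4; 8; 2; 32; 16]; Known 31 139%N [:: 1; 4; 15; 2; 32; 16];
  Pop 0%N [:: 4; 32; 1; 3; 11; 16]; Known 18 140%N [:: 1; 4; 2; 8; 32; 16];
  Known 24 140%N [:: 1; 2; 8; 4; 32; 16]; Known 31 140%N [:: 1; 2; 15; 4; 32; 16];
  Known 34 140%N [:: 1; 4; 2; 8; 16; 32]; Known 40 140%N [:: 1; 2; 8; 4; 16; 32];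
  Known 47 140%N [:: 1; 2; 15; 4; 16; 32]; Pop 0%N [:: 1; 2; 5; 10; 17; 33];
  Known 23 141%N [:: 1; 2; 4; 16; 8; 32]; Known 27 141%N [:: 1; 2; 8; 16; 4; 32];
  Known 29 141%N [:: 1; 4; 8; 16; 2; 32]; Known 30 141%N [:: 2; 4; 8; 16; 1; 32];
  Known 39 141%N [:: 1; 2; 4; 32; 8; 16]; Known 43 141%N [:: 1; 2; 8; 32; 4; 16];
  Known 45 141%N [:: 1; 4; 8; 32; 2; 16]; Known 46 141%N [:: 2; 4; 8; 32; 1; 16];
  Known 51 141%N [:: 1; 2; 16; 32; 4; 8]; Known 53 141%N [:: 1; 4; 16; 32; 2; 8];
  Known 54 141%N [:: 2; 4; 16; 32; 1; 8]; Known 57 141%N [:: 1; 8; 16; 32; 2; 4];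
  Known 58 141%N [:: 2; 8; 16; 32; 1; 4]; Known 60 141%N [:: 4; 8; 16; 32; 1; 2]; Push 47;
  Known 6 141%N [:: 1; 6; 8; 32; 2; 16]; Known 9 141%N [:: 2; 4; 9; 32; 1; 16];
  Known 12 141%N [:: 1; 2; 12; 32; 4; 16]; Known 31 136%N [:: 16; 31; 32; 1; 2; 4];
  Known 33 141%N [:: 2; 4; 8; 33; 1; 16]; Known 34 141%N [:: 1; 4; 8; 34; 2; 16];
  Known 40 141%N [:: 1; 2; 4; 40; 8; 16]; Known 59 136%N [:: 4; 16; 47; 1; 2; 8];
  Known 61 136%N [:: 2; 16; 47; 1; 4; 8]; Known 62 136%N [:: 1; 16; 47; 2; 4; 8]; Push 48;
  Known 17 136%N [:: 1; 17; 32; 2; 4; 8]; Known 18 136%N [:: 2; 18; 32; 1; 4; 8];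
  Known 20 136%N [:: 4; 20; 32; 1; 2; 8]; Known 24 136%N [:: 8; 24; 32; 1; 2; 4];
  Pop 0%N [:: 32; 16; 37; 36; 39; 47]; Known 17 142%N [:: 2; 4; 8; 32; 16; 1];
  Known 20 142%N [:: 1; 2; 8; 32; 16; 4]; Known 63 142%N [:: 1; 2; 4; 8; 16; 47];
  Pop 0%N [:: 1; 2; 5; 10; 37; 18]; Known 31 143%N [:: 1; 2; 4; 8; 32; 16];
  Known 55 143%N [:: 1; 2; 4; 16; 8; 32]; Known 59 143%N [:: 1; 2; 8; 16; 4; 32];
  Known 61 143%N [:: 1; 4; 8; 16; 2; 32]; Known 62 143%N [:: 2; 4; 8; 16; 1; 32]; Push 63;
  Known 5 143%N [:: 2; 5; 8; 16; 1; 32]; Known 6 143%N [:: 1; 6; 8; 16; 2; 32];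
  Known 9 143%N [:: 2; 4; 9; 16; 1; 32]; Known 17 143%N [:: 2; 4; 8; 17; 1; 32];
  Known 18 143%N [:: 1; 4; 8; 18; 2; 32]; Known 24 143%N [:: 1; 2; 4; 24; 8; 32];
  Known 34 143%N [:: 1; 4; 8; 16; 2; 34]; Known 36 143%N [:: 1; 2; 8; 16; 4; 36];
  Known 40 143%N [:: 1; 2; 4; 16; 8; 40]; Pop 4%N [:: 1; 2; 4; 12; 51; 16];
  Pop 0%N [:: 1; 2; 4; 8; 16; 32]])%num.

(** At the outermost level the script pushes 7, 15, 47 and 63, with three, four, five and six ones;
    the first three are transferred by [Known] to all vectors with equally many ones. The last [Pop]
    is left with the vectors with one or two ones, which are the edges of K7 over the starting
    basis. *)
Definition script_ok : bool :=
  has (beqs units6) (run targets classification_script [:: (units6, [::])] [::]).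

Lemma script_okE : script_ok.
Proof. by lazy. Qed.

(** * Regularity of the targets *)

Inductive trit := T0 | T1 | TN.

Definition tz (t : trit) : int := match t with T0 => 0 | T1 => 1 | TN => -1 end.

Definition topp (t : trit) := match t with T0 => T0 | T1 => TN | TN => T1 end.

Definition tmul (s t : trit) :=
  match s with T0 => T0 | T1 => t | TN => topp t end.

(** [None] stands for the values 2 and -2, at which the check gives up. *)
Definition tsub (s t : trit) : option trit :=
  match s, t with
  | T0, _ => Some (topp t)
  | _, T0 => Some s
  | T1, T1 | TN, TN => Some T0
  | _, _ => None
  end.

Fixpoint tzero (x : seq trit) : bool :=
  match x with [::] => true | T0 :: x' => tzero x' | _ => false end.

Fixpoint teq (x y : seq trit) : bool :=
  match x, y with
  | [::], [::] => true
  | a :: x', b :: y' =>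
      match tsub a b with Some T0 => teq x' y' | _ => false end
  | _, _ => false
  end.

Fixpoint tmem (x : seq trit) (s : seq (seq trit)) : bool :=
  match s with [::] => false | y :: s' => if teq x y then true else tmem x s' end.

(* [x - s a c], or [None] when an entry leaves {0, 1, -1} *)
Fixpoint tcomb (s a : trit) (c x : seq trit) : option (seq trit) :=
  match c, x with
  | [::], [::] => Some [::]
  | d :: c', b :: x' =>
      match tsub b (tmul (tmul s a) d), tcomb s a c' x' with
      | Some e, Some y => Some (e :: y)
      | _, _ => None
      end
  | _, _ => None
  end.

Fixpoint telim (c x : seq trit) : option (seq trit) :=
  match c, x with
  | T0 :: c', a :: x' =>
      match telim c' x' with Some y => Some (a :: y) | None => None end
  | s :: c', a :: x' => tcomb s a c' x'
  | _, _ => None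
  end.

Fixpoint tnorm (x : seq trit) : seq trit :=
  match x with
  | [::] => [::]
  | T0 :: x' => T0 :: tnorm x'
  | T1 :: _ => x
  | TN :: _ => map topp x
  end.

(** Zero columns, and columns equal up to sign to one already kept, yield no new determinant up to
    sign. Dropping them keeps the recursion of [ucheck] small. *)
Fixpoint tproject (c : seq trit) (L : seq (seq trit)) : option (seq (seq trit)) :=
  match L with
  | [::] => Some [::]
  | x :: L' =>
      match telim c x, tproject c L' with
      | Some y, Some L1 =>
          Some (if tzero y then L1
                else let z := tnorm y in if tmem z L1 then L1 else z :: L1)
      | _, _ => None
      end
  end.

(* All k x k determinants with columns in L lie in {0, 1, -1}: those avoiding the
   head c of L by recursion, the others by pivoting on c. *)
Fixpoint ucheck (k : nat) : seq (seq trit) -> bool :=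
  match k with
  | 0 => fun=> true
  | k'.+1 => fix go L :=
      match L with
      | [::] => true
      | c :: L' =>
          if go L' then
            if tzero c then true
            else match tproject c L' with
                 | Some L1 => ucheck k' L1
                 | None => false
                 end
          else false
      end
  end.

Definition tcol (k : nat) (x : seq trit) : 'cV[int]_k := \col_i tz (nth T0 x i).

(** The columns that a list stands for once [tproject] has discarded zeros and repetitions.
    Membership is [List.In] because [trit] is not equipped with a decidable equality structure. *)
Definition up_to_sign (k : nat) (L : seq (seq trit)) (v : 'cV[int]_k) : Prop :=
  v = 0 \/ exists2 x, List.In x L & v = tcol k x \/ v = - tcol k x.

Lemma tz_opp t : tz (topp t) = - tz t. Proof. by case: t. Qed.

Lemma tz_mul s t : tz (tmul s t) = tz s * tz t. Proof. by case: s t => [] []. Qed.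

Lemma tz_sub s t r : tsub s t = Some r -> tz r = tz s - tz t.
Proof. by case: s t => [] [] //= [<-]. Qed.

Lemma tzeroP k x : tzero x -> tcol k x = 0.
Proof.
move=> x0; apply/matrixP => i j; rewrite !mxE; move: (nat_of_ord i).
by elim: x x0 => [|[] x IHx] //= x0 [|n] //=; apply: IHx.
Qed.

Lemma teqP x y : teq x y -> x = y.
Proof.
by elim: x y => [|a x IHx] [|b y] //=; case: a b => [] [] //= /IHx->.
Qed.

Lemma tmemP x s : tmem x s -> List.In x s.
Proof. by elim: s => //= y s IHs; case: ifP => [/teqP->|_ /IHs]; [left|right]. Qed.

Lemma tcol_opp k x : tcol k (map topp x) = - tcol k x.
Proof.
apply/matrixP => i j; rewrite !mxE; move: (nat_of_ord i).
by elim: x => [|a x IHx] [|n] //=; rewrite tz_opp.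
Qed.

Lemma tnormP k x : tcol k (tnorm x) = tcol k x \/ tcol k (tnorm x) = - tcol k x.
Proof.
have : tnorm x = x \/ tnorm x = map topp x.
  elim: x => [|[] x IHx] /=; [by left | | by left | by right].
  by case: IHx => ->; [left | right].
by case=> ->; rewrite ?tcol_opp; auto.
Qed.

Lemma tcombP s a c x y i : tcomb s a c x = Some y ->
  tz (nth T0 y i) = tz (nth T0 x i) - tz s * tz a * tz (nth T0 c i).
Proof.
elim: c x y i => [|d c IHc] [|b x] y i //=.
  by case=> <-; rewrite nth_nil mulr0 subr0.
case E: tsub => [e|] //; case F: tcomb => [z|] // [<-].
case: i => [|i] /=; last exact: IHc.
by rewrite (tz_sub E) !tz_mul.
Qed.

Fixpoint pivot (c : seq trit) : nat :=
  match c with T0 :: c' => (pivot c').+1 | _ => 0 end.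

Lemma pivotP c : ~~ tzero c ->
  (pivot c < size c)%N /\ tz (nth T0 c (pivot c)) \in [:: 1; -1].
Proof. by elim: c => [|[] c IHc] //= /IHc. Qed.

Lemma nth_pivot c i : (i < pivot c)%N -> nth T0 c i = T0.
Proof. by elim: c i => [|[] c IHc] [|i] //=; apply: IHc. Qed.

Lemma telimP c x y i : telim c x = Some y ->
  tz (nth T0 y i) = tz (nth T0 x (bump (pivot c) i)) -
    tz (nth T0 c (pivot c)) * tz (nth T0 x (pivot c)) * tz (nth T0 c (bump (pivot c) i)).
Proof.
elim: c x y i => [|[] c IHc] [|a x] y i //=; try exact: tcombP.
case E: telim => [z|] // [<-]; case: i => [|i] /=.
  by rewrite mulr0 subr0.
by rewrite /bump ltnS -/(bump (pivot c) i) addnS /= (IHc _ _ _ E).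
Qed.

Lemma tproject_in k c L L1 x y : tproject c L = Some L1 -> List.In x L ->
  telim c x = Some y -> up_to_sign L1 (tcol k y).
Proof.
elim: L L1 => [|z L IHL] L1 //=; case E: telim => [w|] //.
case F: tproject => [L2|] // [<-] [<-|xL] xy; last first.
  have [->|[a aL ay]] := IHL _ F xL xy; first by left.
  right; exists a => //; case: ifP => // _; case: ifP => // _; by right.
move: xy; rewrite E => -[<-]; case: ifP => [/tzeroP-> //|_]; first by left.
right; exists (tnorm w).
  by case: ifP => [/tmemP|_]; [|left].
by case: (tnormP k w) => ->; [left | right; rewrite opprK].
Qed.

Lemma tproject_def c L L1 x : tproject c L = Some L1 -> List.In x L ->
  exists y, telim c x = Some y.
Proof.
elim: L L1 => [|z L IHL] L1 //=; case E: telim => [w|] //.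
case F: tproject => [L2|] // _ [<-|xL]; first by exists w.
exact: IHL F xL.
Qed.

(* Subtracting multiples of the first column [c] clears row [p]. *)
Lemma det_pivot (k : nat) (c : 'cV[int]_k.+1) (X : 'M[int]_(k.+1, k)) p :
  c p 0 \in [:: 1; -1] ->
  \det (row' p (X - c *m (c p 0 *: row p X))) \in sign01 int ->
  \det (row_mx c X : 'M_(1 + k)) \in sign01 int.
Proof.
move=> cp; set Y := X - _ => dY.
have cc : c p 0 * c p 0 = 1 by move: cp; rewrite !inE => /orP[]/eqP->.
have -> : \det (row_mx c X : 'M_(1 + k)) = \det (row_mx c Y : 'M_(1 + k)).
  pose W : 'M_(1 + k) := block_mx 1%:M (- (c p 0 *: row p X)) 0 1%:M.
  have <- : (row_mx c X : 'M_(1 + k)) *m W = row_mx c Y.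
    by rewrite mul_row_block mulmx1 mulmx0 addr0 mulmx1 mulmxN addrC.
  by rewrite det_mulmx det_ublock !det1 !mulr1.
rewrite (expand_det_row _ p) big_ord_recl big1 ?addr0 => [|j _]; last first.
  rewrite -rshift1 (@row_mxEr _ k.+1 1 k) !mxE big_ord1 !mxE mulrA cc mul1r.
  by rewrite subrr mul0r.
have -> : ord0 = lshift k (0 : 'I_1) :> 'I_(1 + k) by apply: val_inj.
rewrite (@row_mxEl _ k.+1 1 k) /cofactor.
have -> : row' p (col' (lshift k 0) (row_mx c Y : 'M_(1 + k))) = row' p Y.
  apply/matrixP => i j; rewrite [LHS]mxE [LHS]mxE [RHS]mxE.
  have -> : lift (lshift k (0 : 'I_1)) j = rshift 1 j by apply: val_inj.
  by rewrite (@row_mxEr _ k.+1 1 k).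
apply: sign01M; first by move: cp; rewrite !inE => /orP[]/eqP->.
apply: sign01M dY; rewrite -signr_odd.
by case: odd; rewrite ?expr0 ?expr1.
Qed.

(** Column [j] is swapped with column 0, which changes the determinant at most by a sign; only
    membership in [sign01] has to survive. *)
Lemma det_front (k : nat) (M : 'M[int]_k.+1) (j : 'I_k.+1) :
  exists X : 'M[int]_(k.+1, k),
    (forall i, exists j', col i X = col j' M) /\
    (\det (row_mx (col j M) X : 'M_(1 + k)) \in sign01 int ->
     \det M \in sign01 int).
Proof.
pose N := xcol j 0 M; exists (\matrix_(i, l) N i (lift ord0 l)); split.
  move=> i; exists (tperm j 0 (lift ord0 i)); apply/matrixP => a b.
  by rewrite !mxE.
have -> : row_mx (col j M) (\matrix_(i, l) N i (lift ord0 l)) = N :> 'M_(1 + k).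
  apply/matrixP => a b; case: (split_ordP b) => b' ->.
    by rewrite (@row_mxEl _ k.+1 1 k) !mxE ord1 lshift0 tpermR.
  by rewrite (@row_mxEr _ k.+1 1 k) mxE rshift1.
rewrite /N xcolE det_mulmx /tperm_mx det_perm => dN.
have -> : \det M = \det M * (-1) ^+ tperm j 0 * (-1) ^+ tperm j 0.
  by rewrite -mulrA -expr2 sqrr_sign mulr1.
by apply: sign01M dN _; case: odd_perm.
Qed.

Lemma det_col0 (k : nat) (M : 'M[int]_k) j : col j M = 0 -> \det M = 0.
Proof.
move=> Mj; rewrite (expand_det_col _ j) big1 // => i _.
by have /matrixP/(_ i 0) := Mj; rewrite !mxE => ->; rewrite mul0r.
Qed.

Lemma ucheckP k L (M : 'M[int]_k) : ucheck k L ->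
  (forall j, up_to_sign L (col j M)) -> \det M \in sign01 int.
Proof.
elim: k L M => [|k IHk] L M; first by rewrite det_mx00.
elim: L => [_ h|c L IHL] /=.
  have [c0|[? []]] := h 0.
  by rewrite (det_col0 c0).
case: ifP => // /IHL {}IHL.
case: ifP => [/tzeroP c0 _ h|/negbT c0].
  apply: IHL => j; have [->|[x [<-|xL] xj]] := h j; first by left.
    by left; case: xj => ->; rewrite c0 ?oppr0.
  by right; exists x.
case F: tproject => [L1|] // /IHk {}IHk h.
(* If no column is [c] up to sign, the shorter list covers them all; otherwise such a column serves
   as pivot. *)
have [[j jc]|noj] := EM (exists j, col j M = tcol k.+1 c \/ col j M = - tcol k.+1 c); last first.
  apply: IHL => j; have [->|[x [<-|xL] xj]] := h j; first by left.
    by case: noj; exists j.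
  by right; exists x.
(* The length of [c] is not tied to [k]: when its leading entry lies beyond the first [k.+1]
   coordinates, the column is zero. *)
have [pc pc1] := pivotP c0; have [pk|kp] := ltnP (pivot c) k.+1; last first.
  have t0 : tcol k.+1 c = 0.
    apply/matrixP => i l; rewrite !mxE nth_pivot //.
    exact: leq_trans (ltn_ord i) kp.
  by rewrite (@det_col0 _ M j) //; case: jc => ->; rewrite t0 ?oppr0.
pose p := Ordinal pk; pose C := col j M.
(* The pivot column enters the elimination through these products only, and they are the same for
   [c] and its negative. *)
have CC a : C a 0 * C p 0 = tz (nth T0 c a) * tz (nth T0 c p).
  by rewrite /C; case: jc => ->; rewrite !mxE ?mulrNN.
have Cp : C p 0 \in [:: 1; -1].
  rewrite /C; case: jc => ->; rewrite !mxE //.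
  by move: pc1; rewrite !inE => /orP[]/eqP->.
have [X [XM dX]] := det_front M j; apply: dX.
(* [Q] is the elimination as an additive map on columns: it matches [telim c] on lists and kills
   [c], so that all columns remain covered by [L1]. *)
rewrite -/C; apply: (det_pivot Cp); clearbody C; apply: IHk => i; pose Q (v : 'cV[int]_k.+1) : 'cV[int]_k :=
  \col_l (v (lift p l) 0 - C (lift p l) 0 * C p 0 * v p 0).
have -> : col i (row' p (X - C *m (C p 0 *: row p X))) = Q (col i X).
  by apply/matrixP => a b; rewrite !mxE big_ord1 !mxE mulrA.
have QN v : Q (- v) = - Q v.
  by apply/matrixP => a b; rewrite !mxE; ring.
have Qx x y : telim c x = Some y -> Q (tcol k.+1 x) = tcol k y.
  move=> xy; apply/matrixP => a b; rewrite !mxE CC (telimP _ xy) /=.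
  by congr (_ - _); ring.
have Q0 : Q 0 = 0 by apply/matrixP => a b; rewrite !mxE mulr0 subrr.
have Qc : Q (tcol k.+1 c) = 0.
  apply/matrixP => a b; rewrite !mxE CC /=.
  have -> (t s : int) : s - s * t * t = s * (1 - t * t) by ring.
  by move: pc1; rewrite !inE => /orP[]/eqP->; rewrite ?mulr1 ?mulrNN ?mulr1 subrr mulr0.
have [j' ->] := XM i; have [->|[x [<-|xL] xj]] := h j'; first by left.
  by left; case: xj => ->; rewrite ?QN Qc ?oppr0.
have [y xy] := tproject_def F xL.
have := tproject_in k F xL xy; case: xj => ->; rewrite ?QN (Qx _ _ xy) //.
case=> [->|[z zL1 zy]]; first by left; rewrite oppr0.
by right; exists z => //; case: zy => ->; rewrite ?opprK; auto.
Qed.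

Section TotallyUnimodular.
Variables (E : Type) (r : nat) (u : E -> 'cV[int]_r) (e : 'I_r -> E).
Hypothesis uu : unimodular u.
Hypothesis ue : forall i, u (e i) = delta_mx i 0.

(* A minor of order less than r is completed by unit columns. *)
Lemma unimodular_subdet (k : nat) (f : 'I_k -> 'I_r) (g : 'I_k -> E) :
  injective f -> \det (\matrix_(i, j) u (g j) (f i) 0) \in sign01 int.
Proof.
have [d] := ubnP (r - k); elim: d => // d IHd in k f g *.
move=> rkd fi; have kr : (k <= r)%N by have := leq_card f fi; rewrite !card_ord.
have [rk|ltkr] := leqP r k.
  have Ekr : k = r by apply/eqP; rewrite eqn_leq kr.
  subst k; have -> : \matrix_(i, j) u (g j) (f i) 0 = row_perm (perm fi) (colsmx u g).
    by apply/matrixP => i j; rewrite !mxE permE.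
  rewrite row_permE det_mulmx det_perm; apply: sign01M (uu g).
  by case: odd_perm.
have [x xf] : exists x, x \notin codom f.
  apply/existsP; rewrite -[[exists _, _]]negbK negb_exists; apply/negP => /forallP H.
  have : (#|'I_r| <= #|codom f|)%N.
    by apply: subset_leq_card; apply/subsetP => x _; have := H x; rewrite negbK.
  by rewrite card_codom // !card_ord leqNgt ltkr.
pose f' (i : 'I_k.+1) := oapp f x (unlift ord0 i).
pose g' (i : 'I_k.+1) := oapp g (e x) (unlift ord0 i).
have f'i : injective f'.
  move=> i j; rewrite /f'; case: unliftP => [i'|] ->; case: unliftP => [j'|] -> //=.
  - by move/fi => ->.
  - by move=> E1; move: xf; rewrite -E1 codom_f.
  - by move=> E1; move: xf; rewrite E1 codom_f.
have := IHd _ f' g' _ f'i; rewrite subnS.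
have -> : ((r - k).-1 < d)%N by move: rkd ltkr; lia.
move/(_ isT); rewrite (expand_det_col _ ord0) big_ord_recl big1 ?addr0 => [|i _]; last first.
  rewrite mxE /g' unlift_none /= ue mxE /f' liftK /=.
  case: eqP => [E1|_]; last by rewrite mul0r.
  by move: xf; rewrite -E1 codom_f.
rewrite mxE /g' /f' unlift_none /= ue mxE eqxx mul1r /cofactor expr0 mul1r.
have -> // : row' ord0 (col' ord0 (\matrix_(i, j) u (g' j) (f' i) 0)) =
  \matrix_(i, j) u (g j) (f i) 0.
by apply/matrixP => i j; rewrite !mxE /f' /g' !liftK.
Qed.

End TotallyUnimodular.

(** * Signed columns as certificates of regularity *)

Definition colbv (x : bvec) : 'cV['F_2]_6 := \col_i (nth false x i)%:R.

Definition code_col (L : seq N) (i : 'I_(size L)) : 'cV['F_2]_6 :=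
  colbv (bv (nth N0 L i)).

Definition binary_matroid (L : seq N) : matroid 'I_(size L) :=
  linear_matroid (@code_col L).

Fixpoint tsign (x y : bvec) : seq trit :=
  match x, y with
  | a :: x', b :: y' => (if a then if b then TN else T1 else T0) :: tsign x' y'
  | _, _ => [::]
  end.

Definition tcolumns (L S : seq N) : seq (seq trit) :=
  [seq tsign (bv p.1) (bv p.2) | p <- zip L S].

Definition tunits : seq (seq trit) :=
  [seq tsign x (bv N0) | x <- units6].

(** The unit columns have to occur, with sign +1: they complete smaller minors to maximal ones,
    which upgrades unimodular to totally unimodular, and they provide a basis. *)
Definition signing_ok (L S : seq N) : bool :=
  let T := tcolumns L S in
  [&& size L == size S, all (tmem^~ T) tunits & ucheck 6 T].

Lemma In_map (A B : Type) (f : A -> B) (s : seq A) (y : B) :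
  List.In y (map f s) <-> exists2 x, List.In x s & f x = y.
Proof.
elim: s => [|x s IHs] /=; first by split=> // -[].
split.
  by case=> [<-|ys]; [exists x; auto | have [/(_ ys)[z zs <-] _] := IHs; exists z; auto].
case=> z [->|zs] yz; first by left.
by right; apply (proj2 IHs); exists z.
Qed.

Section Signing.
Variables (L S : seq N).
Hypothesis ok : signing_ok L S.

Let sz : size L = size S. Proof. by case/and3P: ok => /eqP. Qed.

Definition signed_column (i : 'I_(size L)) : 'cV[int]_6 :=
  tcol 6 (tsign (bv (nth N0 L i)) (bv (nth N0 S i))).

Lemma mem_InP (T : eqType) (x : T) s : reflect (List.In x s) (x \in s).
Proof.
elim: s => [|y s IHs] /=; first by constructor.
rewrite in_cons; apply: (iffP orP) => [[/eqP->|/IHs]|[->|/IHs]]; auto.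
Qed.

Lemma signed_column_in (i : 'I_(size L)) : List.In (tsign (bv (nth N0 L i)) (bv (nth N0 S i)))
  (tcolumns L S).
Proof.
rewrite /tcolumns.
apply (proj2 (In_map _ (zip L S) _)).
exists (nth (N0, N0) (zip L S) i); last by rewrite (nth_zip _ _ _ sz).
by apply/mem_InP; apply: mem_nth; rewrite size_zip -sz minnn.
Qed.

Lemma signed_column_unimodular : unimodular signed_column.
Proof.
move=> g; apply: (@ucheckP 6 (tcolumns L S)); first by case/and3P: ok.
move=> j; right; exists (tsign (bv (nth N0 L (g j))) (bv (nth N0 S (g j)))).
  exact: signed_column_in.
by left; apply/matrixP => a b; rewrite !mxE.
Qed.

Lemma nth_tsign (x y : bvec) i : size x = size y ->
  (tz (nth T0 (tsign x y) i))%:~R = (nth false x i)%:R :> 'F_2.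
Proof.
elim: x y i => [|a x IHx] [|b y] i //=; first by case: i.
by case=> sxy; case: i => [|i] /=; [apply/val_inj; case: a; case: b | apply: IHx].
Qed.

Lemma signed_column_mod2 i :
  modr 'F_2 (signed_column i) = code_col i.
Proof. by apply/matrixP => a b; rewrite !mxE nth_tsign // !size_bv. Qed.

Lemma signed_column_units :
  exists e, forall i : 'I_6, signed_column (e i) = delta_mx i 0.
Proof.
suff H (i : 'I_6) : exists k, signed_column k = delta_mx i 0.
  by have [e eP] := fin_all_exists H; exists e.
have [x xT xi] : exists2 x, List.In x tunits & tcol 6 x = delta_mx i 0.
  (* [units6] lists the highest coordinate first. *)
  exists (nth [::] tunits (5 - i)).
    by case: i => -[|[|[|[|[|[|]]]]]] //= _; auto 10.
  apply/matrixP => a b; rewrite !mxE ord1 andbT.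
  by case: i a {b} => -[|[|[|[|[|[|]]]]]] // ? [[|[|[|[|[|[|]]]]]] // ?].
have /tmemP : tmem x (tcolumns L S).
  case/and3P: ok => _ + _; elim: tunits xT => //= y s IHs [->|ys] /andP[yT sT] //.
  exact: IHs.
case/(proj1 (In_map _ (zip L S) _)) => -[a b] /mem_InP abz abx.
have [lt E] : (index (a, b) (zip L S) < size L)%N /\ nth (N0, N0) (zip L S) (index (a, b) (zip L S)) = (a, b).
  split; last exact: nth_index.
  by move: abz; rewrite -index_mem size_zip -sz minnn.
exists (Ordinal lt); rewrite /signed_column -xi -abx /=.
by move: E; rewrite (nth_zip _ _ _ sz) => -[-> ->].
Qed.

Lemma signed_units_basis (e : 'I_6 -> 'I_(size L)) :
  (forall i, signed_column (e i) = delta_mx i 0) ->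
  injective e /\ \det (colsmx signed_column e) != 0.
Proof.
move=> ue; split.
  move=> i j eij; have := ue i; rewrite eij ue => /matrixP/(_ i 0).
  by rewrite !mxE !eqxx andbT; case: eqP.
have -> : colsmx signed_column e = 1%:M; last by rewrite det1.
by apply/matrixP => i j; rewrite mxE ue !mxE andbT.
Qed.

Lemma code_col_basis :
  exists2 g : 'I_6 -> 'I_(size L), injective g & \det (colsmx (@code_col L) g) != 0.
Proof.
have [e ue] := signed_column_units; have [ei de] := signed_units_basis ue.
exists e => //; have -> : colsmx (@code_col L) e = colsmx (fun i => modr 'F_2 (signed_column i)) e.
  by apply/matrixP => i j; rewrite mxE -signed_column_mod2 [RHS]mxE.
by rewrite det_modr //; exact: signed_column_unimodular.
Qed.

(** The signed columns reduce modulo 2 to the binary ones and, being unimodular, have the same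
    independent sets over the rationals; [unimodular_subdet] makes their matrix totally
    unimodular. *)
Lemma binary_matroid_regular : regular (binary_matroid L).
Proof.
have [e ue] := signed_column_units; have uu := signed_column_unimodular.
exists 6, (size L), (map_mx intr (colsmx signed_column id)); split.
  move=> k f g fi _; rewrite -map_mxsub det_map_mx.
  have := unimodular_subdet uu ue g fi.
  have -> : \matrix_(i, j) signed_column (g j) (f i) 0 = mxsub f g (colsmx signed_column id).
    by apply/matrixP => i j; rewrite !mxE.
  by rewrite !inE => /or3P[] /eqP->.
exists id; first by exists id.
move=> I; rewrite imset_id.
have [ei de] := signed_units_basis ue.
have -> : indep (binary_matroid L) I = free_on (fun e => modr 'F_2 (signed_column e)) I.
  by congr (free _); apply: eq_map => i; rewrite signed_column_mod2.
rewrite (unimodular_free_on _ rat uu ei de); congr (free _); apply: eq_map => i.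
by apply/matrixP => a b; rewrite !mxE.
Qed.

End Signing.

(* The binary digits of an entry mark the coordinates -1 of the signed column. *)
Definition signs : seq (seq N) := ([::
  [:: 0; 0; 0; 0; 0; 0; 2; 4; 8; 16; 32; 4; 8; 16; 32; 8; 16; 32; 16; 32; 32];
  [:: 0; 0; 0; 0; 0; 0; 6; 10; 16; 32; 16; 16; 2; 18; 32; 8];
  [:: 2; 0; 0; 0; 0; 0; 0; 36; 12; 16; 48; 48];
  [:: 0; 0; 0; 6; 2; 0; 0; 4; 28; 0; 16; 0; 14; 60; 48];
  [:: 0; 0; 0; 0; 8; 0; 2; 0; 50; 18; 32; 8; 0; 0; 8];
  [:: 0; 0; 0; 0; 8; 8; 0; 0; 56; 24; 0; 8; 0; 0; 40];
  [:: 0; 0; 0; 0; 8; 0; 0; 4; 52; 0; 4; 32; 0; 52; 36];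
  [:: 0; 0; 0; 0; 8; 8; 0; 4; 26; 24; 4; 0; 32; 4; 4];
  [:: 0; 0; 0; 0; 0; 8; 0; 40; 2; 40; 44; 16; 0; 32; 52];
  [:: 0; 0; 0; 2; 0; 6; 8; 0; 0; 24; 56; 16; 32; 14; 42];
  [:: 0; 0; 0; 0; 0; 16; 8; 0; 4; 36; 44; 16; 0; 0; 48]])%num.

Definition signings_ok : bool := all2 signing_ok targets signs.


Lemma signings_okE : signings_ok.
Proof. by lazy. Qed.

(** * The classification *)

Lemma F2_cases (x : 'F_2) : x = 0 \/ x = 1.
Proof. by case: x => -[|[|//]] ?; [left|right]; apply: val_inj. Qed.

Lemma addF2_mx m n (v : 'M['F_2]_(m, n)) : v + v = 0.
Proof.
by apply/matrixP => i j; rewrite !mxE; case: (F2_cases (v i j)) => ->; apply: val_inj.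
Qed.

Lemma comb_sum (b : seq 'cV['F_2]_6) (x : bvec) :
  comb b x = \sum_(j < size b) (nth false x j)%:R *: nth 0 b j.
Proof.
elim: b x => [|v b IHb] [|c x] /=; rewrite ?big_ord0 //.
  by rewrite big1 // => j _; rewrite nth_nil scale0r.
rewrite big_ord_recl /= IHb; congr (_ + _).
by case: c; rewrite ?scale1r ?scale0r.
Qed.

Definition basis_mx (b : seq 'cV['F_2]_6) : 'M['F_2]_6 :=
  colsmx (fun i : 'I_6 => nth 0 b i) id.

Lemma comb_mx (b : seq 'cV['F_2]_6) x :
  size b = 6 -> comb b x = basis_mx b *m colbv x.
Proof.
move=> sb; rewrite comb_sum colsmx_mulcV sb; apply: eq_bigr => j _.
by rewrite mxE.
Qed.

Definition col_bits (x : 'cV['F_2]_6) : bvec := [seq x i 0 != 0 | i <- enum 'I_6].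

Lemma size_col_bits x : size (col_bits x) = 6.
Proof. by rewrite size_map size_enum_ord. Qed.

Lemma nth_col_bits x (i : 'I_6) : nth false (col_bits x) i = (x i 0 != 0).
Proof. by rewrite (nth_map i) ?size_enum_ord // nth_ord_enum. Qed.

Lemma col_bitsK x : colbv (col_bits x) = x.
Proof.
apply/matrixP => i j; rewrite ord1 mxE nth_col_bits.
by case: (F2_cases (x i 0)) => ->.
Qed.

Lemma bnzP x : bnz x = false -> x = nseq (size x) false.
Proof. by elim: x => [|[] x IHx] //= /IHx {1}->. Qed.

Lemma colbv_eq0 x : (size x <= 6)%N -> colbv x = 0 -> bnz x = false.
Proof.
move=> x6 /matrixP H; apply/negbTE/negP => nz.
have [i xi] : exists i, nth false x i.
  elim: x nz {x6 H} => [|[] x IHx] //= nz; first by exists 0%N.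
  by have [i xi] := IHx nz; exists i.+1.
have ix : (i < size x)%N by case: ltnP => // h; rewrite nth_default in xi.
have := H (Ordinal (leq_trans ix x6)) 0; rewrite !mxE /= xi; exact/eqP.
Qed.

Lemma is_basis_det b : is_basis b -> \det (basis_mx b) != 0.
Proof.
move=> [sb bb]; apply: det_neq0_inj => x; rewrite -[x]col_bitsK -comb_mx //.
move=> /bb; rewrite size_col_bits => /(_ isT)/bnzP ->.
by apply/matrixP => i j; rewrite !mxE nth_nseq if_same.
Qed.

Lemma is_basis_unit b : is_basis b -> basis_mx b \in unitmx.
Proof. by move=> bb; rewrite unitmxE unitfE is_basis_det. Qed.

Lemma is_basis_total (b : seq 'cV['F_2]_6) v : is_basis b -> v != 0 ->
  exists2 x, x \in behead (ball 6) & v = comb b x.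
Proof.
move=> bb v0; pose x := invmx (basis_mx b) *m v.
have vE : v = comb b (col_bits x).
  by rewrite comb_mx ?col_bitsK ?mulKVmx ?is_basis_unit //; case: bb.
exists (col_bits x) => //; have := mem_ball (col_bits x).
rewrite size_col_bits ball_cons in_cons => /orP[/eqP x0|//].
by move: v0; rewrite vE x0 comb_bnz ?eqxx.
Qed.

Lemma regular_unimodular_rank (E : finType) (M : matroid E) r :
  regular M -> rank M = r ->
  exists u : E -> 'cV[int]_r,
    [/\ unimodular u,
        exists2 g : 'I_r -> E, injective g & \det (colsmx u g) != 0 &
        forall I, indep M I = free_on (fun e => modr 'F_2 (u e)) I].
Proof.
move=> regM <-; have [u [uu [g gi dg] iE]] := regular_unimodular regM.
exists u; split=> //; first by exists g.
by move=> I; rewrite iE; exact: unimodular_free_on uu gi dg _.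
Qed.

(** Over F_2 the only nonzero coefficient is 1, so a dependent set of at most two elements contains
    a zero vector or consists of two equal vectors. *)
Lemma simpleP (E : finType) (M : matroid E) (r : nat) (v : E -> 'cV['F_2]_r) :
  (forall I, indep M I = free_on v I) ->
  simple M <-> (forall e, v e != 0) /\ injective v.
Proof.
move=> iE; split=> [sM|[v0 vi] C].
  have dep (I : {set E}) : (#|I| <= 2)%N -> indep M I.
    move=> cI; apply/negPn/negP => dI.
    have [C mC sC] := @minset_exists _ (fun X => ~~ indep M X) I dI.
    have := sM C mC; rewrite ltnNge => /negP[].
    by apply: leq_trans cI; apply: subset_leq_card.
  split=> [e|e e' ve].
    have := dep [set e]; rewrite cards1 iE => /(_ isT)/free_onP H.
    apply/eqP => v0; have := H (fun=> 1); rewrite big_set1 v0 scaler0.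
    by move=> /(_ erefl e); rewrite inE eqxx => /(_ isT)/eqP; rewrite oner_eq0.
  apply/eqP/negPn/negP => ne.
  have := dep [set e; e']; rewrite cards2 ne iE => /(_ isT)/free_onP H.
  have := H (fun=> 1); rewrite big_setU1 ?inE //= big_set1 ve !scale1r addF2_mx.
  move=> /(_ erefl e); rewrite !inE eqxx => /(_ isT)/eqP; by rewrite oner_eq0.
rewrite /circuit => /minsetP[dC _]; rewrite ltnNge; apply/negP => cC.
move: dC; rewrite iE => /negP; apply; apply/free_onP => k.
have [z|[e eC]] := set_0Vmem C; first by move=> _ e; rewrite z inE.
have [C1|C1] := eqVneq C [set e].
  rewrite C1 big_set1 => /eqP; rewrite scaler_eq0 (negPf (v0 e)) orbF.
  by move=> /eqP ke x; rewrite inE => /eqP->.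
have [e' e'C ne] : exists2 e', e' \in C & e' != e.
  apply/exists_inP; apply: contraT; rewrite negb_exists_in => /forall_inP H.
  case/eqP: C1; apply/setP => x; rewrite inE; apply/idP/eqP => [xC|->//].
  by have := H x xC; rewrite negbK => /eqP.
have C2 : C = [set e; e'].
  apply/esym/eqP; rewrite eqEcard subUset !sub1set eC e'C /=.
  by rewrite cards2 eq_sym ne.
rewrite C2 big_setU1 ?inE 1?eq_sym //= big_set1 => S.
have kE : k e = 0 /\ k e' = 0.
  move: S; case: (F2_cases (k e)) => ->; case: (F2_cases (k e')) => ->;
    rewrite ?scale0r ?scale1r ?addr0 ?add0r // => /eqP.
  - by rewrite (negPf (v0 e')).
  - by rewrite (negPf (v0 e)).
  rewrite addr_eq0 => /eqP vv; case/eqP: ne; apply: vi; rewrite vv.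
  by apply/eqP; rewrite -subr_eq0 opprK addF2_mx.
by move=> x; rewrite !inE => /orP[]/eqP->; case: kE.
Qed.

(** The basis [b] lifts to an integer matrix [U] of odd determinant, hence 1 or -1. Multiplying by
    its integer inverse keeps unimodularity, sends the lifted basis to the unit columns, and modulo
    2 computes coordinates over [b], where the pattern is visible. *)
Lemma mod2_no_fano (E : finType) (u : E -> 'cV[int]_6)
    (b : seq 'cV['F_2]_6) ys :
  unimodular u -> is_basis b ->
  (forall v, v \in b -> exists e, modr 'F_2 (u e) = v) ->
  holds (fun v => exists e, modr 'F_2 (u e) = v) b ys ->
  fano_pattern ys -> False.
Proof.
move=> uu bb bS hy pat; have sb : size b = 6 by case: bb.
have [g gE] : exists g : 'I_6 -> E, forall i, modr 'F_2 (u (g i)) = nth 0 b i.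
  have H (i : 'I_6) : exists e, modr 'F_2 (u e) = nth 0 b i.
    by apply: bS; rewrite mem_nth // sb.
  by have [g gP] := fin_all_exists H; exists g.
pose U := colsmx u g.
have UE : colsmx (fun e => modr 'F_2 (u e)) g = basis_mx b.
  by apply/matrixP => i j; rewrite mxE gE mxE.
have dU : \det U != 0 by rewrite -(det_modr 'F_2) // UE is_basis_det.
have Uu := colsmx_unit uu dU.
pose c e := invmx U *m u e.
have uc : unimodular c.
  move=> h; rewrite colsmx_mul det_mulmx det_inv.
  by have := uu h; have := uu g; rewrite -/U !inE => /or3P[]/eqP-> // /or3P[]/eqP->.
have cg i : c (g i) = delta_mx i 0.
  have <- : col i (colsmx c g) = c (g i).
    by apply/matrixP => k l; rewrite [LHS]mxE [LHS]mxE ord1.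
  rewrite (colsmx_mul (invmx U)) (mulVmx Uu).
  by apply/matrixP => k l; rewrite !mxE ord1 andbT.
have par y : y \in ys -> exists e, forall k, (k < 6)%N ->
    (c e (i6 k) 0)%:~R = (nth false y k)%:R :> 'F_2.
  move=> /hy[e eE]; exists e => k k6.
  suff /matrixP/(_ (i6 k) 0) : modr 'F_2 (c e) = colbv y by rewrite !mxE inordK.
  have Bu := is_basis_unit bb.
  rewrite -[LHS](mulKmx Bu) -[RHS](mulKmx Bu) -comb_mx // -eE -UE.
  congr (_ *m _); rewrite colsmx_map -map_mxM; congr (map_mx _ _).
  by rewrite /c mulKVmx.
have take_nth n (y z : bvec) k : take n y = z -> (k < n)%N ->
    nth false y k = nth false z k by move=> <- kn; rewrite nth_take.
case/orP: pat => /beqsP.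
  case: ys {hy} par => [|y1 [|y2 [|y3 [|y4 [|? ?]]]]] //= par.
  case=> /take_nth t1 /take_nth t2 /take_nth t3 /take_nth t4.
  have [|e1 p1] := par y1; first by rewrite !inE eqxx.
  have [|e2 p2] := par y2; first by rewrite !inE eqxx ?orbT.
  have [|e3 p3] := par y3; first by rewrite !inE eqxx ?orbT.
  have [|e4 p4] := par y4; first by rewrite !inE eqxx ?orbT.
  by apply: (@no_fano E c g uc cg e1 e2 e3 e4);
    rewrite ?p1 ?p2 ?p3 ?p4 ?t1 ?t2 ?t3 ?t4.
case: ys {hy} par => [|y1 [|y2 [|y3 [|? ?]]]] //= par.
case=> /take_nth t1 /take_nth t2 /take_nth t3.
have [|e1 p1] := par y1; first by rewrite !inE eqxx.
have [|e2 p2] := par y2; first by rewrite !inE eqxx ?orbT.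
have [|e3 p3] := par y3; first by rewrite !inE eqxx ?orbT.
by apply: (@no_dual_fano E c g uc cg e1 e2 e3);
  rewrite ?p1 ?p2 ?p3 ?t1 ?t2 ?t3.
Qed.

Fixpoint distinct_nonzero (s : seq bvec) : bool :=
  match s with
  | [::] => true
  | x :: s' => if bnz x then if bmem x s' then false else distinct_nonzero s' else false
  end.

Lemma beq_refl x : beq x x.
Proof. by elim: x => [|[] x IHx]. Qed.

Lemma bmem_in x s : x \in s -> bmem x s.
Proof.
elim: s => //= y s IHs; rewrite in_cons => /orP[/eqP->|/IHs->].
  by rewrite beq_refl.
by case: ifP.
Qed.

Lemma distinct_nonzeroP s : distinct_nonzero s -> uniq s /\ all bnz s.
Proof.
elim: s => //= x s IHs; case: ifP => // nx; case: ifP => // xs /IHs[-> ->].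
by split; rewrite ?andbT //; apply/negP => /bmem_in; rewrite xs.
Qed.

Lemma colbv_inj x y : size x = 6 -> size y = 6 -> colbv x = colbv y -> x = y.
Proof.
move=> sx sy /matrixP xy; apply: (@eq_from_nth _ false); rewrite ?sx ?sy // => i i6.
by have := xy (Ordinal i6) 0; rewrite !mxE /=; case: nth; case: nth.
Qed.

Definition targets_distinct : bool := all (fun L => distinct_nonzero (map bv L)) targets.

Lemma targets_distinctE : targets_distinct.
Proof. by lazy. Qed.

Lemma target_simple t : (t < size targets)%N -> simple (binary_matroid (nth [::] targets t)).
Proof.
move=> ts; set L := nth [::] targets t.
have /distinct_nonzeroP[uL nL] : distinct_nonzero (map bv L).
  by apply: (allP targets_distinctE); apply: mem_nth.
apply/(simpleP (v := @code_col L)) => //; split.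
  move=> i; apply/eqP => /colbv_eq0; rewrite size_bv => /(_ isT).
  have /(allP nL)-> // : bv (nth N0 L i) \in map bv L by apply: map_f; apply: mem_nth.
move=> i j /colbv_inj; rewrite !size_bv => /(_ erefl erefl) ij.
apply/val_inj/eqP; rewrite /= -(nth_uniq [::] _ _ uL) ?size_map //.
by rewrite !(nth_map N0) // ij.
Qed.

Lemma target_signing t : (t < size targets)%N -> exists S, signing_ok (nth [::] targets t) S.
Proof.
move: signings_okE; rewrite /signings_ok; elim: targets signs t => [|L Ls IHL] [|S Ss] t //=.
by case/andP=> LS ok; case: t => [|t]; [exists S | exact: IHL ok].
Qed.

Lemma rank_det (E : finType) (v : E -> 'cV['F_2]_6) (g : 'I_6 -> E) :
  injective g -> \det (colsmx v g) != 0 -> rank (linear_matroid v) = 6.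
Proof.
move=> gi dg; apply/eqP; rewrite eqn_leq; apply/andP; split.
  by apply/bigmax_leqP => I iI; apply: free_on_card iI.
have := @leq_rank _ (linear_matroid v) [set g i | i : 'I_6].
by rewrite card_imset_inj // => -> //; rewrite [indep _ _](free_on_det _ gi).
Qed.

Lemma target_rank t : (t < size targets)%N -> rank (binary_matroid (nth [::] targets t)) = 6.
Proof.
by move=> /target_signing[S /code_col_basis[g gi dg]]; exact: rank_det gi dg.
Qed.

Lemma free_on_unitmx (K : fieldType) (E : finType) (r : nat) (B : 'M[K]_r)
    (v : E -> 'cV[K]_r) (I : {set E}) :
  B \in unitmx -> free_on (fun e => B *m v e) I = free_on v I.
Proof.
move=> Bu; have sumE k : \sum_(e in I) k e *: (B *m v e) = B *m \sum_(e in I) k e *: v e.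
  by rewrite mulmx_sumr; apply: eq_bigr => e _; rewrite scalemxAr.
apply/free_onP/free_onP => H k k0; apply: H; first by rewrite sumE k0 mulmx0.
by rewrite -[LHS](mulKmx Bu) -sumE k0 mulmx0.
Qed.

(** Simplicity makes the vectors [w e] distinct, so sending each to its column is injective. Were
    the image not everything, [M] would be a proper restriction of a simple regular matroid of rank
    six. *)
Lemma embed_target (E : finType) (M : matroid E) (w : E -> 'cV['F_2]_6) b t :
  maximal_simple_regular 6 M -> (forall I, indep M I = free_on w I) ->
  is_basis b -> (t < size targets)%N ->
  (forall e, exists2 n, n \in nth [::] targets t & w e = comb b (bv n)) ->
  isomorphic M (binary_matroid (nth [::] targets t)).
Proof.
move=> [sM regM rM maxM] iE bb tlt wT; set L := nth [::] targets t in wT *.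
pose v := @code_col L.
have [f fE] : exists f : E -> 'I_(size L), forall e, w e = basis_mx b *m v (f e).
  have H e : exists i : 'I_(size L), w e = basis_mx b *m v i.
    have [n nL ->] := wT e; rewrite -index_mem in nL.
    exists (Ordinal nL); rewrite comb_mx /v /code_col /= ?nth_index -?index_mem //.
    by case: bb.
  by have [f fP] := fin_all_exists H; exists f.
have [_ wi] := proj1 (simpleP iE) sM.
have fi : injective f by move=> e e' ff; apply: wi; rewrite !fE ff.
have indE (I : {set E}) : indep (binary_matroid L) [set f x | x in I] = indep M I.
  rewrite iE [LHS](free_on_imset _ _ fi).
  rewrite -(free_on_unitmx _ I (is_basis_unit bb)); congr (free _).
  by apply: eq_map => e; rewrite fE.
pose X := [set f x | x : E].
have [XT|Xp] := eqVneq X [set: 'I_(size L)].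
  exists f => //; apply: inj_card_bij => //.
  by rewrite -[#|'I_(size L)|]cardsT -XT card_imset // cardsT.
have {}Xp : X \proper [set: 'I_(size L)] by rewrite properEneq Xp subsetT.
have [S ok] := target_signing tlt.
case: (maxM _ (binary_matroid L) X (target_simple tlt)
  (binary_matroid_regular ok) (target_rank tlt) Xp).
have fX e : f e \in X by apply: imset_f.
exists (fun e => exist _ (f e) (fX e) : {x | x \in X}).
  apply: inj_card_bij => [e e' [/fi]//|].
  by rewrite card_sig /X card_imset // cardT.
move=> I; rewrite /= /restr_indep -imset_comp -indE.
apply: (congr1 (indep (binary_matroid L))).
by apply: eq_imset.
Qed.

Theorem maximal_simple_regular_rank6 (E : finType) (M : matroid E) :
  maximal_simple_regular 6 M ->
  exists2 t, (t < size targets)%N & isomorphic M (binary_matroid (nth [::] targets t)).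
Proof.
move=> maxM; have [sM regM rM _] := maxM.
have [u [uu [g gi dg] iE]] := regular_unimodular_rank regM rM.
pose w e := modr 'F_2 (u e).
pose inS v := exists e, w e = v.
pose Good := exists2 t, (t < size targets)%N &
  isomorphic M (binary_matroid (nth [::] targets t)).
have [w0 wi] := proj1 (simpleP iE) sM.
have hT (b : seq 'cV['F_2]_6) : is_basis b -> forall v, inS v ->
    exists2 x, x \in behead (ball 6) & v = comb b x.
  by move=> bb _ [e <-]; apply: is_basis_total => //; exact: w0.
have hL (b : seq 'cV['F_2]_6) t : is_basis b -> (t < size targets)%N ->
    (forall v, inS v -> exists2 n, n \in nth [::] targets t & v = comb b (bv n)) ->
    Good.
  move=> bb tlt h; exists t => //; apply: (embed_target maxM iE bb tlt) => e.
  by apply: h; exists e.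
have hF (b : seq 'cV['F_2]_6) ys : is_basis b -> (forall v, v \in b -> inS v) ->
    holds inS b ys -> fano_pattern ys -> False.
  exact: mod2_no_fano.
have hU : handled inS Good units6 :=
  run_handled (@addF2_mx 6 1) hF hT hL script_okE.
pose b := [seq w (g i) | i <- enum 'I_6].
have sb : size b = 6 by rewrite size_map size_enum_ord.
have bE : basis_mx b = colsmx w g.
  apply/matrixP => i j; rewrite mxE [RHS]mxE (nth_map j) ?size_enum_ord //.
  by rewrite nth_ord_enum.
have bu : basis_mx b \in unitmx by rewrite bE unitmxE unitfE det_modr.
apply: (hU b); first split=> // x x6.
  rewrite comb_mx // => h; apply: colbv_eq0 => //.
  by rewrite -[colbv x](mulKmx bu) h mulmx0.
have bS i : inS (nth 0 b (i6 i)).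
  by exists (g (i6 i)); rewrite (nth_map (i6 i)) ?size_enum_ord // nth_ord_enum.
have e1 (i : nat) : (i < 6)%N -> inS (nth 0 b i) by move=> i_lt; have := bS i; rewrite /i6 inordK.
(* The codes 32, 16, 8, 4, 2, 1 yield the basis vectors, last one first. *)
move=> x; rewrite /units6 !inE; case: b sb e1 {bE bu bS} => [|v0 [|v1 [|v2 [|v3 [|v4 [|v5 [|? ?]]]]]]] //= _ e1.
by do 5?[case/orP]; move=> /eqP->; rewrite /= ?addr0 ?add0r;
  [exact: (e1 5) | exact: (e1 4) | exact: (e1 3) | exact: (e1 2) | exact: (e1 1) | exact: (e1 0)].
Qed.

(** * Graphs *)

Section Incidence.
Variable G : graph.

Definition inc (e : edge G) (x : vertex G) : 'F_2 :=
  (x == (ends e).1)%:R + (x == (ends e).2)%:R.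

Lemma acyclicP (I : {set edge G}) :
  reflect (forall k : edge G -> 'F_2,
             (forall x, \sum_(e in I) k e * inc e x = 0) ->
             forall e, e \in I -> k e = 0)
          (acyclic I).
Proof.
rewrite acyclicE; apply: (iffP (free_onP _ _)) => H k k0; apply: H.
  apply/ffunP => x; rewrite sum_ffunE [RHS]ffunE.
  by under eq_bigr do rewrite !ffunE; exact: k0.
move=> x; have := congr1 (fun f : {ffun vertex G -> ('F_2)^o} => f x) k0.
rewrite sum_ffunE [RHS]ffunE.
by under eq_bigr do rewrite !ffunE.
Qed.

Lemma acyclicPn (I : {set edge G}) : ~~ acyclic I ->
  exists2 k : edge G -> 'F_2, (forall x, \sum_(e in I) k e * inc e x = 0) &
    exists2 e, e \in I & k e != 0.
Proof.
rewrite acyclicE => /free_onPn[k k0 ke]; exists k => // x.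
have := congr1 (fun f : {ffun vertex G -> ('F_2)^o} => f x) k0.
rewrite sum_ffunE [RHS]ffunE.
by under eq_bigr do rewrite !ffunE.
Qed.

End Incidence.

Lemma sum_in_supp (E : finType) (I : {set E}) (k : E -> 'F_2) (F : E -> 'F_2) :
  \sum_(e in I) k e * F e = \sum_e (if e \in I then k e else 0) * F e.
Proof.
rewrite [RHS](bigID (mem I)) /= [X in _ = _ + X]big1 ?addr0 => [|e /negbTE->].
  by apply: eq_bigr => e ->.
by rewrite mul0r.
Qed.

(** * Recognizing cographic matroids by the cycle space *)

Section Cographic.
Variables (G : graph) (w : edge G -> 'cV['F_2]_6) (us g0 : 'I_6 -> edge G).
Hypothesis g0i : injective g0.
Hypothesis dg0 : \det (colsmx w g0) != 0.
Hypothesis rows_cycles : forall x i, \sum_e w e i 0 * inc e x = 0.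
Hypothesis cycles_rows : forall k : edge G -> 'F_2,
  (forall x, \sum_e k e * inc e x = 0) ->
  forall e, k e = \sum_i w e i 0 * k (us i).

Let row_cycle (l : 'I_6 -> 'F_2) x : \sum_e (\sum_i w e i 0 * l i) * inc e x = 0.
Proof.
under eq_bigr do rewrite mulr_suml; rewrite exchange_big big1 //= => i _.
under eq_bigr do rewrite -mulrA [l i * _]mulrC mulrA.
by rewrite -mulr_suml rows_cycles mul0r.
Qed.

(** By hypothesis the row space of [w] is the cycle space of the graph. A cycle avoiding all [g i]
    is a row combination vanishing on a column basis, hence zero, so the complement is acyclic. It
    is maximal, as a row combination equal to 1 at [g j] and 0 at the other [g i] is a cycle. *)
Lemma cotree_basis (g : 'I_6 -> edge G) : injective g -> \det (colsmx w g) != 0 ->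
  basis (cycle_matroid G) (~: [set g i | i : 'I_6]).
Proof.
move=> gi dg; set X := [set g i | i : 'I_6].
have U : colsmx w g \in unitmx by rewrite unitmxE unitfE.
apply/maxsetP; split.
  apply/acyclicP => k k0; pose k' e := if e \in ~: X then k e else 0.
  have kl := @cycles_rows k'; have {}kl : forall e, k' e = \sum_i w e i 0 * k' (us i).
    by apply: kl => x; rewrite -[RHS](k0 x) [RHS]sum_in_supp.
  pose l : 'rV_6 := \row_i k' (us i).
  have lE e : k' e = (l *m w e) 0 0.
    by rewrite kl mxE; apply: eq_bigr => i _; rewrite mxE mulrC.
  have l0 : l = 0.
    rewrite -[l](mulmxK U) (_ : l *m colsmx w g = 0) ?mul0mx //.
    apply/matrixP => i j; rewrite ord1 [RHS]mxE.
    have -> : (l *m colsmx w g) 0 j = (l *m w (g j)) 0 0.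
      by rewrite !mxE; apply: eq_bigr => a _; rewrite [colsmx _ _ _ _]mxE.
    by rewrite -lE /k' inE imset_f.
  by move=> e eX; have := lE e; rewrite /k' eX l0 mul0mx mxE.
move=> B iB sB; apply/eqP; rewrite eqEsubset sB andbT; apply/subsetP => e eB.
rewrite inE; apply/negP => /imsetP[j _ ej].
(* Row [j] of the inverse matrix is the functional dual to the column of [g j]. *)
pose l i := invmx (colsmx w g) j i.
pose k e' := \sum_i w e' i 0 * l i.
have kg i : k (g i) = (j == i)%:R.
  have /matrixP/(_ j i) := mulVmx U; rewrite mxE [RHS]mxE => <-.
  by apply: eq_bigr => a _; rewrite mulrC [colsmx _ _ _ _]mxE.
have kB e' : e' \notin B -> k e' = 0.
  move=> e'B; have : e' \in X by apply: contraR e'B => e'X; apply: (subsetP sB); rewrite inE.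
  case/imsetP=> i _ e'i; rewrite e'i kg; case: eqP => // ji.
  by case/negP: e'B; rewrite e'i -ji -ej.
have := acyclicP _ iB k; move=> /(_ _ e eB); rewrite ej kg eqxx => H.
suff /H/eqP : forall x, \sum_(e in B) k e * inc e x = 0 by rewrite oner_eq0.
move=> x; rewrite -[RHS](row_cycle l x) [RHS](bigID (mem B)) /= [X in _ = _ + X]big1 ?addr0 //.
by move=> e' e'B; rewrite -/(k e') kB // mul0r.
Qed.

(** If [I] avoids a basis [B] and [e] is in [I], the fundamental cycle of [e] meets [I] in [e]
    alone; being a row combination, it annihilates any dependency among columns, whose coefficient
    at [e] is thus 0. Conversely, free columns extend to a column basis, and its complement is a
    basis of the cycle matroid. *)
Lemma dual_cycle_indep (I : {set edge G}) :
  indep (dual (cycle_matroid G)) I = free_on w I.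
Proof.
apply/existsP/idP => [[B /andP[bB dIB]]|fI].
  apply/free_onP => k k0 e eI.
  have eB : e \notin B by apply/negP => eB; move: dIB;
    rewrite disjoint_subset => /subsetP/(_ e eI); rewrite inE eB.
  have /acyclicPn[c c0 [f fB cf]] : ~~ acyclic (e |: B).
    apply/negP => ac; have /maxsetP[_ /(_ _ ac (subsetUr _ _)) E] := bB.
    by case/negP: eB; rewrite -E setU11.
  pose c' f := if f \in e |: B then c f else 0.
  have c'E : forall f, c' f = \sum_i w f i 0 * c' (us i).
    by apply: cycles_rows => x; rewrite -[RHS](c0 x) [RHS]sum_in_supp.
  (* A nonzero cycle avoiding [e] would lie inside [B], which is acyclic. *)
  have ce : c e != 0.
    apply: contraNneq cf => ce; have [-> //|fe] := eqVneq f e; first exact/eqP.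
    have fB' : f \in B by move: fB; rewrite !inE (negPf fe).
    have /maxsetP[/acyclicP H _] := bB; apply/eqP; apply: (H _ _ f fB') => x.
    by rewrite -[RHS](c0 x) big_setU1 //= ce mul0r add0r.
  have : \sum_(f in I) k f * c' f = 0.
    have := congr1 (mulmx (\row_i c' (us i))) k0; rewrite mulmx0 mulmx_sumr.
    have lE h : (\row_i c' (us i) *m w h) 0 0 = c' h.
      by rewrite c'E mxE; apply: eq_bigr => i _; rewrite mxE mulrC.
    move/matrixP/(_ 0 0); rewrite [RHS]mxE summxE.
    by under eq_bigr do rewrite -scalemxAr mxE lE.
  rewrite (bigD1 e) //= big1 ?addr0 => [|h /andP[hI he]].
    by rewrite /c' setU11 => /eqP; rewrite mulf_eq0 (negPf ce) orbF => /eqP.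
  rewrite /c' !inE (negPf he) /=; case: ifP => hB; last by rewrite mulr0.
  by move: dIB; rewrite disjoint_subset => /subsetP/(_ h hI); rewrite inE hB.
have i0 : indep (linear_matroid w) [set g0 i | i : 'I_6].
  by rewrite [indep _ _](free_on_det _ g0i).
have [|B sB /andP[iB /eqP cB]] := @extend_card _ (linear_matroid w) I _ fI i0.
  by rewrite card_imset_inj //; exact: free_on_card fI.
rewrite card_imset_inj // in cB; have [g gi Bg] := enum_imset cB.
exists (~: B); rewrite {1}Bg cotree_basis //=.
  by rewrite disjoint_sym disjoints_subset setCS.
by rewrite -free_on_det // -Bg.
Qed.

End Cographic.

(* The edges; the six edges whose columns are the unit vectors; and for every
   other edge e, as a binary number, a vertex set whose cut consists of e and of
   those of the six where the column of e has a coordinate 1 (0 for the six). *)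
Definition cubic_graphs : seq (seq (nat * nat) * seq nat * seq N) := [::
  ([:: (0, 4); (4, 2); (0, 5); (5, 1); (4, 5); (1, 6); (6, 2); (0, 7); (7, 3); (6, 7); (2, 8); (8, 3); (1, 9); (9, 3); (8, 9)]%N,
   [:: 0; 1; 2; 5; 6; 11]%N, [:: 0; 0; 0; 48; 16; 0; 0; 1; 193; 64; 4; 0; 50; 822; 260]%num);
  ([:: (2, 3); (4, 2); (0, 5); (5, 1); (4, 5); (1, 6); (6, 2); (0, 7); (7, 3); (6, 7); (0, 8); (8, 4); (1, 9); (9, 3); (8, 9)]%N,
   [:: 0; 1; 2; 3; 5; 7]%N, [:: 0; 0; 0; 0; 991; 0; 1019; 0; 196; 68; 1; 975; 2; 819; 305]%num);
  ([:: (1, 3); (4, 2); (0, 5); (5, 1); (4, 5); (1, 6); (6, 2); (0, 7); (7, 3); (6, 7); (0, 8); (8, 4); (2, 9); (9, 3); (8, 9)]%N,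
   [:: 0; 1; 2; 3; 6; 7]%N, [:: 0; 0; 0; 0; 991; 2; 0; 0; 194; 66; 1; 975; 4; 821; 305]%num);
  ([:: (2, 3); (0, 4); (0, 5); (5, 1); (4, 5); (1, 6); (6, 2); (0, 7); (7, 3); (6, 7); (4, 8); (8, 2); (1, 9); (9, 3); (8, 9)]%N,
   [:: 0; 1; 2; 3; 5; 6]%N, [:: 0; 0; 0; 0; 991; 0; 0; 1; 193; 64; 48; 1019; 2; 822; 308]%num);
  ([:: (1, 3); (0, 4); (0, 5); (5, 1); (4, 5); (1, 6); (6, 2); (0, 7); (7, 3); (6, 7); (4, 8); (8, 2); (2, 9); (9, 3); (8, 9)]%N,
   [:: 0; 1; 2; 3; 6; 11]%N, [:: 0; 0; 0; 0; 991; 2; 0; 1; 195; 66; 48; 0; 4; 820; 304]%num);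
  ([:: (1, 3); (2, 3); (0, 4); (5, 1); (4, 5); (1, 6); (6, 2); (0, 7); (7, 3); (6, 7); (0, 8); (8, 5); (4, 9); (9, 2); (8, 9)]%N,
   [:: 0; 1; 2; 3; 4; 6]%N, [:: 0; 0; 0; 0; 0; 2; 0; 821; 1015; 66; 203; 991; 16; 1019; 491]%num);
  ([:: (1, 2); (2, 3); (0, 4); (4, 2); (5, 1); (4, 5); (1, 6); (6, 3); (0, 7); (6, 7); (7, 8); (8, 3); (0, 9); (9, 5); (8, 9)]%N,
   [:: 0; 1; 2; 4; 7; 8]%N, [:: 0; 0; 0; 1019; 0; 20; 2; 0; 0; 66; 194; 1015; 1; 971; 458]%num);
  ([:: (0, 3); (2, 3); (4, 2); (0, 5); (5, 1); (4, 5); (0, 6); (1, 7); (7, 2); (6, 7); (6, 8); (8, 4); (1, 9); (9, 3); (8, 9)]%N,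
   [:: 0; 1; 2; 3; 4; 7]%N, [:: 0; 0; 0; 0; 0; 991; 1; 0; 1019; 891; 197; 975; 2; 1015; 501]%num)].

(** The edges are listed in the order of the columns of target 0; vertex 0 is the one without a
    coordinate. *)
Definition complete7 : seq (nat * nat) := [seq (0, j) | j <- iota 1 6]%N ++
  flatten [seq [seq (i, j) | j <- iota i.+1 (6 - i)] | i <- iota 1 5]%N.

Definition list_graph (n m : nat) (es : seq (nat * nat)) : graph :=
  @Graph 'I_n.+1 'I_m
    (fun e => (inord (nth (0, 0)%N es e).1, inord (nth (0, 0)%N es e).2)).

Definition binc (p : nat * nat) (x : nat) : bool := xorb (x == p.1) (x == p.2).

Definition ends_ok (n : nat) (es : seq (nat * nat)) : bool :=
  all (fun p => (p.1 <= n)%N && (p.2 <= n)%N) es.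

Lemma addbF2 (a b : bool) : (xorb a b)%:R = a%:R + b%:R :> 'F_2.
Proof. by apply: val_inj; case: a; case: b. Qed.

Lemma list_graph_inc n m es (e : 'I_m) (x : 'I_n.+1) : ends_ok n es -> size es = m ->
  inc (G := list_graph n m es) e x = (binc (nth (0, 0)%N es e) x)%:R.
Proof.
move=> /allP ok se; rewrite /inc addbF2 /=.
have /ok/andP[a b] : nth (0, 0)%N es e \in es by rewrite mem_nth // se.
by rewrite -!(inj_eq val_inj) /= !inordK.
Qed.

Definition parity (F : nat -> bool) (m : nat) : bool :=
  foldr (fun e b => xorb (F e) b) false (iota 0 m).

Lemma parityE (F : nat -> bool) (m : nat) :
  \sum_(e < m) (F e)%:R = (parity F m)%:R :> 'F_2.
Proof.
rewrite -(big_mkord xpredT (fun e => (F e)%:R)) /parity /index_iota subn0.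
by elim: (iota 0 m) => [|e s IHs]; rewrite ?big_nil // big_cons IHs addbF2.
Qed.

Definition nbits (k : nat) (n : N) : bvec :=
  match n with N0 => [::] | Npos p => pos_bits k p end.

Definition entry (L : seq N) (e i : nat) : bool := nth false (bv (nth N0 L e)) i.

(** The last two tests supply the hypotheses [rows_cycles] and, by way of cuts, [cycles_rows]. *)
Definition cographic_ok (L : seq N) (d : seq (nat * nat) * seq nat * seq N) : bool :=
  let: (es, us, ys) := d in
  [&& size es == size L, ends_ok 9 es, size us == 6, all (fun e => e < size L)%N us,
    all (fun x => all (fun i =>
        negb (parity (fun e => entry L e i && binc (nth (0, 0)%N es e) x) (size L)))
      (iota 0 6)) (iota 0 10) &
    all (fun e => let y := nbits 10 (nth N0 ys e) in
      all (fun f => let p := nth (0, 0)%N es f in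
        xorb (nth false y p.1) (nth false y p.2) ==
        xorb (e == f) (parity (fun i => entry L e i && (nth 0%N us i == f)) 6))
      (iota 0 (size L))) (iota 0 (size L))].

Definition cubic_graphs_ok : bool := all2 cographic_ok (drop 3 targets) cubic_graphs.

Lemma cubic_graphs_okE : cubic_graphs_ok.
Proof. by lazy. Qed.

Definition complete7_ok : bool :=
  let L := nth [::] targets 0 in
  [&& size complete7 == size L, ends_ok 6 complete7 &
    all (fun e => all (fun i => entry L e i == binc (nth (0, 0)%N complete7 e) i.+1)
      (iota 0 6)) (iota 0 (size L))].

Lemma complete7_okE : complete7_ok.
Proof. by lazy. Qed.

Lemma code_colE L (e : 'I_(size L)) i : code_col e i 0 = (entry L e i)%:R.
Proof. by rewrite mxE. Qed.

Lemma oppF2 (x : 'F_2) : - x = x.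
Proof. by case: (F2_cases x) => ->; apply: val_inj. Qed.

Lemma sum_delta_F2 (I : finType) (y : I -> 'F_2) a :
  \sum_x y x * (x == a)%:R = y a.
Proof.
rewrite (bigD1 a) //= eqxx mulr1 big1 ?addr0 // => x /negbTE->.
by rewrite mulr0.
Qed.

Lemma all_iotaP (P : pred nat) m : all P (iota 0 m) -> forall i, (i < m)%N -> P i.
Proof. by move=> /allP H i im; apply: H; rewrite mem_iota add0n. Qed.

Lemma cographic_okP L d S : cographic_ok L d -> signing_ok L S ->
  cographic (binary_matroid L).
Proof.
case: d => [[es us] ys] /and5P[/eqP ses eok /eqP sus /allP usL /andP[rows cuts]] ok.
have [g0 g0i dg0] := code_col_basis ok.
pose G := list_graph 9 (size L) es.
have usP (i : 'I_6) : (nth 0%N us i < size L)%N by apply: usL; rewrite mem_nth // sus.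
pose u (i : 'I_6) : edge G := Ordinal (usP i).
exists G; exists id; first by exists id.
move=> I; rewrite imset_id; apply: (@dual_cycle_indep G (@code_col L) u g0 g0i dg0).
  move=> x i.
  have -> : \sum_e @code_col L e i 0 * inc (G := G) e x =
      \sum_(e < size L) (entry L e i && binc (nth (0, 0)%N es e) x)%:R.
    apply: eq_bigr => e _; rewrite list_graph_inc // code_colE.
    by rewrite -natrM mulnb.
  rewrite (parityE (fun e => entry L e i && binc (nth (0, 0)%N es e) x)).
  have := all_iotaP (all_iotaP rows (ltn_ord x)) (ltn_ord i).
  by case: parity.
move=> k k0 e; pose y := nbits 10 (nth N0 ys e).
pose Y (x : vertex G) : 'F_2 := (nth false y x)%:R.
(* The cycle [k] meets the cut of the vertex set [Y] evenly. That cut is the sum of [e] and of the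
   edges [u i] at which the column of [e] has a 1, so the values of [k] there determine [k e]. *)
have : \sum_(x : vertex G) Y x * \sum_f k f * inc (G := G) f x = 0.
  by rewrite big1 // => x _; rewrite k0 mulr0.
under eq_bigr do rewrite mulr_sumr.
rewrite exchange_big /=.
under eq_bigr => f _.
  under eq_bigr do rewrite mulrCA.
  rewrite -mulr_sumr.
  have -> : \sum_x Y x * inc (G := G) f x =
      (e == f)%:R + \sum_(i < 6) (entry L e i && (nth 0%N us i == f))%:R.
    have -> : \sum_x Y x * inc (G := G) f x = Y (@ends G f).1 + Y (@ends G f).2.
      by under eq_bigr do rewrite mulrDr; rewrite big_split /= !sum_delta_F2.
    have /allP/(_ (nth (0, 0)%N es f)) := eok; rewrite mem_nth ?ses // => /(_ isT)/andP[a b].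
    rewrite /Y /= !inordK // -addbF2.
    have /eqP -> := all_iotaP (all_iotaP cuts (ltn_ord e)) (ltn_ord f).
    by rewrite addbF2 -(parityE (fun i => entry L e i && (nth 0%N us i == f))).
  over.
move=> S0.
have : k e + \sum_(i < 6) @code_col L e i 0 * k (u i) = 0.
  rewrite -[RHS]S0; under [RHS]eq_bigr do rewrite mulrDr.
  rewrite big_split /=; congr (_ + _).
    rewrite -[LHS](sum_delta_F2 k); apply: eq_bigr => f _.
    by rewrite eq_sym.
  under [RHS]eq_bigr do rewrite mulr_sumr.
  rewrite exchange_big /=; apply: eq_bigr => i _.
  rewrite -[k (u i)](sum_delta_F2 k) mulr_sumr; apply: eq_bigr => f _.
  by rewrite code_colE mulrCA -natrM mulnb [f == _]eq_sym.
by move/eqP; rewrite addr_eq0 => /eqP ->; rewrite oppF2.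
Qed.

Lemma target_cographic t : (3 <= t < size targets)%N ->
  cographic (binary_matroid (nth [::] targets t)).
Proof.
case/andP=> t3 tl; have [S ok] := target_signing tl.
have := cubic_graphs_okE; rewrite /cubic_graphs_ok.
have -> : nth [::] targets t = nth [::] (drop 3 targets) (t - 3) by rewrite nth_drop subnKC.
have : (t - 3 < size (drop 3 targets))%N by rewrite size_drop ltn_sub2r // (leq_ltn_trans t3).
rewrite -{1}[t](subnKC t3) -nth_drop in ok.
elim: (drop 3 targets) cubic_graphs (t - 3)%N ok => [|L Ls IH] [|d ds] k //= ok.
case: k ok => [|k] ok k_lt /andP[dok dsok]; first exact: cographic_okP dok ok.
exact: IH dsok.
Qed.

Lemma isomorphic_trans (E F H : finType) (M : matroid E) (N : matroid F)
    (P : matroid H) : isomorphic M N -> isomorphic N P -> isomorphic M P.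
Proof.
move=> [f fb fI] [g gb gI]; exists (g \o f); first exact: bij_comp.
by move=> I; rewrite -fI -gI -imset_comp.
Qed.

Lemma inc_sum (G : graph) (e : edge G) : \sum_x inc e x = 0.
Proof.
have D a : \sum_x (x == a :> vertex G)%:R = 1 :> 'F_2.
  by rewrite (bigD1 a) //= eqxx big1 ?addr0 // => x /negbTE->.
by rewrite big_split /= !D; apply: val_inj.
Qed.

(** The columns are the incidence vectors of K7 without the coordinate of vertex 0. Modulo 2 that
    coordinate is the sum of the others, so it adds no condition on dependencies. *)
Lemma target_graphic : graphic (binary_matroid (nth [::] targets 0)).
Proof.
set L := nth [::] targets 0.
have /and3P[/eqP ses eok /allP cols] := complete7_okE.
pose G := list_graph 6 (size L) complete7.
exists G; exists id; first by exists id.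
move=> I; rewrite imset_id.
have colE (e : 'I_(size L)) (i : 'I_6) :
    @code_col L e i 0 = inc (G := G) e (lift ord0 i).
  rewrite list_graph_inc // code_colE; congr (_%:R).
  have es : (e : nat) \in iota 0 (size L) by rewrite mem_iota add0n /=.
  have is6 : (i : nat) \in iota 0 6 by rewrite mem_iota add0n /=.
  by have /eqP -> := allP (cols _ es) _ is6.
apply/acyclicP/free_onP => H k k0; apply: H.
  move=> x.
  have kl (i : 'I_6) : \sum_(e in I) k e * inc (G := G) e (lift ord0 i) = 0.
    have /matrixP/(_ i 0) := k0; rewrite [RHS]mxE summxE.
    by under eq_bigr do rewrite mxE -/(code_col _) colE.
  have [j ->|->] := unliftP ord0 x; first exact: kl.
  have : \sum_y \sum_(e in I) k e * inc (G := G) e y = 0.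
    rewrite exchange_big big1 //= => e _.
    rewrite -mulr_sumr; have -> := @inc_sum G e; exact: mulr0.
  by rewrite big_ord_recl [X in _ + X]big1 ?addr0.
apply/matrixP => i j; rewrite [RHS]mxE summxE -[RHS](k0 (lift ord0 i)) ord1.
by apply: eq_bigr => e _; rewrite mxE -/(code_col _) colE.
Qed.

Definition rows_bits (n : nat) (rows : seq (seq nat)) (L : seq N) : bool :=
  all (fun j => all (fun i =>
    nth 0%N (nth [::] rows i) j == nat_of_bool (entry L j i)) (iota 0 6)) (iota 0 n).

Lemma vector_matroid_rows (L : seq N) (rows : seq (seq nat)) :
  rows_bits (size L) rows L ->
  isomorphic (binary_matroid L) (vector_matroid (mx_of_rows 6 (size L) rows)).
Proof.
move=> ok; exists id; first by exists id.
move=> I; rewrite imset_id; congr (free _); apply: eq_map => j.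
apply/matrixP => i k; rewrite !mxE.
by have /eqP -> := all_iotaP (all_iotaP ok (ltn_ord j)) (ltn_ord i).
Qed.

Lemma target_A16 : isomorphic (binary_matroid (nth [::] targets 1)) PT_K5_K33dual.
Proof. by apply: vector_matroid_rows; lazy. Qed.

Lemma target_A12 : isomorphic (binary_matroid (nth [::] targets 2)) P_K3_R10.
Proof. by apply: vector_matroid_rows; lazy. Qed.

(** * Cosystoles *)

Section Cocycles.
Variables (E : finType) (M : matroid E) (w : E -> 'cV['F_2]_6) (g0 : 'I_6 -> E).
Hypothesis iE : forall I, indep M I = free_on w I.
Hypothesis g0i : injective g0.
Hypothesis dg0 : \det (colsmx w g0) != 0.

(** The elements off the hyperplane where [y] vanishes; the cocircuits are the minimal nonempty such
    sets. *)
Definition cocycle (y : 'rV['F_2]_6) : {set E} := [set e | (y *m w e) 0 0 != 0].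

Lemma basis6 B : basis M B ->
  exists2 g : 'I_6 -> E, injective g /\ \det (colsmx w g) != 0 & B = [set g i | i : 'I_6].
Proof.
move=> bB; have iB := basis_indep bB.
have i0 : indep M [set g0 i | i : 'I_6] by rewrite iE free_on_det.
have cB : #|B| = 6.
  apply/eqP; rewrite eqn_leq; have -> : (#|B| <= 6)%N.
    by move: iB; rewrite iE => /free_on_card.
  by have := leq_card_basis bB i0; rewrite card_imset_inj.
have [g gi Bg] := enum_imset cB; exists g => //; split=> //.
by rewrite -free_on_det // -Bg -iE.
Qed.

Lemma det_basis (g : 'I_6 -> E) : injective g -> \det (colsmx w g) != 0 ->
  basis M [set g i | i : 'I_6].
Proof.
move=> gi dg; have iB : indep M [set g i | i : 'I_6] by rewrite iE free_on_det.
apply/maxsetP; split=> // J iJ sJ; apply/esym/eqP; rewrite eqEcard sJ.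
by rewrite card_imset_inj //; move: iJ; rewrite iE; apply: free_on_card.
Qed.

Lemma rowvec_eq0 (y : 'rV['F_2]_6) (g : 'I_6 -> E) : \det (colsmx w g) != 0 ->
  (forall i, (y *m w (g i)) 0 0 = 0) -> y = 0.
Proof.
move=> dg y0; have U : colsmx w g \in unitmx by rewrite unitmxE unitfE.
rewrite -[y](mulmxK U) (_ : y *m colsmx w g = 0) ?mul0mx //.
apply/matrixP => i j; rewrite ord1 [RHS]mxE -[RHS](y0 j) !mxE.
by apply: eq_bigr => a _; rewrite [colsmx _ _ _ _]mxE.
Qed.

(** A nonzero functional cannot vanish on a whole basis, so its support meets every basis. *)
Lemma cocycle_codependent y : y != 0 -> ~~ indep (dual M) (cocycle y).
Proof.
move=> y0; apply/negP => /existsP[B /andP[bB dB]].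
have [g [gi dg] Bg] := basis6 bB; case/eqP: y0; apply: (rowvec_eq0 dg) => i.
apply/eqP; apply: contraTT dB => yi; apply/pred0Pn; exists (g i).
by rewrite /= inE yi Bg imset_f.
Qed.

(** If the columns outside [X] had rank 6, they would contain a basis disjoint from [X]. Hence they
    do not span, and some nonzero functional vanishes on all of them. *)
Lemma codependent_cocycle X : ~~ indep (dual M) X ->
  exists2 y, y != 0 & cocycle y \subset X.
Proof.
move=> dX; pose k := #|~: X|; pose v (i : 'I_k) := enum_val i.
pose A := colsmx w v.
have [fA|nA] := boolP (row_free A).
  have fA' : row_full A^T by rewrite /row_full mxrank_tr.
  pose f := fullrankfun fA'; pose g (i : 'I_6) := v (f i).
  have gi : injective g by move=> i j /enum_val_inj; apply: fullrankfun_inj.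
  have dg : \det (colsmx w g) != 0.
    have : rowsub f A^T \in unitmx by rewrite -row_full_unit fullrowsub_full.
    rewrite unitmxE unitfE -det_tr; congr (\det _ != 0).
    by apply/matrixP => i j; rewrite !mxE.
  case/negP: dX; apply/existsP; exists [set g i | i : 'I_6].
  rewrite det_basis //= disjoint_sym disjoints_subset; apply/subsetP => _ /imsetP[i _ ->].
  exact: enum_valP.
have kA : kermx A != 0 by rewrite kermx_eq0.
have [y /sub_kermxP yA y0] := rowV0Pn kA; exists y => //.
apply/subsetP => e; rewrite inE; apply: contraR => eX.
have eC : e \in ~: X by rewrite inE.
have /matrixP/(_ 0 (enum_rank_in eC e)) := yA.
rewrite [RHS]mxE => <-; apply/eqP; rewrite !mxE; apply: eq_bigr => a _.
by rewrite [A _ _]mxE /v enum_rankK_in.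
Qed.

(** Take the smallest cocycle through [e] inside the given one. A cocycle strictly inside it would
    miss [e] by minimality; adding the two functionals gives the symmetric difference of the
    supports, which is smaller and still contains [e]. *)
Lemma cocircuit_in_cocycle y e : e \in cocycle y ->
  exists C, [/\ cocircuit M C, e \in C & C \subset cocycle y].
Proof.
move=> ey; pose P z := (e \in cocycle z) && (cocycle z \subset cocycle y).
have Py : P y by rewrite /P ey subxx.
case: (@arg_minnP _ y P (fun z => #|cocycle z|) Py) => z /andP[ez zy] zmin.
have z0 : z != 0 by apply: contraTneq ez => ->; rewrite inE mul0mx mxE eqxx.
exists (cocycle z); split=> //; apply/minsetP; split; first exact: cocycle_codependent.
move=> X dX Xz; have [t t0 tX] := codependent_cocycle dX.
have tz := subset_trans tX Xz.
have [et|et] := boolP (e \in cocycle t).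
  apply/eqP; rewrite eqEsubset Xz; apply: subset_trans tX.
  suff /eqP-> : cocycle t == cocycle z by [].
  by rewrite eqEcard tz zmin // /P et (subset_trans tz).
have sumE f : (f \in cocycle (z + t)) = (f \in cocycle z) (+) (f \in cocycle t).
  rewrite !inE mulmxDl mxE.
  by case: (F2_cases ((z *m w f) 0 0)) => ->; case: (F2_cases ((t *m w f) 0 0)) => ->.
have [i ti] : exists i, (t *m w (g0 i)) 0 0 != 0.
  apply/existsP; apply: contraR t0; rewrite negb_exists => /forallP H.
  by apply/eqP; apply: (rowvec_eq0 dg0) => i; apply/eqP; rewrite -[_ == _]negbK.
have it : g0 i \in cocycle t by rewrite inE.
have lt : (#|cocycle (z + t)| < #|cocycle z|)%N.
  apply: proper_card; apply/properP; split.
    apply/subsetP => f; rewrite sumE; case: (boolP (f \in cocycle t)) => [/(subsetP tz)->//|_].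
    by rewrite addbF.
  by exists (g0 i); rewrite ?sumE ?it ?(subsetP tz).
have := zmin (z + t); rewrite leqNgt lt => /implyP; rewrite implybF /P sumE ez (negPf et) /=.
case/negP; apply: subset_trans zy; apply/subsetP => f; rewrite sumE.
by case: (boolP (f \in cocycle t)) => [/(subsetP tz)->//|_]; rewrite addbF.
Qed.

Lemma cocircuit_cocycle C : cocircuit M C -> exists2 y, y != 0 & C = cocycle y.
Proof.
case/minsetP=> dC minC; have [y y0 yC] := codependent_cocycle dC.
by exists y => //; rewrite (minC _ _ yC) // cocycle_codependent.
Qed.

(** Each support has an element outside the other two. A cocircuit through that element inside the
    support keeps it private, because the other two sets only shrink. *)
Lemma non_inclusion_cocircuits y1 y2 y3 :
  non_inclusion (cocycle y1) (cocycle y2) (cocycle y3) ->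
  exists C1 C2 C3, [/\ [/\ cocircuit M C1, cocircuit M C2 & cocircuit M C3],
    non_inclusion C1 C2 C3 &
    [/\ C1 \subset cocycle y1, C2 \subset cocycle y2 & C3 \subset cocycle y3]].
Proof.
case/and3P=> /subsetPn[e1 /cocircuit_in_cocycle[C1 [c1 e1C s1]] n1].
case/subsetPn=> [e2 /cocircuit_in_cocycle[C2 [c2 e2C s2]] n2].
case/subsetPn=> [e3 /cocircuit_in_cocycle[C3 [c3 e3C s3]] n3].
have notin e (A B A' B' : {set E}) : A' \subset A -> B' \subset B ->
    e \notin A :|: B -> e \notin A' :|: B'.
  by move=> sA sB; apply: contra; apply: subsetP; apply: setUSS.
exists C1, C2, C3; split=> //; apply/and3P; split; apply/subsetPn.
- by exists e1 => //; apply: notin n1.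
- by exists e2 => //; apply: notin n2.
- by exists e3 => //; apply: notin n3.
Qed.

End Cocycles.

Section Certificate.
Variables (R : realType) (E : finType) (M : matroid E).
Variables (w : E -> 'cV['F_2]_6) (g0 : 'I_6 -> E).
Hypothesis iE : forall I, indep M I = free_on w I.
Hypothesis g0i : injective g0.
Hypothesis dg0 : \det (colsmx w g0) != 0.
Variables (s : R) (T : seq (nat * ('rV['F_2]_6 * 'rV['F_2]_6 * 'rV['F_2]_6))).

Let cyc := cocycle w.

Hypothesis T_noninc : forall t, t \in T ->
  non_inclusion (cyc t.2.1.1) (cyc t.2.1.2) (cyc t.2.2).
Hypothesis T_pos : (0 < \sum_(t <- T) t.1)%N.

Definition cover (t : nat * ('rV['F_2]_6 * 'rV['F_2]_6 * 'rV['F_2]_6)) e : nat :=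
  (e \in cyc t.2.1.1) + (e \in cyc t.2.1.2) + (e \in cyc t.2.2).

Hypothesis T_cover : forall e,
  (\sum_(t <- T) t.1 * cover t e)%N%:R <= s * (\sum_(t <- T) t.1)%N%:R.

Lemma measureS (mu : E -> R) (C D : {set E}) : (forall e, 0 <= mu e) ->
  C \subset D -> measure mu C <= measure mu D.
Proof.
move=> mu0 CD; rewrite /measure [leRHS](big_setID C) /= (setIidPr CD) lerDl.
by apply: sumr_ge0 => e _; exact: mu0.
Qed.

Lemma measureE (mu : E -> R) (C : {set E}) : measure mu C = \sum_e mu e * (e \in C)%:R.
Proof.
rewrite /measure big_mkcond; apply: eq_bigr => e _.
by case: (e \in C); rewrite ?mulr1 ?mulr0.
Qed.

(* Weak duality: a minimum is at most every weighted average over triples. *)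
Lemma min_le (mu : E -> R) m : weight mu -> is_min (triple_measure M mu) m -> m <= s.
Proof.
move=> [mu0 mu1] [_ minm].
have mT t : t \in T -> m <= \sum_e mu e * (cover t e)%:R.
  move=> /T_noninc/(non_inclusion_cocircuits iE g0i dg0).
  case=> [C1 [C2 [C3 [[c1 c2 c3] ni [s1 s2 s3]]]]].
  apply: le_trans (minm _ _) _; first by exists C1, C2, C3.
  have -> : \sum_e mu e * (cover t e)%:R =
      measure mu (cyc t.2.1.1) + measure mu (cyc t.2.1.2) + measure mu (cyc t.2.2).
    rewrite !measureE -!big_split /=; apply: eq_bigr => e _.
    by rewrite /cover !natrD !mulrDr.
  by apply: lerD; [apply: lerD|]; apply: measureS.
have L0 : 0 < (\sum_(t <- T) t.1)%N%:R :> R by rewrite ltr0n.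
rewrite -(ler_pM2r L0) natr_sum mulr_sumr.
apply: (@le_trans _ _ (\sum_(t <- T) t.1%:R * \sum_e mu e * (cover t e)%:R)).
  rewrite big_seq [leRHS]big_seq; apply: ler_sum => t tT.
  by rewrite mulrC ler_wpM2l ?mT.
have -> : \sum_(t <- T) t.1%:R * (\sum_e mu e * (cover t e)%:R) =
    \sum_e \sum_(t <- T) t.1%:R * (mu e * (cover t e)%:R) :> R.
  by rewrite exchange_big; apply: eq_bigr => t _; rewrite mulr_sumr.
rewrite -natr_sum -[leRHS]mulr1 -[X in _ <= _ * X]mu1 mulr_sumr; apply: ler_sum => e _.
rewrite [leRHS]mulrC.
apply: (le_trans _ (ler_wpM2l (mu0 e) (T_cover e))).
rewrite natr_sum mulr_sumr le_eqVlt; apply/orP; left; apply/eqP.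
by apply: eq_bigr => t _; rewrite natrM mulrCA.
Qed.

(** Every cocircuit has weight at least [s / 3], so every triple has at least [s]; weak duality
    gives the opposite inequality for any weights. The minimum is attained because there are
    finitely many triples. *)
Lemma is_cosystole3_of_certificate (mu : E -> R) : weight mu ->
  (forall y, y != 0 -> s <= 3 * measure mu (cyc y)) -> is_cosystole3 M s.
Proof.
move=> wmu light; split; last by move=> m [mu' wmu' mm]; apply: min_le mm.
exists mu => //.
have lower x : triple_measure M mu x -> s <= x.
  case=> C1 [C2 [C3 [[c1 c2 c3] _ ->]]].
  have lC C : cocircuit M C -> s <= 3 * measure mu C.
    by move=> /(cocircuit_cocycle iE g0i dg0)[y y0 ->]; apply: light.
  by have := lC _ c1; have := lC _ c2; have := lC _ c3; lra.
pose P (C : {set E} * {set E} * {set E}) :=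
  [&& cocircuit M C.1.1, cocircuit M C.1.2, cocircuit M C.2 &
      non_inclusion C.1.1 C.1.2 C.2].
pose F (C : {set E} * {set E} * {set E}) :=
  measure mu C.1.1 + measure mu C.1.2 + measure mu C.2.
(* A triple of the certificate shows that the minimum runs over a nonempty set. *)
have [t tT] : exists t, t \in T.
  by case: T T_pos => [|t T' _]; [rewrite big_nil | exists t; rewrite mem_head].
have [C1 [C2 [C3 [[c1 c2 c3] ni _]]]] := non_inclusion_cocircuits iE g0i dg0 (T_noninc tT).
have P0 : P (C1, C2, C3) by rewrite /P /= c1 c2 c3 ni.
case: (@Order.TotalTheory.arg_minP _ _ _ _ P F P0) => D /and4P[d1 d2 d3 nD] Dmin.
have tD : triple_measure M mu (F D) by exists D.1.1, D.1.2, D.2.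
have mD : is_min (triple_measure M mu) (F D).
  split=> // x [A [B [C [[a b c] nABC ->]]]].
  by apply: (Dmin (A, B, C)); rewrite /P /= a b c nABC.
have <- // : F D = s.
by apply/eqP; rewrite eq_le lower // (min_le wmu mD).
Qed.

End Certificate.

(** * Numerical certificates for the targets *)

Fixpoint bdot (x y : bvec) : bool :=
  match x, y with a :: x', b :: y' => xorb (a && b) (bdot x' y') | _, _ => false end.

Definition support (L : seq N) (y : bvec) : seq bool := [seq bdot y (bv n) | n <- L].

Fixpoint wt (ms : seq nat) (x : seq bool) : nat :=
  match ms, x with
  | m :: ms', b :: x' => if b then (m + wt ms' x')%N else wt ms' x'
  | _, _ => 0%N
  end.

Fixpoint escapes (a b c : seq bool) : bool :=
  match a, b, c with
  | x :: a', y :: b', z :: c' =>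
      if x && ~~ (y || z) then true else escapes a' b' c'
  | _, _, _ => false
  end.

Definition triple_supports (L : seq N) (t : N * N * N) : seq bool * seq bool * seq bool :=
  (support L (bv t.1.1), support L (bv t.1.2), support L (bv t.2)).

Definition non_inclusion_ok (x : seq bool * seq bool * seq bool) : bool :=
  [&& escapes x.1.1 x.1.2 x.2, escapes x.1.2 x.1.1 x.2 & escapes x.2 x.1.1 x.1.2].

Definition cover_sum (T : seq (nat * (seq bool * seq bool * seq bool))) (e : nat) : nat :=
  sumn [seq (t.1 * (nth false t.2.1.1 e + nth false t.2.1.2 e + nth false t.2.2 e))%N | t <- T].

(* [ms] are the weights of the elements, up to the factor [sumn ms]; the
   cosystole is [Q / sumn ms].  [T] lists triples of linear functionals with
   multiplicities; together they cover every element at most [P] times. *)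
Definition cosystole_ok (L : seq N)
    (d : seq nat * nat * nat * seq (nat * (N * N * N))) : bool :=
  let: (ms, Q, P, T) := d in
  let T' := [seq (t.1, triple_supports L t.2) | t <- T] in
  [&& size ms == size L, 0 < sumn ms, 0 < sumn (map fst T),
      all (fun y => Q <= 3 * wt ms (support L y)) (behead (ball 6)),
      all (fun t => non_inclusion_ok t.2) T',
      all (fun e => cover_sum T' e <= P) (iota 0 (size L)) &
      P * sumn ms <= Q * sumn (map fst T)]%N.

(** The entries follow [targets]. For M(K7) the weights select the Hamiltonian cycle 0-1-6-3-5-4-2:
    every cut contains at least two of its seven edges, whence 6/7. For [A12] the element shared by
    the triangle and R10, column 2, has weight 0. The values of the eight cographic targets are
    12/13, 1, 30/31, 18/19, 12/13, 1, 24/25, 1. *)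
Definition cosystole_data : seq (seq nat * nat * nat * seq (nat * (N * N * N))) := [::
  ([:: 1; 1; 0; 0; 0; 0; 0; 0; 0; 0; 1; 0; 1; 0; 0; 0; 1; 1; 1; 0; 0]%N, 6%N, 6%N, [:: (2%N, (1, 8, 32)%num); (2%N, (63, 4, 16)%num); (1%N, (63, 2, 8)%num); (1%N, (4, 32, 2)%num); (1%N, (16, 1, 2)%num)]);
  ([:: 1; 1; 0; 2; 1; 1; 1; 0; 1; 1; 1; 0; 0; 1; 0; 2]%N, 12%N, 216%N, [:: (15%N, (16, 29, 1)%num); (4%N, (51, 32, 2)%num); (6%N, (32, 48, 4)%num); (13%N, (46, 16, 2)%num); (37%N, (1, 2, 4)%num); (2%N, (1, 46, 51)%num); (10%N, (3, 4, 16)%num); (16%N, (16, 8, 4)%num); (39%N, (29, 46, 4)%num); (48%N, (51, 8, 48)%num); (44%N, (3, 8, 32)%num)]);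
  ([:: 1; 3; 0; 1; 1; 1; 1; 1; 1; 1; 1; 1]%N, 12%N, 12%N, [:: (2%N, (48, 1, 32)%num); (1%N, (1, 16, 24)%num); (2%N, (24, 44, 1)%num); (1%N, (44, 1, 16)%num); (1%N, (1, 48, 16)%num); (1%N, (8, 52, 12)%num); (2%N, (1, 52, 4)%num); (2%N, (1, 12, 8)%num); (1%N, (1, 4, 32)%num)]);
  ([:: 1; 0; 1; 0; 2; 1; 1; 1; 0; 1; 1; 1; 0; 2; 1]%N, 12%N, 120%N, [:: (25%N, (32, 35, 8)%num); (19%N, (24, 5, 19)%num); (4%N, (12, 4, 5)%num); (10%N, (5, 12, 24)%num); (5%N, (12, 8, 26)%num); (27%N, (5, 2, 48)%num); (3%N, (35, 48, 4)%num); (23%N, (26, 4, 32)%num); (1%N, (2, 24, 32)%num); (11%N, (32, 12, 19)%num); (2%N, (35, 2, 26)%num)]);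
  ([:: 1; 0; 1; 1; 1; 1; 1; 0; 1; 1; 1; 1; 0; 1; 1]%N, 12%N, 358%N, [:: (8%N, (39, 44, 38)%num); (33%N, (1, 26, 32)%num); (37%N, (17, 16, 60)%num); (20%N, (60, 3, 12)%num); (24%N, (4, 60, 35)%num); (78%N, (1, 3, 4)%num); (17%N, (17, 12, 26)%num); (27%N, (11, 8, 26)%num); (48%N, (12, 16, 32)%num); (5%N, (44, 1, 35)%num); (21%N, (38, 26, 34)%num); (27%N, (4, 8, 18)%num); (13%N, (39, 1, 48)%num)]);
  ([:: 1; 2; 3; 1; 2; 4; 1; 1; 4; 1; 2; 3; 3; 1; 2]%N, 30%N, 2100%N, [:: (62%N, (54, 9, 17)%num); (117%N, (26, 44, 1)%num); (111%N, (9, 11, 44)%num); (205%N, (16, 45, 48)%num); (138%N, (16, 50, 13)%num); (67%N, (45, 50, 17)%num); (72%N, (13, 32, 1)%num); (77%N, (16, 32, 1)%num); (37%N, (9, 2, 26)%num); (99%N, (17, 2, 11)%num); (476%N, (26, 32, 4)%num); (364%N, (1, 2, 4)%num); (5%N, (32, 48, 50)%num); (192%N, (44, 2, 17)%num); (148%N, (45, 54, 2)%num)]);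
  ([:: 2; 1; 3; 0; 2; 1; 1; 0; 1; 2; 1; 1; 1; 1; 2]%N, 18%N, 270%N, [:: (5%N, (28, 34, 1)%num); (33%N, (48, 56, 34)%num); (2%N, (12, 6, 1)%num); (79%N, (1, 6, 8)%num); (4%N, (1, 3, 48)%num); (25%N, (2, 33, 12)%num); (8%N, (48, 28, 33)%num); (7%N, (34, 12, 3)%num); (12%N, (56, 28, 33)%num); (34%N, (16, 3, 6)%num); (11%N, (12, 16, 8)%num); (45%N, (33, 28, 49)%num); (20%N, (28, 6, 2)%num)]);
  ([:: 1; 1; 2; 0; 1; 1; 1; 0; 1; 1; 0; 1; 1; 0; 2]%N, 12%N, 168%N, [:: (18%N, (56, 16, 1)%num); (26%N, (50, 12, 6)%num); (1%N, (16, 32, 6)%num); (15%N, (6, 2, 17)%num); (18%N, (13, 1, 16)%num); (11%N, (32, 17, 12)%num); (6%N, (2, 1, 32)%num); (24%N, (32, 13, 56)%num); (5%N, (16, 2, 12)%num); (16%N, (2, 50, 17)%num); (42%N, (6, 9, 32)%num)]);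
  ([:: 1; 1; 1; 0; 1; 1; 1; 0; 1; 1; 1; 1; 1; 0; 1]%N, 12%N, 2%N, [:: (1%N, (16, 34, 4)%num); (1%N, (35, 1, 20)%num)]);
  ([:: 3; 1; 1; 1; 1; 3; 1; 3; 1; 1; 3; 1; 3; 1; 1]%N, 24%N, 216%N, [:: (6%N, (11, 38, 2)%num); (8%N, (11, 19, 54)%num); (14%N, (19, 2, 44)%num); (2%N, (6, 8, 16)%num); (13%N, (8, 37, 9)%num); (13%N, (11, 32, 44)%num); (23%N, (6, 9, 32)%num); (20%N, (19, 16, 24)%num); (14%N, (37, 32, 16)%num); (27%N, (4, 19, 40)%num); (45%N, (9, 16, 4)%num); (7%N, (4, 24, 2)%num); (12%N, (8, 32, 19)%num); (19%N, (54, 32, 38)%num); (2%N, (4, 38, 6)%num)]);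
  ([:: 1; 0; 1; 1; 0; 1; 1; 1; 1; 1; 0; 1; 1; 1; 1]%N, 12%N, 124%N, [:: (14%N, (1, 6, 8)%num); (21%N, (15, 16, 32)%num); (2%N, (56, 8, 16)%num); (28%N, (25, 52, 34)%num); (9%N, (32, 56, 1)%num); (6%N, (4, 15, 25)%num); (1%N, (52, 15, 56)%num); (18%N, (3, 4, 8)%num); (5%N, (1, 52, 16)%num); (16%N, (3, 6, 56)%num); (4%N, (4, 6, 32)%num)])].

Definition all_cosystole_ok : bool := all2 cosystole_ok targets cosystole_data.

Lemma all_cosystole_okE : all_cosystole_ok.
Proof. by lazy. Qed.

Lemma bdotE (n : nat) (y x : bvec) : size y = n ->
  \sum_(i < n) (nth false y i && nth false x i)%:R = (bdot y x)%:R :> 'F_2.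
Proof.
elim: y n x => [|a y IHy] n x <- /=; first by rewrite big_ord0.
case: x => [|b x].
  by rewrite big1 // => i _; rewrite nth_nil andbF.
by rewrite big_ord_recl /= (IHy _ x erefl) addbF2.
Qed.

Lemma nth_support L y i : (i < size L)%N ->
  nth false (support L y) i = bdot y (bv (nth N0 L i)).
Proof. by move=> iL; rewrite (nth_map N0). Qed.

Lemma escapesP (a b c : seq bool) : escapes a b c ->
  exists2 i, (i < size a)%N & [&& nth false a i, ~~ nth false b i & ~~ nth false c i].
Proof.
elim: a b c => [|x a IHa] [|y b] [|z c] //=; case: ifP => [/andP[x1 yz] _|_ /IHa[i ia H]].
  by exists 0%N => //=; rewrite x1 -negb_or.
by exists i.+1.
Qed.

Lemma wtE (ms : seq nat) (x : seq bool) n : size ms = n -> size x = n ->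
  wt ms x = (\sum_(i < n) nth 0 ms i * nth false x i)%N.
Proof.
elim: ms x n => [|m ms IHms] [|b x] n <- //=; first by rewrite big_ord0.
case=> sx; rewrite big_ord_recl /= (IHms x (size ms)) //.
by case: b; rewrite ?muln1 ?muln0.
Qed.

Section TargetCosystole.
Variables (R : realType) (L : seq N) (S0 : seq N).
Variables (ms : seq nat) (Q P : nat) (T : seq (nat * (N * N * N))).
Hypothesis signed : signing_ok L S0.
Hypothesis ok : cosystole_ok L (ms, Q, P, T).

(** Vectors and weights are pulled back along the isomorphism [f], so the certificate applies
    directly to [M]. *)
Lemma target_cosystole (E : finType) (M : matroid E) :
  isomorphic M (binary_matroid L) -> is_cosystole3 M (Q%:R / (sumn ms)%:R : R).
Proof.
move=> [f fb fI].
case/and5P: ok => /eqP sms D0 L0 lower /and3P[ni cov PQ].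
have fi := bij_inj fb; have [f' f'K fK'] := fb.
have [g gi dg] := code_col_basis signed.
pose w e := code_col (f e).
have iE I : indep M I = free_on w I by rewrite -fI; exact: free_on_imset.
pose g0 := f' \o g.
have g0i : injective g0 by apply: inj_comp gi; apply: can_inj fK'.
have dg0 : \det (colsmx w g0) != 0.
  have -> // : colsmx w g0 = colsmx (@code_col L) g.
  by apply/matrixP => i j; rewrite !mxE /g0 /= fK'.
pose row (y : bvec) : 'rV['F_2]_6 := (colbv y)^T.
have cocE y e : size y = 6 -> (e \in cocycle w (row y)) = nth false (support L y) (f e).
  move=> sy; rewrite inE nth_support //.
  have -> : (row y *m w e) 0 0 = (bdot y (bv (nth N0 L (f e))))%:R.
    rewrite -(@bdotE 6) // !mxE; apply: eq_bigr => i _.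
    by rewrite !mxE -natrM mulnb.
  by case: bdot.
have sumE (F : 'I_(size L) -> R) : \sum_e F (f e) = \sum_i F i.
  by rewrite (reindex f) //; exists f' => x _.
have D0' : 0 < (sumn ms)%:R :> R by rewrite ltr0n.
pose mu e : R := (nth 0%N ms (f e))%:R / (sumn ms)%:R.
have mu_sum : \sum_e mu e = 1.
  rewrite (sumE (fun i => (nth 0%N ms i)%:R / (sumn ms)%:R)) -mulr_suml -natr_sum.
  have -> : (\sum_(i < size L) nth 0 ms i)%N = sumn ms.
    by rewrite sumnE -sms (big_nth 0%N) big_mkord.
  by rewrite divff // gt_eqF.
have muw : weight mu by split=> // e; rewrite divr_ge0.
have mu_coc y : size y = 6 ->
    measure mu (cocycle w (row y)) = (wt ms (support L y))%:R / (sumn ms)%:R.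
  move=> sy; rewrite measureE.
  under eq_bigr do rewrite cocE //.
  rewrite (sumE (fun i => (nth 0%N ms i)%:R / (sumn ms)%:R * (nth false (support L y) i)%:R)).
  rewrite (wtE sms) ?size_map // natr_sum mulr_suml; apply: eq_bigr => i _.
  by rewrite natrM mulrAC.
pose T1 := [seq (t.1, (row (bv t.2.1.1), row (bv t.2.1.2), row (bv t.2.2))) | t <- T].
have lambda : (\sum_(t <- T1) t.1)%N = sumn (map fst T).
  by rewrite sumnE big_map big_map.
apply: (@is_cosystole3_of_certificate R E M w g0 iE g0i dg0 _ T1 _ _ _ mu muw).
- move=> _ /mapP[t tT ->] /=.
  have esc (x y z : N) : escapes (support L (bv x)) (support L (bv y)) (support L (bv z)) ->
      ~~ (cocycle w (row (bv x)) \subset cocycle w (row (bv y)) :|: cocycle w (row (bv z))).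
    case/escapesP=> i; rewrite size_map => iL /and3P[ix iy iz].
    apply/subsetPn; exists (f' (Ordinal iL)).
      by rewrite cocE ?size_bv // fK'.
    by rewrite inE !cocE ?size_bv // fK' (negPf iy) (negPf iz).
  have /allP/(_ (t.1, triple_supports L t.2)) := ni.
  rewrite (map_f (fun t => (t.1, triple_supports L t.2)) tT) => /(_ isT)/and3P[/= a b c].
  by apply/and3P; split; apply: esc.
- by rewrite lambda.
- move=> e; rewrite lambda.
  apply: (@le_trans _ _ P%:R).
    rewrite ler_nat; apply: leq_trans (all_iotaP cov (ltn_ord (f e))).
    rewrite /cover_sum sumnE !big_map leq_eqVlt; apply/orP; left; apply/eqP.
    by apply: eq_bigr => t _; rewrite /cover /= !cocE ?size_bv.
  by rewrite mulrAC ler_pdivlMr // -!natrM ler_nat.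
- move=> y y0; rewrite -[y]trmxK -[y^T]col_bitsK -/(row _).
  rewrite mu_coc ?size_col_bits // mulrA ler_pM2r ?invr_gt0 //.
  rewrite -natrM ler_nat; apply: (allP lower).
  have := mem_ball (col_bits y^T); rewrite size_col_bits ball_cons in_cons.
  case/orP=> [/eqP yz|//]; case/eqP: y0; rewrite -[y]trmxK -[y^T]col_bitsK yz.
  by apply/matrixP => i j; rewrite !mxE nth_nseq if_same.
Qed.

End TargetCosystole.

Definition target_value (R : realType) (t : nat) : R :=
  let: (ms, Q, _, _) := nth ([::], 0, 0, [::])%N cosystole_data t in
  Q%:R / (sumn ms)%:R.

Lemma target_cosystole3 (R : realType) t (E : finType) (M : matroid E) :
  (t < size targets)%N -> isomorphic M (binary_matroid (nth [::] targets t)) ->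
  is_cosystole3 M (target_value R t).
Proof.
move=> tl iso; have [S ok] := target_signing tl.
have : cosystole_ok (nth [::] targets t) (nth ([::], 0, 0, [::])%N cosystole_data t).
  move: all_cosystole_okE; rewrite /all_cosystole_ok.
  elim: targets cosystole_data t tl {iso ok} => [|L Ls IH] [|d ds] [|t] //= tl /andP[dok dsok].
    exact: dok.
  exact: IH dsok.
rewrite /target_value; case: (nth ([::], 0, 0, [::])%N cosystole_data t) => [[[ms Q] P] T] cok.
exact: target_cosystole ok cok _ _ iso.
Qed.

(** Equality occurs for targets 4, 8 and 10, which are cographic. *)
Lemma target_value_le1 (R : realType) t : (t < size targets)%N -> target_value R t <= 1.
Proof.
move=> tl; rewrite /target_value; set d := nth _ _ _.
have : (let: (ms, Q, _, _) := d in 0 < sumn ms /\ Q <= sumn ms)%N.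
  by rewrite /d {d}; move: tl; do 11?[case: t => [//|t]].
case: d => [[[ms Q] P] T] [D0 QD].
by rewrite ler_pdivrMr ?ltr0n // mul1r ler_nat.
Qed.

Lemma graphic_iso (E F : finType) (M : matroid E) (N : matroid F) :
  isomorphic M N -> graphic N -> graphic M.
Proof. by move=> MN [G NG]; exists G; apply: isomorphic_trans NG. Qed.

Lemma cographic_iso (E F : finType) (M : matroid E) (N : matroid F) :
  isomorphic M N -> cographic N -> cographic M.
Proof. by move=> MN [G NG]; exists G; apply: isomorphic_trans NG. Qed.

Theorem theorem3 (R : realType) (E : finType) (M : matroid E)
  (maxM : maximal_simple_regular 6 M) :
  [\/ graphic M /\ is_cosystole3 M (6 / 7 : R),
      cographic M /\ (exists2 s : R, is_cosystole3 M s & s <= 1)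
    | (isomorphic M P_K3_R10 \/ isomorphic M PT_K5_K33dual) /\
      is_cosystole3 M (12 / 13 : R)].
Proof.
have [t tl iso] := maximal_simple_regular_rank6 maxM.
have cos := target_cosystole3 R tl iso.
(* Targets 0, 1 and 2 are M(K7), [A16] and [A12]. Their weights add up to 7, 13 and 13, so
   [target_value] computes to 6 / 7, 12 / 13 and 12 / 13. *)
case: t tl iso cos => [|[|[|t]]] tl iso cos.
- apply: Or31; split; last exact: cos.
  exact: graphic_iso iso target_graphic.
- apply: Or33; split; last exact: cos.
  by right; apply: isomorphic_trans iso target_A16.
- apply: Or33; split; last exact: cos.
  by left; apply: isomorphic_trans iso target_A12.
- apply: Or32; split; last by exists (target_value R t.+3) => //; apply: target_value_le1.
  by apply: cographic_iso iso _; apply: target_cographic; rewrite tl.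
Qed.
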